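(* Let $n\ge 2$ and consider the ordinary differential equation $y^{(n)}+f(x,y,y',\ldots,y^{(n-1)})=0$, where $f$ is a rational function of $x,y,y',\ldots,y^{(n-1)}$ over $\mathbb{C}$ (possibly also depending rationally on finitely many parameters and/or undetermined functions of $(x,y)$). This equation is linearizable via a point transformation $u=\phi(x,y)$, $t=\psi(x,y)$ if and only if its linearizing differential system $\{S^{=},S^{\neq}\}$ (defined in the context) is consistent, i.e. has a solution.
   Context: Conventions. $y^{(k)}=d^ky/dx^k$, and all functions are assumed to be smooth. Linearizability. The equation $y^{(n)}+f(x,y,y',\ldots,y^{(n-1)})=0$ is linearizable via a point transformation if there is a transformation $u=\phi(x,y)$, $t=\psi(x,y)$, invertible in the sense that $$J:=\phi_x\psi_y-\phi_y\psi_x\neq 0,$$ which maps the equation into a linear homogeneous equation $u^{(n)}(t)+\sum_{k=0}^{n-1}a_k(t)u^{(k)}(t)=0$, $u^{(k)}=d^ku/dt^k$. (If such a transformation exists, then for $n\ge3$ it can always be chosen so that the target has the Laguerre–Forsyth form $u^{(n)}(t)+\sum_{k=0}^{n-3}a_k(t)u^{(k)}(t)=0$, and for $n=2$ so that the target is $u''(t)=0$.) If $f$ depends on parameters or undetermined functions of $(x,y)$, these are treated as additional unknown functions of $(x,y)$ (parameters having zero $x$- and $y$-derivatives), and ''linearizable'' means linearizable for some choice of them. Linearizing differential system. The unknowns are functions $\phi,\psi$ of $(x,y)$ and, if $n\ge 3$, functions $a_0,\ldots,a_{n-3}$ of $(x,y)$ (together with the parameters/undetermined functions in $f$, if any). Treat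 $y',y'',\ldots,y^{(n)}$ as independent variables, let $D=\partial_x+\sum_{k\ge0}y^{(k+1)}\partial_{y^{(k)}}$ be the total derivative, $\Delta:=D\psi=\psi_x+\psi_y y'$, and put $U_0:=\phi$, $U_{k+1}:=D(U_k)/\Delta$ (so $U_k$ expresses $u^{(k)}(t)$). Then $U_n=J\Delta^{-(n+1)}y^{(n)}+P_n(y',\ldots,y^{(n-1)})\,\Delta^{-(2n-1)}$ with $P_n$ polynomial in $y',\ldots,y^{(n-1)}$. Let $$R:=P_n+\Delta^{2n-1}\sum_{k=0}^{n-3}a_kU_k$$ (empty sum if $n=2$). This is a polynomial in $y',\ldots,y^{(n-1)}$, and solving $U_n+\sum_{k=0}^{n-3}a_kU_k=0$ for $y^{(n)}$ gives $y^{(n)}+R/(J\Delta^{n-2})=0$. Let $M$ and $N$ be the numerator and denominator of $f$. The set $S^{=}$ consists of the following partial differential equations: (i) all equations obtained by setting to zero the coefficients of the expression $$R\cdot N-J\cdot M\cdot(\psi_x+\psi_yy')^{n-2}$$ regarded as a polynomial in $y',\ldots,y^{(n-1)}$; (ii) if $n\ge3$, the equations $\psi_y(a_k)_x-\psi_x(a_k)_y=0$ for $k=0,\ldots,n-3$ (expressing that $a_k$ is a function of $t$); (iii) if $f$ contains parameters $p$, the equations $p_x=0$, $p_y=0$ for each of them. The set of inequations is $S^{\neq}=\{J\neq0\}$.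
   Formalization: J is taken as φ_yψ_x − φ_xψ_y, opposite in sign to the printed one, as the formulas for U_n and R require; and parameters and undetermined functions must be chosen, on both sides, so that the denominator N of f is a nonzero polynomial in y',…,y^(n−1) at each point. *)

(* Defs.v *)
From HB Require Import structures.
From mathcomp Require Import all_boot all_order all_algebra.
From mathcomp Require Import all_classical all_reals all_analysis.
(* The notations of mpoly clash with those of mathcomp-analysis. *)
From mathcomp Require Export -(notations) mpoly.
From mathcomp Require Export -(notations) complex.

Set Implicit Arguments.
Unset Strict Implicit.
Unset Printing Implicit Defensive.

Import Order.TTheory GRing.Theory Num.Theory.
Import numFieldNormedType.Exports.

Local Open Scope classical_set_scope.
Local Open Scope ring_scope.

(* Everything is written over a numFieldType K and is used with K := R[i],
   R a realType: derivatives are then complex derivatives, and the variables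
   x, y, t, u are complex. *)

Section Smooth.
Context {K : numFieldType} {V : normedModType K}.

(* f is C^oo near the points of U: all its iterated directional derivatives are
   Frechet-differentiable at every point of U. *)
Definition smooth (U : set V) (f : V -> K) : Prop :=
  forall (vs : seq V) (z : V), U z ->
    differentiable (foldr (fun v g => 'D_v g : V -> K) f vs : V -> K) z.

End Smooth.

Section PlaneFunctions.
Context {K : numFieldType}.

Definition pdx (g : K * K -> K) : K * K -> K := 'D_((1, 0) : K * K) g.
Definition pdy (g : K * K -> K) : K * K -> K := 'D_((0, 1) : K * K) g.

(* The sign is the one for which J is the coefficient of y^(n) in
   Delta^(n+1) U_n for all n >= 2; e.g. U_2 = D(D phi / D psi) / D psi has
   numerator D psi D^2 phi - D phi D^2 psi, in which the coefficient of y'' is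
   (psi_x + psi_y y') phi_y - (phi_x + phi_y y') psi_y.  It is the opposite of
   phi_x psi_y - phi_y psi_x, which does not affect the condition J != 0. *)
Definition jacobian_det (phi psi : K * K -> K) : K * K -> K :=
  pdy phi * pdx psi - pdx phi * pdy psi.

End PlaneFunctions.

(* Polynomials in y', ..., y^(n-1), whose coefficients are polynomials in x, y,
   m parameters and l undetermined functions.  The variable of index i in the
   outer ring is y^(i+1); the 2 + (m + l) variables of the inner ring are, in
   order, x, y, the parameters, the undetermined functions. *)
Definition ode_poly (K : numFieldType) (n m l : nat) :=
  mpoly n.-1 (mpoly (2 + (m + l)) K).

Section RationalEquation.
Context {K : numFieldType} {n m l : nat}.
Variables (p : 'I_m -> K * K -> K) (q : 'I_l -> K * K -> K).

Definition base_point (z : K * K) (i : 'I_(2 + (m + l))) : K :=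
  match fintype.split i with
  | inl j => if j == 0 :> nat then z.1 else z.2
  | inr j => match fintype.split j with inl j1 => p j1 z | inr j2 => q j2 z end
  end.

(* The polynomial in y', ..., y^(n-1) obtained at the point z. *)
Definition specialize (P : ode_poly K n m l) (z : K * K) : mpoly n.-1 K :=
  map_mpoly (meval (base_point z)) P.

(* f = M / N is a well-defined rational function of y', ..., y^(n-1) over each
   point of U; this only restricts the choice of p and q. *)
Definition denominator_nonzero (U : set (K * K)) (N : ode_poly K n m l) :=
  forall z, U z -> specialize N z != 0.

Definition eval_along (P : ode_poly K n m l) (y : K -> K) (x : K) : K :=
  meval (fun i : 'I_n.-1 => derive1n i.+1 y x) (specialize P (x, y x)).

Definition source_equation (M N : ode_poly K n m l) (y : K -> K) (x : K) :=
  derive1n n y x + eval_along M y x / eval_along N y x = 0.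

End RationalEquation.

Definition linear_equation {K : numFieldType} (n : nat) (a : 'I_n -> K -> K)
    (u : K -> K) (t : K) :=
  derive1n n u t + \sum_(k < n) a k t * derive1n k u t = 0.

(* (phi, psi) sends the curve y = y(x), x in I, to the curve u = u(t).  The
   condition on the derivative makes t = psi(x, y(x)) a local coordinate on the
   curve. *)
Definition transforms {K : numFieldType} (phi psi : K * K -> K)
    (I T : set K) (y u : K -> K) : Prop :=
  forall x, I x ->
    [/\ 'D_1 (fun s => psi (s, y s) : K) x != 0,
        T (psi (x, y x)) & u (psi (x, y x)) = phi (x, y x)].

Definition maps_to_linear {K : numFieldType} {n m l : nat}
    (M N : ode_poly K n m l) (p : 'I_m -> K * K -> K) (q : 'I_l -> K * K -> K)
    (U : set (K * K)) (phi psi : K * K -> K) (a : 'I_n -> K -> K) : Prop :=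
  forall (I T : set K) (y u : K -> K),
    open I -> smooth I y -> open T -> smooth T u ->
    (forall x, I x -> U (x, y x) /\ eval_along p q N y x != 0) ->
    transforms phi psi I T y u ->
    forall x, I x ->
      source_equation p q M N y x <-> linear_equation a u (psi (x, y x)).

(* Point transformations are local: they are defined on some nonempty open
   subset of the (x, y)-space. *)
Definition linearizable {K : numFieldType} {n m l : nat}
    (M N : ode_poly K n m l) : Prop :=
  exists (U : set (K * K)) (V : set K) (c : 'I_m -> K)
         (q : 'I_l -> K * K -> K) (phi psi : K * K -> K) (a : 'I_n -> K -> K),
    let p i := cst (c i) in
    [/\ open U /\ U !=set0,
        (forall j, smooth U (q j)) /\ denominator_nonzero p q U N,
        [/\ smooth U phi, smooth U psi
          & forall z, U z -> jacobian_det phi psi z != 0],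
        [/\ open V, psi @` U `<=` V & forall k, smooth V (a k)]
      & maps_to_linear M N p q U phi psi a].

Section JetPolynomials.
Context {K : numFieldType} (n : nat).

(* Polynomials in y', ..., y^(n), the variable of index i being y^(i+1), over
   the ring of functions of (x, y) with pointwise operations. *)
Definition jet_poly := mpoly n (K * K -> K).

Definition cstJ (g : K * K -> K) : jet_poly := mpolyC n g.

Definition varJ (i : 'I_n) : jet_poly := mpolyX _ (mnm1 i).

(* y^(k) for 1 <= k <= n; it is 0 for the other values of k. *)
Definition jet (k : nat) : jet_poly := \sum_(i < n | i.+1 == k) varJ i.

(* The total derivative.  As jet n.+1 = 0, it has its meaning on polynomials in
   y', ..., y^(n-1) only, which is where it is used to build U_0, ..., U_n. *)
Definition Dtot (P : jet_poly) : jet_poly :=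
  map_mpoly pdx P + jet 1 * map_mpoly pdy P
  + \sum_(i < n) jet i.+2 * mderiv i P.

Variables (phi psi : K * K -> K).

Definition Delta : jet_poly := Dtot (cstJ psi).

(* The pair (Q, e) stands for the fraction Q / Delta^e. *)
Definition jet_frac := (jet_poly * nat)%type.

Definition DtotF (F : jet_frac) : jet_frac :=
  let: (Q, e) := F in
  if e == 0 then (Dtot Q, 0%N)
  else (Delta * Dtot Q - Q * Dtot Delta *+ e, e.+1).

Definition divDelta (F : jet_frac) : jet_frac := (F.1, F.2.+1).

Definition Ufrac (k : nat) : jet_frac :=
  iter k (fun F => divDelta (DtotF F)) (cstJ phi, 0%N).

Lemma Ufrac_exponent k : (Ufrac k).2 = (2 * k - 1)%N.
Proof.
have odd_exp j : (2 * j.+1 - 1 = (2 * j).+1)%N by rewrite mulnS.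
case: k => // k; elim: k => [//|k IHk].
rewrite /Ufrac iterS -/(Ufrac k.+1); case: (Ufrac k.+1) IHk => Q e /= ->.
by rewrite !odd_exp mulnS.
Qed.

Definition Jac : jet_poly := cstJ (jacobian_det phi psi).

(* U_n = (Ufrac n).1 / Delta^(2 n - 1), while the term J Delta^(-(n+1)) y^(n) of
   U_n has numerator J Delta^(n-2) y^(n) over the same denominator. *)
Definition Pn : jet_poly := (Ufrac n).1 - Jac * Delta ^+ (n - 2) * jet n.

Definition Rpoly (a : 'I_(n - 2) -> K * K -> K) : jet_poly :=
  Pn + \sum_(k < n - 2)
         cstJ (a k) * (Ufrac k).1 * Delta ^+ (2 * n - 1 - (Ufrac k).2).

Definition lift_ode_poly {m l : nat} (p : 'I_m -> K * K -> K)
    (q : 'I_l -> K * K -> K) (P : ode_poly K n m l) : jet_poly :=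
  mmap (fun b => cstJ (fun z => meval (base_point p q z) b))
       (fun i => varJ (widen_ord (leq_pred n) i)) P.

End JetPolynomials.

Section LinearizingSystem.
Context {K : numFieldType} {n m l : nat}.
Variables (M N : ode_poly K n m l) (U : set (K * K)).
Variables (phi psi : K * K -> K) (a : 'I_(n - 2) -> K * K -> K).
Variables (p : 'I_m -> K * K -> K) (q : 'I_l -> K * K -> K).

Definition system_expression : jet_poly n :=
  Rpoly phi psi a * lift_ode_poly p q N
  - Jac n phi psi * lift_ode_poly p q M * Delta n psi ^+ (n - 2).

Definition system_equations : Prop :=
  [/\ forall mon z, U z -> mcoeff mon system_expression z = 0,
      forall k z, U z -> (pdy psi * pdx (a k) - pdx psi * pdy (a k)) z = 0
    & forall i z, U z -> pdx (p i) z = 0 /\ pdy (p i) z = 0].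

Definition system_inequations : Prop :=
  forall z, U z -> jacobian_det phi psi z != 0.

End LinearizingSystem.

Definition linearizing_system_consistent {K : numFieldType} {n m l : nat}
    (M N : ode_poly K n m l) : Prop :=
  exists (U : set (K * K)) (phi psi : K * K -> K)
         (a : 'I_(n - 2) -> K * K -> K)
         (p : 'I_m -> K * K -> K) (q : 'I_l -> K * K -> K),
    [/\ open U /\ U !=set0,
        [/\ smooth U phi, smooth U psi & forall k, smooth U (a k)],
        [/\ forall i, smooth U (p i), forall j, smooth U (q j)
          & denominator_nonzero p q U N],
        system_equations M N U phi psi a p q
      & system_inequations U phi psi].

(* Main.v *)
(* Along a curve y = y(x) that is carried to u = u(t), the chain rule identifies
   the fractions U_k with the derivatives of u.  On the jet of the curve this gives
     Delta^(2n-1) (U_n + sum_k a_k U_k) N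
       = (R N - J M Delta^(n-2)) + J Delta^(n-2) (y^(n) N + M),
   where J and Delta do not vanish.
   If the system holds, the middle term vanishes, so the linear equation for u is
   equivalent to the equation for y; the a_k are functions of t because of (ii) and
   the implicit function theorem.
   Conversely, a linear equation is brought locally to its Laguerre-Forsyth form by
   u = G v, dh = w^-2 dt, where G and w solve linear equations of orders one and
   two.  Every jet (x, y, y', ..., y^(n-1)) at which N and Delta do not vanish is that
   of a curve, a Taylor polynomial, whose y^(n) can be chosen to solve the given
   equation at x; then the image of the curve solves the linear equation at the
   corresponding t, and the middle term vanishes at the jet.  Hence N Delta times the
   middle term vanishes as a polynomial in y', ..., y^(n-1), and so does the middle
   term.
   The complex analysis rests on antiderivatives on discs, obtained as limits of
   Riemann sums along radii; linear equations are solved by Picard iteration. *)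
From HB Require Import structures.
Require Import Defs.
From mathcomp Require Import all_boot all_order all_algebra.
From mathcomp Require Import all_classical all_reals all_analysis.
From mathcomp Require Import ring lra.

Set Implicit Arguments.
Unset Strict Implicit.
Unset Printing Implicit Defensive.

Import Order.TTheory GRing.Theory Num.Theory.
Import numFieldNormedType.Exports.

Local Open Scope classical_set_scope.
Local Open Scope ring_scope.

(** * Smooth functions *)

(** [maps_to_linear] is an equivalence at each single point, along arbitrary curves and not only
    along solutions. Hence a polynomial curve that satisfies the equation at one point already tests
    the transformation there, and the identity above can be read jet by jet. The factors N and Delta
    are carried along because jets where one of them vanishes offer no admissible curve. As J != 0
    forces the gradient of psi to be nonzero, both are nonzero polynomials over each point, and a
    polynomial ring over K has no zero divisors. In the normal form two coefficients are to be
    removed and two functions can be chosen: the gauge G removes the term of order n - 1, and the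
    change of variable h that of order n - 2. The latter is a Riccati equation for half the
    logarithmic derivative of h', which w linearizes. [smooth] speaks only of iterated
    differentiability on a set. Limits are first shown to be differentiable once; an equation
    expressing their derivative through themselves then raises the order step by step. The same
    bootstrap serves reciprocals and implicit functions. *)

Section SmoothClosure.
Context {K : numFieldType} {V : normedModType K}.
Implicit Types (U W : set V) (f g : V -> K).

(** Finite orders allow induction: the derivative of a product, a reciprocal or a composite involves
    the same functions again, at an order lower by one. *)
Fixpoint nsmooth (k : nat) (U : set V) (f : V -> K) : Prop :=
  if k is k'.+1 then
    (forall z, U z -> differentiable f z) /\ forall v, nsmooth k' U ('D_v f)
  else True.

Lemma smoothP U f : smooth U f <-> forall k, nsmooth k U f.
Proof.
split=> [sf k|sf vs].
  elim: k f sf => [//|k IHk] f sf; split=> [z Uz|v]; first exact: (sf [::] z Uz).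
  by apply: IHk => vs z Uz; have := sf (rcons vs v) z Uz; rewrite foldr_rcons.
(* [foldr] differentiates along the last direction of the list first, so lists are taken apart from
   the end. *)
elim/last_ind: vs f sf => [|vs v IHvs] f sf; first exact: (sf 1%N).1.
by rewrite foldr_rcons; apply: IHvs => k; exact: (sf k.+1).2.
Qed.

Lemma smooth_differentiable U f z : smooth U f -> U z -> differentiable f z.
Proof. by move=> sf /(sf [::]). Qed.

Lemma smooth_derive U f v : smooth U f -> smooth U ('D_v f).
Proof. by move=> /smoothP sf; apply/smoothP => k; exact: (sf k.+1).2. Qed.

Lemma nsmoothW k U f : nsmooth k.+1 U f -> nsmooth k U f.
Proof.
elim: k f => [//|k IHk] f [df Df]; split=> // v.
by apply: IHk; exact: Df.
Qed.

Lemma derive_near_eq U f g v z : open U -> U z ->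
  (forall x, U x -> f x = g x) -> 'D_v f z = 'D_v g z.
Proof.
move=> oU Uz fg; have [->|v0] := eqVneq v 0; first by rewrite !derive0.
apply: near_eq_derive => //.
by near=> x; apply: fg; near: x; exact: open_nbhs_nbhs.
Unshelve. all: by end_near. Qed.

(** The first-order expansion at z depends only on the germ, so g inherits that of f, and
    [diff_unique] identifies its linear part with the differential of g. *)
Lemma differentiable_near_eq U f g z : open U -> U z ->
  (forall x, U x -> f x = g x) -> differentiable f z -> differentiable g z.
Proof.
move=> oU Uz fg /diff_locallyP [dfc dfE].
have nU : \forall h \near (0 : V), U (h + z).
  have : \near z, U z by exact: open_nbhs_nbhs.
  by rewrite (near_shift 0) subr0.
have Eg : g \o shift z = cst (g z) + 'd f z +o_ (0 : V) id.
  apply/eqaddoP => e e0; have /eqaddoP /(_ e e0) := dfE.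
  apply: filterS2 nU => h Uh.
  rewrite -[X in `|X| <= _ -> _]/(f (h + z) - (f z + 'd f z h)).
  rewrite -[X in _ -> `|X| <= _]/(g (h + z) - (g z + 'd f z h)).
  by rewrite !fg.
by apply/diff_locallyP; rewrite (diff_unique dfc Eg).
Qed.

Lemma nsmooth_eq k U f g : open U -> (forall z, U z -> f z = g z) ->
  nsmooth k U f -> nsmooth k U g.
Proof.
move=> oU; elim: k f g => [//|k IHk] f g fg [df Df]; split=> [z Uz|v].
  exact: (differentiable_near_eq oU Uz fg (df z Uz)).
apply: (IHk ('D_v f)); last exact: Df.
by move=> z Uz; exact: (derive_near_eq v oU Uz fg).
Qed.

Lemma smooth_subset U W f : W `<=` U -> smooth U f -> smooth W f.
Proof. by move=> WU sf vs z /WU; exact: sf. Qed.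

Lemma smooth_cst U (c : K) : smooth U (cst c).
Proof.
apply/smoothP => k; elim: k c => [//|k IHk] c; split=> [z _|v].
  exact: differentiable_cst.
have -> : 'D_v (cst c : V -> K) = cst 0 by apply/funext => z; rewrite derive_cst.
exact: IHk.
Qed.

Lemma nsmoothD k U f g : open U -> nsmooth k U f -> nsmooth k U g ->
  nsmooth k U (f + g).
Proof.
move=> oU; elim: k f g => [//|k IHk] f g [df Df] [dg Dg]; split=> [z Uz|v].
  by apply: differentiableD; [exact: df|exact: dg].
apply: (@nsmooth_eq _ _ ('D_v f + 'D_v g)) => //; last first.
  by apply: IHk; [exact: Df|exact: Dg].
move=> z Uz; rewrite deriveD //; apply: diff_derivable; [exact: df|exact: dg].
Qed.

Lemma nsmoothM k U f g : open U -> nsmooth k U f -> nsmooth k U g ->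
  nsmooth k U (f * g).
Proof.
move=> oU; elim: k f g => [//|k IHk] f g sf sg.
have [df Df] := sf; have [dg Dg] := sg; split=> [z Uz|v].
  by apply: differentiableM; [exact: df|exact: dg].
apply: (@nsmooth_eq _ _ (f * 'D_v g + g * 'D_v f)) => //.
  move=> z Uz; rewrite deriveM //; apply: diff_derivable; [exact: df|exact: dg].
apply: nsmoothD => //; apply: IHk; do ?exact: nsmoothW; [exact: Dg|exact: Df].
Qed.

Lemma smoothD U f g : open U -> smooth U f -> smooth U g -> smooth U (f + g).
Proof.
by move=> oU /smoothP sf /smoothP sg; apply/smoothP => k; exact: nsmoothD.
Qed.

Lemma smoothM U f g : open U -> smooth U f -> smooth U g -> smooth U (f * g).
Proof.
by move=> oU /smoothP sf /smoothP sg; apply/smoothP => k; exact: nsmoothM.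
Qed.

Lemma smoothN U f : open U -> smooth U f -> smooth U (- f).
Proof.
move=> oU sf; rewrite -mulN1r; apply: smoothM => //.
exact: (@smooth_cst U (- 1)).
Qed.

Lemma smoothB U f g : open U -> smooth U f -> smooth U g -> smooth U (f - g).
Proof. by move=> oU sf sg; apply: smoothD => //; exact: smoothN. Qed.

Lemma smooth_sum I (r : seq I) (P : pred I) U (F : I -> V -> K) : open U ->
  (forall i, P i -> smooth U (F i)) -> smooth U (\sum_(i <- r | P i) F i).
Proof.
move=> oU sF; elim/big_ind: _ => //; first exact: smooth_cst.
by move=> f g; exact: smoothD.
Qed.

Lemma smoothMn U f n : open U -> smooth U f -> smooth U (f *+ n).
Proof.
move=> oU sf; elim: n => [|n IHn]; first exact: smooth_cst.
by rewrite mulrS; exact: smoothD.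
Qed.

Lemma smoothX U f n : open U -> smooth U f -> smooth U (f ^+ n).
Proof.
move=> oU sf; elim: n => [|n IHn]; first exact: smooth_cst.
by rewrite exprS; exact: smoothM.
Qed.

(** The reciprocal occurs in its own derivative, - f' / f^2, which gains one order at a time. *)
Lemma smoothV U f : open U -> (forall z, U z -> f z != 0) -> smooth U f ->
  smooth U (fun z => (f z)^-1).
Proof.
move=> oU f0 sf; apply/smoothP => k; elim: k => [//|k IHk]; split=> [z Uz|v].
  by apply: differentiableV; [exact: smooth_differentiable sf _|exact: f0].
apply: (@nsmooth_eq _ _ ((fun z => (f z)^-1) * (fun z => (f z)^-1) * (- 'D_v f))) => //.
  move=> z Uz; rewrite deriveV; [|exact: f0|]; last first.
    by apply: diff_derivable; exact: smooth_differentiable sf _.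
  rewrite -[LHS]/((f z)^-1 * (f z)^-1 * - 'D_v f z).
  by rewrite -exprVn expr2 scaleNr mulrN.
apply: nsmoothM => //; first exact: nsmoothM.
have /smoothP := smoothN oU (smooth_derive v sf); exact.
Qed.

End SmoothClosure.

(** * Chain rules and smoothness of composites *)

Section SmoothComposition.
Context {K : numFieldType} {V : normedModType K}.
Implicit Types (U : set V) (g : V -> K).

Lemma derive_comp1 (h : K -> K) g z v :
  differentiable g z -> differentiable h (g z) ->
  'D_v (h \o g) z = 'D_1 h (g z) * 'D_v g z.
Proof.
move=> dg dh; rewrite [LHS]deriveE; last exact: (@differentiable_comp _ _ _ _ g h).
rewrite diff_comp // /= !deriveE //.
by rewrite -[in LHS](mulr1 ('d g z v)) -[in LHS]/('d g z v *: 1) linearZ mulrC.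
Qed.

Lemma smooth_comp U (W : set K) (h : K -> K) g : open U ->
  smooth W h -> smooth U g -> (forall z, U z -> W (g z)) ->
  smooth U (h \o g).
Proof.
move=> oU sh sg Wg; apply/smoothP => k; elim: k h sh => [//|k IHk] h sh.
split=> [z Uz|v].
  apply: (@differentiable_comp _ _ _ _ g h).
    exact: smooth_differentiable sg _.
  by apply: smooth_differentiable sh _; exact: Wg.
apply: (@nsmooth_eq _ _ _ _ (('D_1 h \o g) * 'D_v g)) => //.
  move=> z Uz; have dg : differentiable g z by exact: smooth_differentiable sg _.
  have dh : differentiable h (g z) by apply: smooth_differentiable sh _; exact: Wg.
  by rewrite derive_comp1.
apply: nsmoothM => //; first by apply: IHk; exact: smooth_derive.
by have /smoothP := smooth_derive v sg; exact.
Qed.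

Lemma derive_comp2 (f : K * K -> K) g1 g2 z v :
  differentiable g1 z -> differentiable g2 z -> differentiable f (g1 z, g2 z) ->
  'D_v (fun z => f (g1 z, g2 z)) z =
  pdx f (g1 z, g2 z) * 'D_v g1 z + pdy f (g1 z, g2 z) * 'D_v g2 z.
Proof.
move=> d1 d2 df; have dp := differentiable_pair d1 d2.
rewrite deriveE; last exact: (@differentiable_comp _ _ _ _ (fun z => (g1 z, g2 z)) f).
rewrite (@diff_comp _ _ _ _ (fun z => (g1 z, g2 z)) f) // /= diff_pair //=.
rewrite /pdx /pdy !deriveE //.
have -> : ('d g1 z v, 'd g2 z v) =
  'd g1 z v *: ((1, 0) : K * K) + 'd g2 z v *: ((0, 1) : K * K).
  have E (x y : K) : (x, y) = (x * 1 + y * 0, x * 0 + y * 1).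
    by rewrite !mulr1 !mulr0 addr0 add0r.
  exact: E.
by rewrite linearD !linearZ /= mulrC [X in _ + X]mulrC.
Qed.

(** The inner functions carry a finite order only: the solution of the implicit function theorem is
    inserted here while its smoothness is still being proved. *)
Lemma nsmooth_comp2 k U (W : set (K * K)) (f : K * K -> K) g1 g2 : open U ->
  smooth W f -> nsmooth k U g1 -> nsmooth k U g2 ->
  (forall z, U z -> W (g1 z, g2 z)) ->
  nsmooth k U (fun z => f (g1 z, g2 z)).
Proof.
move=> oU sf s1 s2 Wg; elim: k f sf s1 s2 => [//|k IHk] f sf s1 s2.
have [d1 D1] := s1; have [d2 D2] := s2.
have df z : U z -> differentiable f (g1 z, g2 z).
  by move=> Uz; apply: smooth_differentiable sf _; exact: Wg.
split=> [z Uz|v].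
  apply: (@differentiable_comp _ _ _ _ (fun z => (g1 z, g2 z)) f); last exact: df.
  by apply: differentiable_pair; [exact: d1|exact: d2].
apply: (@nsmooth_eq _ _ _ _ ((fun z => pdx f (g1 z, g2 z)) * 'D_v g1
                         + (fun z => pdy f (g1 z, g2 z)) * 'D_v g2)) => //.
  by move=> z Uz; rewrite derive_comp2 //; [exact: d1|exact: d2|exact: df].
apply: nsmoothD => //; apply: nsmoothM => //.
- by apply: IHk; [exact: smooth_derive|exact: nsmoothW|exact: nsmoothW].
- exact: D1.
- by apply: IHk; [exact: smooth_derive|exact: nsmoothW|exact: nsmoothW].
- exact: D2.
Qed.

Lemma smooth_comp2 U (W : set (K * K)) (f : K * K -> K) g1 g2 : open U ->
  smooth W f -> smooth U g1 -> smooth U g2 ->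
  (forall z, U z -> W (g1 z, g2 z)) ->
  smooth U (fun z => f (g1 z, g2 z)).
Proof.
move=> oU sf /smoothP s1 /smoothP s2 Wg; apply/smoothP => k.
exact: (nsmooth_comp2 oU sf (s1 k) (s2 k) Wg).
Qed.

End SmoothComposition.

(** * Coordinate functions, partial derivatives and curves in the plane *)

Section SmoothPlane.
Context {K : numFieldType}.

Lemma is_diff_fst (z : K * K) : is_diff z (fst : K * K -> K) fst.
Proof.
have cf : continuous (fst : K * K -> K) by move=> x; exact: cvg_fst.
apply: DiffDef.
  exact: (@linear_differentiable K (K * K)%type K^o (fst : {linear (K * K)%type -> K^o})).
exact: (@diff_lin K (K * K)%type K^o (fst : {linear (K * K)%type -> K^o})).
Qed.

Lemma is_diff_snd (z : K * K) : is_diff z (snd : K * K -> K) snd.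
Proof.
have cf : continuous (snd : K * K -> K) by move=> x; exact: cvg_snd.
apply: DiffDef.
  exact: (@linear_differentiable K (K * K)%type K^o (snd : {linear (K * K)%type -> K^o})).
exact: (@diff_lin K (K * K)%type K^o (snd : {linear (K * K)%type -> K^o})).
Qed.

Lemma derive_fst (v z : K * K) : 'D_v (fst : K * K -> K) z = v.1.
Proof.
by have [d e] := is_diff_fst z; rewrite deriveE // e.
Qed.

Lemma derive_snd (v z : K * K) : 'D_v (snd : K * K -> K) z = v.2.
Proof.
by have [d e] := is_diff_snd z; rewrite deriveE // e.
Qed.

Lemma smooth_fst (U : set (K * K)) : smooth U (fst : K * K -> K).
Proof.
apply/smoothP => -[//|k]; split=> [z _|v].
  by have [] := is_diff_fst z.
have -> : 'D_v (fst : K * K -> K) = cst v.1.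
  by apply/funext => z; rewrite derive_fst.
by have /smoothP := @smooth_cst _ _ U v.1; exact.
Qed.

Lemma smooth_snd (U : set (K * K)) : smooth U (snd : K * K -> K).
Proof.
apply/smoothP => -[//|k]; split=> [z _|v].
  by have [] := is_diff_snd z.
have -> : 'D_v (snd : K * K -> K) = cst v.2.
  by apply/funext => z; rewrite derive_snd.
by have /smoothP := @smooth_cst _ _ U v.2; exact.
Qed.

Lemma smooth_id (I : set K) : smooth I (id : K -> K).
Proof.
apply/smoothP => -[//|k]; split=> [z _|v]; first exact: ex_diff.
have -> : 'D_v (id : K -> K) = cst v by apply/funext => z; rewrite derive_id.
by have /smoothP := @smooth_cst _ _ I v; exact.
Qed.

Lemma pdx_comp (h : K -> K) (g : K * K -> K) z :
  differentiable g z -> differentiable h (g z) ->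
  pdx (h \o g) z = derive1 h (g z) * pdx g z.
Proof. by move=> dg dh; rewrite derive1E; exact: derive_comp1. Qed.

Lemma pdy_comp (h : K -> K) (g : K * K -> K) z :
  differentiable g z -> differentiable h (g z) ->
  pdy (h \o g) z = derive1 h (g z) * pdy g z.
Proof. by move=> dg dh; rewrite derive1E; exact: derive_comp1. Qed.

Lemma derive1_chain (h g : K -> K) x :
  differentiable g x -> differentiable h (g x) ->
  derive1 (h \o g) x = derive1 h (g x) * derive1 g x.
Proof. by move=> dg dh; rewrite !derive1E; exact: derive_comp1. Qed.

Lemma smooth_derive1 (I : set K) (y : K -> K) : smooth I y -> smooth I (derive1 y).
Proof.
move=> sy; have -> : derive1 y = 'D_1 y by apply/funext => x; rewrite derive1E.
exact: smooth_derive.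
Qed.

Lemma smooth_derive1n (I : set K) (y : K -> K) k :
  smooth I y -> smooth I (derive1n k y).
Proof. by move=> sy; elim: k => [//|k IHk]; exact: smooth_derive1. Qed.

Lemma smooth_pdx (U : set (K * K)) (f : K * K -> K) : smooth U f -> smooth U (pdx f).
Proof. exact: smooth_derive. Qed.

Lemma smooth_pdy (U : set (K * K)) (f : K * K -> K) : smooth U f -> smooth U (pdy f).
Proof. exact: smooth_derive. Qed.

Lemma derive1_plane_curve (f : K * K -> K) (y : K -> K) x :
  differentiable y x -> differentiable f (x, y x) ->
  derive1 (fun s => f (s, y s)) x = pdx f (x, y x) + pdy f (x, y x) * derive1 y x.
Proof.
move=> dy df; rewrite !derive1E (@derive_comp2 _ _ f id y) //.
by congr (_ + _); rewrite derive_id; exact: mulr1.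
Qed.

(** The differential is linear over K, so the derivative of F in the direction v is v f: F is smooth
    to one order more than f. This gain drives the regularity of solutions of differential
    equations. *)
Lemma nsmooth_primitive (I : set K) (f F : K -> K) k : open I -> nsmooth k I f ->
  (forall z, I z -> differentiable F z /\ derive1 F z = f z) -> nsmooth k.+1 I F.
Proof.
move=> oI sf HF; split=> [z /HF[]//|v].
apply: (@nsmooth_eq _ _ _ _ (cst v * f)) => //.
  move=> z Iz; have [dF E] := HF z Iz.
  rewrite -[LHS]/(v * f z) -E derive1E !deriveE //.
  by rewrite -[in RHS](mulr1 v) -[in RHS]/(v *: 1) linearZ.
apply: nsmoothM => //.
by have /smoothP := @smooth_cst _ _ I v; exact.
Qed.

End SmoothPlane.

(** * Real-valued moduli *)

(* The estimates are real inequalities, whereas the norm of a numFieldType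
   takes its values in the field itself. *)
Record real_norm (R : realType) (K : numFieldType) := RealNorm {
  ofreal : {rmorphism R -> K};
  rnorm : K -> R;
  ofreal_le : {mono ofreal : x y / x <= y};
  rnormE : forall z, `|z| = ofreal (rnorm z);
  rnorm_complete : forall (u : nat -> K) (B : R),
    (forall k, rnorm (u k.+1 - u k) <= B / 2 ^+ k) ->
    exists l, forall k, rnorm (l - u k) <= 4 * B / 2 ^+ k }.

Section Estimates.
Context {R : realType} {K : numFieldType} (N : real_norm R K).
Local Notation cnorm := (rnorm N).
Local Notation "x %:C" := (ofreal N x).
Implicit Types (z w : K) (r e : R).

Lemma ofrealI : injective (ofreal N).
Proof. exact: fmorph_inj. Qed.

Lemma ofreal_lt : {mono ofreal N : x y / x < y}.
Proof. exact: leW_mono (ofreal_le N). Qed.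

Lemma cnorm_ge0 z : 0 <= cnorm z.
Proof. by rewrite -(ofreal_le N) rmorph0 -(rnormE N). Qed.

Lemma cnorm0 : cnorm 0 = 0. Proof. by apply: ofrealI; rewrite -(rnormE N) normr0 rmorph0. Qed.

Lemma cnorm_eq0 z : cnorm z = 0 -> z = 0.
Proof. by move=> z0; apply/eqP; rewrite -normr_eq0 (rnormE N) z0 rmorph0. Qed.

Lemma cnorm_gt0 z : z != 0 -> 0 < cnorm z.
Proof. by move=> z0; rewrite lt_neqAle cnorm_ge0 eq_sym andbT; apply: contra_neq z0 => /cnorm_eq0. Qed.

Lemma cnormM z w : cnorm (z * w) = cnorm z * cnorm w.
Proof. by apply: ofrealI; rewrite -(rnormE N) normrM !(rnormE N) rmorphM. Qed.

Lemma cnormD z w : cnorm (z + w) <= cnorm z + cnorm w.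
Proof. by rewrite -(ofreal_le N) rmorphD /= -!(rnormE N) ler_normD. Qed.

Lemma cnormN z : cnorm (- z) = cnorm z.
Proof. by apply: ofrealI; rewrite -!(rnormE N) normrN. Qed.

Lemma cnormB z w : cnorm (z - w) = cnorm (w - z).
Proof. by rewrite -cnormN opprB. Qed.

Lemma cnormV z : cnorm (z^-1) = (cnorm z)^-1.
Proof. by apply: ofrealI; rewrite -(rnormE N) normfV !(rnormE N) fmorphV. Qed.

Lemma cnorm_real (x : R) : cnorm (x%:C) = `|x|.
Proof.
apply: ofrealI; rewrite -(rnormE N); have [x0|x0] := leP 0 x.
  by rewrite (ger0_norm x0) ger0_norm // -(rmorph0 (ofreal N)) ofreal_le.
rewrite (ltr0_norm x0) ler0_norm ?rmorphN //.
by rewrite -(rmorph0 (ofreal N)) ofreal_le ltW.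
Qed.

Lemma cnorm_sum I (s : seq I) (P : pred I) (F : I -> K) :
  cnorm (\sum_(i <- s | P i) F i) <= \sum_(i <- s | P i) cnorm (F i).
Proof.
elim/big_ind2: _ => [|x x' y y' h h'|//]; first by rewrite cnorm0.
by apply: le_trans (cnormD _ _) _; exact: lerD.
Qed.

Definition disc z r : set K := fun w : K => cnorm (w - z) < r.

Lemma discE z r : disc z r = ball z r%:C.
Proof.
by apply/seteqP; split=> w; rewrite -ball_normE /disc /= (rnormE N) ofreal_lt cnormB.
Qed.

Lemma open_disc z r : open (disc z r).
Proof. by rewrite discE; exact: ball_open. Qed.

Lemma disc_center z r : 0 < r -> disc z r z.
Proof. by move=> r0; rewrite /disc /= subrr cnorm0. Qed.

Lemma nbhs_disc z (A : set K) : nbhs z A -> exists2 r, 0 < r & disc z r `<=` A.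
Proof.
move=> /nbhs_ballP [e /= e0 eA].
have eR : e = (cnorm e)%:C by rewrite -(rnormE N) gtr0_norm.
exists (cnorm e); last by rewrite discE -eR.
by apply: cnorm_gt0; rewrite gt_eqF.
Qed.

Lemma open_ex_disc z (A : set K) : open A -> A z ->
  exists2 r, 0 < r & disc z r `<=` A.
Proof. by move=> oA Az; apply: nbhs_disc; exact: open_nbhs_nbhs. Qed.

Lemma disc_nbhs z r : 0 < r -> nbhs z (disc z r).
Proof.
by move=> r0; apply: open_nbhs_nbhs; split; [exact: open_disc|exact: disc_center].
Qed.

Lemma open_ex_bidisc (z : K * K) (A : set (K * K)) : open A -> A z ->
  exists2 r, 0 < r & disc z.1 r `*` disc z.2 r `<=` A.
Proof.
move=> oA Az; have [[P Q] [/= nP nQ] PQ] : nbhs z A by exact: open_nbhs_nbhs.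
have [r r0 rP] := nbhs_disc nP; have [s s0 sQ] := nbhs_disc nQ.
exists (Num.min r s); first by rewrite lt_min r0.
move=> [x y] [/= xr ys]; apply: PQ; split=> /=.
  by apply: rP; rewrite /disc /= in xr *; move: xr; rewrite lt_min => /andP[].
by apply: sQ; rewrite /disc /= in ys *; move: ys; rewrite lt_min => /andP[].
Qed.

Lemma open_bidisc (z : K * K) r s : open (disc z.1 r `*` disc z.2 s).
Proof.
have -> : disc z.1 r `*` disc z.2 s = fst @^-1` disc z.1 r `&` snd @^-1` disc z.2 s.
  by apply/seteqP; split.
apply: openI; apply: open_comp; try exact: open_disc; move=> x _.
  exact: cvg_fst.
exact: cvg_snd.
Qed.

End Estimates.

(** * Differentiability by linear approximation *)

Section LinearApproximation.
Context {R : realType} {K : numFieldType} (N : real_norm R K).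
Local Notation cnorm := (rnorm N).
Local Notation "x %:C" := (ofreal N x).

Lemma ofreal_gt0 (x : R) : 0 < x -> 0 < x%:C.
Proof. by rewrite -(rmorph0 (ofreal N)) ofreal_lt. Qed.

Lemma gt0_ofreal (x : K) : 0 < x -> x = (cnorm x)%:C /\ 0 < cnorm x.
Proof.
by move=> x0; rewrite -(rnormE N) gtr0_norm //; split=> //; apply: cnorm_gt0; rewrite gt_eqF.
Qed.

Lemma linear_approx (f : K -> K) (z : K) : differentiable f z ->
  forall e : R, 0 < e -> exists2 d : R, 0 < d & forall w, disc N z d w ->
    cnorm (f w - f z - derive1 f z * (w - z)) <= e * cnorm (w - z).
Proof.
move=> /derivable1_diffP /derivable_nbhs /eqaddoP df e e0.
have /nbhs_disc-/(_ _ N) [d d0 dA] := df _ (ofreal_gt0 e0).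
exists d => // w wd.
have /dA : disc N 0 d (w - z) by rewrite /disc /= subr0.
rewrite -[X in `|X| <= _ -> _]/(f ((w - z) *: 1 + z) - (f z + (w - z) *: 'D_1 f z)).
rewrite -[X in _ * `|X|]/(w - z) -[(w - z) *: 1]/((w - z) * 1) mulr1 subrK.
rewrite -derive1E opprD addrA -[(w - z) *: _]/((w - z) * _).
rewrite [in X in X -> _](mulrC (w - z)) !(rnormE N) -rmorphM /=.
by rewrite (ofreal_le N).
Qed.

Lemma approx_differentiable (f : K -> K) (z l : K) :
  (forall e : R, 0 < e -> exists2 d : R, 0 < d & forall w, disc N z d w ->
    cnorm (f w - f z - l * (w - z)) <= e * cnorm (w - z)) ->
  differentiable f z /\ derive1 f z = l.
Proof.
move=> fl.
have cl : (fun h : K => h^-1 *: ((f \o shift z) (h *: 1) - f z)) @ 0^' --> l.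
  apply/cvgrPdist_le => e e0.
  have [eE eR0] := gt0_ofreal e0.
  have [d d0 dA] := fl _ eR0.
  have n0 : nbhs (0 : K) (disc N 0 d) by exact: disc_nbhs.
  rewrite near_withinE; apply: filterS n0 => h hd h0.
  have {hd}hd : disc N z d (h + z).
    by move: hd; rewrite /disc /= subr0 addrK.
  rewrite /= -[h *: 1]/(h * 1) mulr1 -[_ *: (_ - f z)]/(_ * _).
  rewrite eE (rnormE N) (ofreal_le N).
  have hn0 := cnorm_gt0 N h0.
  rewrite -(ler_pM2l hn0) -cnormM mulrBr mulrA divff // mul1r.
  by have := dA _ hd; rewrite addrK cnormB [l * h]mulrC [cnorm e * _]mulrC.
have df : derivable f z 1 by apply: cvgP cl.
split; first exact/derivable1_diffP.
by rewrite derive1E; exact: (cvg_lim _ cl).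
Qed.

Lemma plane_norm_le (h : K * K) : `|h| <= `|h.1| + `|h.2|.
Proof.
rewrite prod_normE /Order.max; case: ifP => _; first by rewrite lerDr.
by rewrite lerDl.
Qed.

Lemma plane_norm_ge (h : K * K) : `|h.1| + `|h.2| <= 2 * `|h|.
Proof.
rewrite mulr2n mulrDl mul1r prod_normE /Order.max; case: ifP => [/ltW h12|].
  by rewrite lerD2r.
by move/negbT; rewrite -real_leNgt ?normr_real // => h21; rewrite lerD2l.
Qed.

Lemma linear_approx2 (f : K * K -> K) (z : K * K) : differentiable f z ->
  forall e : R, 0 < e -> exists2 d : R, 0 < d &
    forall w, disc N z.1 d w.1 -> disc N z.2 d w.2 ->
    cnorm (f w - f z - (pdx f z * (w.1 - z.1) + pdy f z * (w.2 - z.2)))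
      <= e * (cnorm (w.1 - z.1) + cnorm (w.2 - z.2)).
Proof.
move=> df e e0.
have /eqaddoP/(_ _ (ofreal_gt0 e0)) A0 := diff_locally df.
have [[P Q] [/= nP nQ] PQ] := A0.
have [r r0 rP] := nbhs_disc N nP; have [s s0 sQ] := nbhs_disc N nQ.
exists (Num.min r s); first by rewrite lt_min r0.
move=> w w1 w2.
have : P (w - z).1 /\ Q (w - z).2.
  split; [apply: rP|apply: sQ]; rewrite /disc /= subr0.
    by move: w1; rewrite /disc /= lt_min => /andP[].
  by move: w2; rewrite /disc /= lt_min => /andP[].
move=> /PQ.
rewrite -[X in `|X| <= _ -> _]/(f ((w - z) + z) - (f z + 'd f z (w - z))).
rewrite -[X in _ * `|X|]/(w - z) subrK opprD addrA.
have -> : 'd f z (w - z) = pdx f z * (w.1 - z.1) + pdy f z * (w.2 - z.2).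
  have -> : w - z = (w.1 - z.1) *: ((1, 0) : K * K) + (w.2 - z.2) *: ((0, 1) : K * K).
    rewrite -[RHS]/(_ * _ + _ * _, _ * _ + _ * _) /=.
    by congr pair; rewrite ?mulr1 ?mulr0 ?addr0 ?add0r.
  by rewrite linearD !linearZ /= /pdx /pdy !deriveE // mulrC [X in _ + X]mulrC.
move=> H; rewrite -(ofreal_le N) -(rnormE N) rmorphM rmorphD /= -!(rnormE N).
apply: le_trans H _; rewrite ler_pM2l; last exact: ofreal_gt0.
exact: plane_norm_le.
Qed.

Lemma approx_differentiable2 (f : K * K -> K) (z : K * K) (a b : K) :
  (forall e : R, 0 < e -> exists2 d : R, 0 < d &
    forall w, disc N z.1 d w.1 -> disc N z.2 d w.2 ->
    cnorm (f w - f z - (a * (w.1 - z.1) + b * (w.2 - z.2)))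
      <= e * (cnorm (w.1 - z.1) + cnorm (w.2 - z.2))) ->
  [/\ differentiable f z, pdx f z = a & pdy f z = b].
Proof.
move=> fab.
(* The candidate differential is presented as the differential of a function g, which provides the
   linearity and continuity that [diff_unique] asks for. *)
pose g : K * K -> K := cst a * fst + cst b * snd.
have [d1 e1] := is_diff_fst z; have [d2 e2] := is_diff_snd z.
have dg1 : differentiable (cst a * fst : K * K -> K) z.
  by apply: differentiableM.
have dg2 : differentiable (cst b * snd : K * K -> K) z.
  by apply: differentiableM.
have dg : differentiable g z by apply: differentiableD.
have gE h : 'd g z h = a * h.1 + b * h.2.
  rewrite -deriveE // deriveD; try exact: diff_derivable.
  rewrite !deriveM; try exact: diff_derivable.
  rewrite !derive_cst derive_fst derive_snd !scaler0 !addr0.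
  by [].
have Ef : f \o shift z = cst (f z) + 'd g z +o_ (0 : K * K) id.
  apply/eqaddoP => e e0.
  have [eE eR0] := gt0_ofreal e0.
  (* Half of e, since the sum of the moduli of the coordinates is at most twice the norm of the
     plane, which is their maximum. *)
  have e20 : 0 < cnorm e / 2 by lra.
  have [d d0 dA] := fab _ e20.
  have n0 : nbhs (0 : K * K) (disc N 0 d `*` disc N 0 d).
    apply: open_nbhs_nbhs; split.
      by have := @open_bidisc _ _ N ((0, 0) : K * K) d d; exact.
    by split; exact: disc_center.
  apply: filterS n0 => h [/= h1 h2].
  rewrite -[X in `|X| <= _]/(f (h + z) - (f z + 'd g z h)) -[X in _ * `|X|]/h.
  have := dA (h + z); rewrite /disc /= !addrK.
  move: h1 h2; rewrite /disc /= !subr0 => h1 h2 /(_ h1 h2).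
  rewrite gE !opprD !addrA -(ofreal_le N) -(rnormE N) => H; apply: le_trans H _.
  rewrite rmorphM rmorphD /= -!(rnormE N) fmorph_div /= -eE rmorph_nat.
  rewrite -mulrA ler_pM2l // mulrC ler_pdivrMr // mulrC.
  exact: plane_norm_ge.
have dE := diff_unique (diff_continuous dg) Ef.
have df : differentiable f z by apply/diff_locallyP; rewrite dE; split=> //; exact: diff_continuous.
have gE1 (x y : K) : 'd g z (x, y) = a * x + b * y := gE (x, y).
have E1 : a * 1 + b * 0 = a by rewrite mulr1 mulr0 addr0.
have E2 : a * 0 + b * 1 = b by rewrite mulr1 mulr0 add0r.
split; [exact: df| |].
  by rewrite /pdx deriveE; [rewrite dE gE1; exact: E1|exact: df].
by rewrite /pdy deriveE; [rewrite dE gE1; exact: E2|exact: df].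
Qed.

End LinearApproximation.

(** * The mean value inequality *)

Section RealAuxiliary.
Context {R : realType}.

(** Compactness of [0, 1] as a continuous induction: the supremum of the t with [P 0 t] is attained
    and cannot lie below 1. The local hypothesis concerns only intervals containing x, the ones on
    which differentiability at x gives an estimate. *)
Lemma interval_induction (P : R -> R -> Prop) :
  (forall s t u, 0 <= s -> s <= t -> t <= u -> u <= 1 -> P s t -> P t u -> P s u) ->
  (forall x, 0 <= x -> x <= 1 -> exists2 d, 0 < d & forall s t, 0 <= s -> s <= x ->
     x <= t -> t <= 1 -> x - d < s -> t < x + d -> P s t) ->
  P 0 1.
Proof.
move=> trP locP.
pose S := [set t : R | [/\ 0 <= t, t <= 1 & P 0 t]].
have S0 : S 0.
  by have [d d0 dP] := locP 0 (lexx _) ler01; split=> //; apply: dP; lra.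
have hS : has_sup S.
  by split; [exists 0 | exists 1 => t []].
have x0 : 0 <= sup S by apply: sup_upper_bound.
have x1 : sup S <= 1 by apply: ge_sup; [exists 0 | move=> t []].
have [d d0 dP] := locP _ x0 x1.
have [t [t0 t1 Pt] xt] := sup_adherent d0 hS.
have tx : t <= sup S by apply: sup_upper_bound.
pose u := Num.min 1 (sup S + d / 2).
have xu : sup S <= u by rewrite /u le_min x1 /=; lra.
have u1 : u <= 1 by rewrite /u ge_min lexx.
have ud : u < sup S + d by rewrite /u gt_min; apply/orP; right; lra.
have Su : S u.
  split=> //; first by lra.
  by apply: (trP 0 t u) => //; [lra | apply: dP].
have ux : u <= sup S by exact: sup_upper_bound.
have u1E : u = 1.
  by move: ux; rewrite /u; have [|] := leP 1 (sup S + d / 2); lra.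
by move: Su; rewrite u1E => -[].
Qed.

Lemma exists_pow2_le (c e : R) : 0 < e -> exists k, c / 2 ^+ k <= e.
Proof.
move=> e0; have [c0|c0] := leP c 0.
  by exists 0%N; rewrite expr0 divr1; lra.
exists (Num.bound (c / e)).
have := archi_boundP (ltW (divr_gt0 c0 e0)); set k := Num.bound _ => ck.
have k2 : (k%:R : R) <= 2 ^+ k.
  by rewrite -natrX ler_nat; exact: ltnW (ltn_expl _ _).
rewrite ler_pdivrMr ?exprn_gt0 // mulrC -ler_pdivrMr //; lra.
Qed.

Lemma le_of_pow2 (x y c : R) : (forall k, x <= y + c / 2 ^+ k) -> x <= y.
Proof.
move=> H; rewrite leNgt; apply/negP => yx.
have e0 : 0 < (x - y) / 2 by lra.
by have [k kP] := exists_pow2_le c e0; have := H k; lra.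
Qed.

End RealAuxiliary.

Section MeanValue.
Context {R : realType} {K : numFieldType} (N : real_norm R K).
Local Notation cnorm := (rnorm N).
Local Notation "x %:C" := (ofreal N x).

Lemma disc_convex (z a b : K) (r th : R) : disc N z r a -> disc N z r b ->
  0 <= th -> th <= 1 -> disc N z r (a + th%:C * (b - a)).
Proof.
rewrite /disc /= => ra rb t0 t1.
have -> : a + th%:C * (b - a) - z = (1 - th)%:C * (a - z) + th%:C * (b - z).
  by rewrite rmorphB rmorph1; ring.
apply: le_lt_trans (cnormD _ _ _) _.
rewrite !cnormM !cnorm_real !ger0_norm //; last by lra.
have [ab|ab] := leP (cnorm (a - z)) (cnorm (b - z)).
  have : 0 <= (1 - th) * (cnorm (b - z) - cnorm (a - z)) by (apply: mulr_ge0; lra). lra.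
have : 0 <= th * (cnorm (a - z) - cnorm (b - z)) by (apply: mulr_ge0; lra).
lra.
Qed.

(** Bounds on increments add up over adjacent intervals. With B + e in place of B they hold on small
    intervals around each point, by splitting the interval at that point; the slack e absorbs the
    error of the linear approximation. *)
Lemma mean_value_ineq (f : K -> K) (a b : K) (B : R) :
  (forall th, 0 <= th -> th <= 1 -> differentiable f (a + th%:C * (b - a)) /\
     cnorm (derive1 f (a + th%:C * (b - a))) <= B) ->
  cnorm (f b - f a) <= B * cnorm (b - a).
Proof.
move=> H; pose g th := a + th%:C * (b - a).
have gB s t : g t - g s = (t - s)%:C * (b - a).
  by rewrite /g rmorphB; ring.
have g0 : g 0 = a by rewrite /g rmorph0 mul0r addr0.
have g1 : g 1 = b by rewrite /g rmorph1 mul1r addrC subrK.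
have Kge := cnorm_ge0 N.
suff Pe e : 0 < e -> cnorm (f b - f a) <= (B + e) * cnorm (b - a).
  apply: (@le_of_pow2 _ _ _ (cnorm (b - a))) => k.
  have e0 : 0 < (2 ^+ k : R)^-1 by rewrite invr_gt0 exprn_gt0.
  have := Pe _ e0; lra.
move=> e0.
rewrite -g1 -g0; have -> : (B + e) * cnorm (g 1 - g 0) = (B + e) * (1 - 0) * cnorm (b - a).
  by rewrite g0 g1; ring.
pose P s t := cnorm (f (g t) - f (g s)) <= (B + e) * (t - s) * cnorm (b - a).
apply: (@interval_induction _ P); rewrite /P.
  move=> s t u _ _ _ _ h1 h2.
  have := cnormD N (f (g u) - f (g t)) (f (g t) - f (g s)); rewrite addrA subrK; lra.
move=> x x0 x1; have [df dB] := H x x0 x1.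
have [d d0 dA] := linear_approx N df e0.
(* The added 1 keeps the divisor positive when a = b. *)
have c1 : 0 < cnorm (b - a) + 1 by have := Kge (b - a); lra.
exists (d / (cnorm (b - a) + 1)); first by rewrite divr_gt0.
move=> s t s0 sx xt t1 sd td.
have near u : `|u - x| < d / (cnorm (b - a) + 1) ->
    cnorm (f (g u) - f (g x)) <= (B + e) * `|u - x| * cnorm (b - a).
  rewrite ltr_pdivlMr // => ux.
  have E : cnorm (g u - g x) = `|u - x| * cnorm (b - a).
    by rewrite gB cnormM cnorm_real.
  have /dA : disc N (g x) d (g u).
    rewrite /disc /= E; have := normr_ge0 (u - x); lra.
  have := cnormD N (f (g u) - f (g x) - derive1 f (g x) * (g u - g x))
                   (derive1 f (g x) * (g u - g x)).
  rewrite subrK cnormM E.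
  have : cnorm (derive1 f (g x)) * (`|u - x| * cnorm (b - a)) <=
         B * (`|u - x| * cnorm (b - a)).
    by apply: ler_wpM2r => //; rewrite mulr_ge0.
  lra.
have tx : `|t - x| = t - x by rewrite ger0_norm //; lra.
have sx' : `|s - x| = x - s by rewrite distrC ger0_norm //; lra.
have := near t; rewrite tx => Ht.
have := near s; rewrite sx' => Hs.
have {}Ht : cnorm (f (g t) - f (g x)) <= (B + e) * (t - x) * cnorm (b - a).
  by apply: Ht; lra.
have {}Hs : cnorm (f (g s) - f (g x)) <= (B + e) * (x - s) * cnorm (b - a).
  by apply: Hs; lra.
have := cnormD N (f (g t) - f (g x)) (f (g x) - f (g s)).
rewrite addrA subrK (cnormB N (f (g x))); lra.
Qed.

Lemma disc_mean_value (f : K -> K) (z : K) (r B : R) (a b : K) :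
  (forall w, disc N z r w -> differentiable f w /\ cnorm (derive1 f w) <= B) ->
  disc N z r a -> disc N z r b -> cnorm (f b - f a) <= B * cnorm (b - a).
Proof.
move=> H za zb; apply: mean_value_ineq => th t0 t1; apply: H.
exact: disc_convex.
Qed.

Lemma disc_constant (f : K -> K) (z : K) (r : R) (a b : K) :
  (forall w, disc N z r w -> differentiable f w /\ derive1 f w = 0) ->
  disc N z r a -> disc N z r b -> f a = f b.
Proof.
move=> H za zb; apply/eqP; rewrite eq_sym -subr_eq0; apply/eqP.
apply: (@cnorm_eq0 _ _ N); apply/eqP; rewrite eq_le cnorm_ge0 andbT.
rewrite -[leRHS](mul0r (cnorm (b - a))).
apply: disc_mean_value za zb => w /H[dw ->]; rewrite cnorm0; split=> //.
Qed.

(** The mean value inequality is used twice: applied to G', it bounds the derivative of G minus its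
    tangent h, and applied to h, it bounds the increment. *)
Lemma taylor2_ineq (G : K -> K) (a b : K) (B : R) :
  (forall th, 0 <= th -> th <= 1 -> let w := a + th%:C * (b - a) in
    [/\ differentiable G w, differentiable (derive1 G) w &
        cnorm (derive1 (derive1 G) w) <= B]) ->
  cnorm (G b - G a - derive1 G a * (b - a)) <= B * cnorm (b - a) ^+ 2.
Proof.
move=> H.
have B0 : 0 <= B.
  by have [_ _] := H 0 (lexx _) ler01; apply: le_trans; exact: cnorm_ge0.
have slope th : 0 <= th -> th <= 1 ->
    cnorm (derive1 G (a + th%:C * (b - a)) - derive1 G a) <= B * cnorm (b - a).
  move=> t0 t1.
  have S : cnorm (derive1 G (a + th%:C * (b - a)) - derive1 G a) <=
           B * cnorm (a + th%:C * (b - a) - a).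
    apply: mean_value_ineq => s s0 s1.
    have -> : a + s%:C * (a + th%:C * (b - a) - a) = a + (s * th)%:C * (b - a).
      by rewrite rmorphM; ring.
    have p0 : 0 <= s * th by apply: mulr_ge0.
    have p1 : s * th <= 1 by apply: mulr_ile1.
    by have [_ h2 h3] := H _ p0 p1.
  apply: le_trans S _; rewrite addrC addKr cnormM cnorm_real ger0_norm //.
  by rewrite ler_wpM2l // ler_piMl // cnorm_ge0.
pose l := derive1 G a.
pose h : K -> K := G - cst l * id.
have -> : G b - G a - derive1 G a * (b - a) = h b - h a.
  by rewrite /h /l -[(G - _) b]/(G b - _ * b) -[(G - _) a]/(G a - _ * a) /cst; ring.
rewrite expr2 mulrA; apply: mean_value_ineq => th t0 t1.
have [dG _ _] := H th t0 t1.
have dl : differentiable (cst l * id : K -> K) (a + th%:C * (b - a)).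
  by apply: differentiableM.
split; first by apply: differentiableB.
suff -> : derive1 h (a + th%:C * (b - a)) = derive1 G (a + th%:C * (b - a)) - l.
  exact: slope.
rewrite !derive1E deriveB; try exact: diff_derivable.
rewrite deriveM; try exact: diff_derivable.
by rewrite derive_cst derive_id -[l *: 1]/(l * 1) scaler0 addr0 mulr1.
Qed.

(** With the common value at z0, the mean value inequality turns the bounds on derivatives into
    bounds on the functions, so both sequences converge geometrically. The limit is differentiable
    because F j - F k is Lipschitz with a constant bounded uniformly in j. *)
Lemma uniform_limit (F : nat -> K -> K) (z0 : K) (r B : R) :
  (forall k, smooth (disc N z0 r) (F k)) -> (forall k, F k z0 = F 0 z0) ->
  0 < r -> 
  (forall k w, disc N z0 r w ->
     cnorm (derive1 (F k.+1) w - derive1 (F k) w) <= B / 2 ^+ k) ->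
  exists L : K -> K, L z0 = F 0 z0 /\ forall w, disc N z0 r w ->
    [/\ differentiable L w, forall k, cnorm (L w - F k w) <= 4 * (B * r) / 2 ^+ k
      & forall k, cnorm (derive1 L w - derive1 (F k) w) <= 4 * B / 2 ^+ k].
Proof.
move=> sF Fz0 r0 FB; set D := disc N z0 r.
have Dz0 : D z0 by exact: disc_center.
have oD : open D by exact: open_disc.
have dF k w : D w -> differentiable (F k) w by exact: smooth_differentiable.
have p2 k : 0 < (2 ^+ k : R)^-1 by rewrite invr_gt0 exprn_gt0.
have B0 : 0 <= B.
  by have := FB 0%N z0 Dz0; rewrite expr0 divr1; apply: le_trans; exact: cnorm_ge0.
have dB j k w : D w -> derive1 (F j - F k) w = derive1 (F j) w - derive1 (F k) w.
  by move=> Dw; rewrite !derive1E deriveB //; apply: diff_derivable; exact: dF.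
have MV j k (c : R) v w : D v -> D w ->
    (forall x, D x -> cnorm (derive1 (F j) x - derive1 (F k) x) <= c) ->
    cnorm ((F j v - F k v) - (F j w - F k w)) <= c * cnorm (v - w).
  move=> Dv Dw H.
  apply: (@disc_mean_value (F j - F k) z0 r) => // x Dx; split.
    by apply: differentiableB; exact: dF.
  by rewrite dB //; exact: H.
have LF w : exists l, D w -> forall k, cnorm (l - F k w) <= 4 * (B * r) / 2 ^+ k.
  have [Dw|nD] := pselect (D w); last by exists 0.
  have [|l lP] := @rnorm_complete _ _ N (fun k => F k w) (B * r); last by exists l.
  move=> k; have := @MV k.+1 k _ w z0 Dw Dz0 (FB k).
  rewrite !Fz0 subrr subr0 => /le_trans; apply.
  rewrite -mulrA [B * r / _]mulrAC -mulrA; apply: ler_wpM2l => //.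
  apply: ler_wpM2l; [exact: ltW|exact: ltW].
have [L LP] := choice LF.
have lF w : exists l, D w -> forall k, cnorm (l - derive1 (F k) w) <= 4 * B / 2 ^+ k.
  have [Dw|nD] := pselect (D w); last by exists 0.
  have [|l lP] := @rnorm_complete _ _ N (fun k => derive1 (F k) w) B; last by exists l.
  by move=> k; exact: FB.
have [l lP] := choice lF.
have Lz0 : L z0 = F 0 z0.
  apply/eqP; rewrite -subr_eq0; apply/eqP; apply: (@cnorm_eq0 _ _ N).
  apply/eqP; rewrite eq_le cnorm_ge0 andbT.
  apply: (@le_of_pow2 _ _ _ (4 * (B * r))) => k; rewrite add0r -(Fz0 k).
  exact: LP.
exists L; split=> // w Dw.
suff [dL lE] : differentiable L w /\ derive1 L w = l w.
  by split=> //; [exact: LP | rewrite lE; exact: lP].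
apply: (@approx_differentiable _ _ N) => e e0.
(* 12 = 8 + 4, from the bounds [S1] and [S3] below; the other half of e is left to the linear
   approximation of F k. *)
have [k kP] := exists_pow2_le (12 * B) (divr_gt0 e0 (ltr0Sn R 1)).
have e20 : 0 < e / 2 by lra.
have [d d0 dA] := linear_approx N (dF k w Dw) e20.
have [d' d'0 dD] := open_ex_disc N oD Dw.
exists (Num.min d d'); first by rewrite lt_min d0.
move=> v; rewrite {1}/disc /= lt_min => /andP[vd vd'].
have Dv : D v by exact: dD.
(* L is compared with F k through F j; all errors depending on j disappear as j grows. *)
have S1 : cnorm ((L v - F k v) - (L w - F k w)) <= 8 * B / 2 ^+ k * cnorm (v - w).
  apply: (@le_of_pow2 _ _ _ (8 * (B * r) + 4 * B * cnorm (v - w))) => j.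
  have c x : D x -> cnorm (derive1 (F j) x - derive1 (F k) x) <= 4 * B / 2 ^+ j + 4 * B / 2 ^+ k.
    move=> Dx; have := lP x Dx j; have := lP x Dx k.
    have := cnormD N (derive1 (F j) x - l x) (l x - derive1 (F k) x).
    rewrite addrA subrK (cnormB N _ (l x)); lra.
  have := MV j k _ v w Dv Dw c.
  have := LP v Dv j; have := LP w Dw j.
  have -> : L v - F k v - (L w - F k w) =
    (L v - F j v) + ((F j v - F k v - (F j w - F k w)) + (F j w - L w)) by ring.
  have := cnormD N (L v - F j v) (F j v - F k v - (F j w - F k w) + (F j w - L w)).
  have := cnormD N (F j v - F k v - (F j w - F k w)) (F j w - L w).
  rewrite (cnormB N _ (L w)).
  have : 0 <= 4 * B / 2 ^+ k * cnorm (v - w).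
    by rewrite mulr_ge0 ?cnorm_ge0 // mulr_ge0 ?(ltW (p2 k)) //; lra.
  lra.
have S2 := dA v vd.
have S3 : cnorm ((l w - derive1 (F k) w) * (v - w)) <= 4 * B / 2 ^+ k * cnorm (v - w).
  by rewrite cnormM; apply: ler_wpM2r; [exact: cnorm_ge0 | exact: lP].
have -> : L v - L w - l w * (v - w) =
  (L v - F k v - (L w - F k w)) + ((F k v - F k w - derive1 (F k) w * (v - w))
   - (l w - derive1 (F k) w) * (v - w)) by ring.
have := cnormD N (L v - F k v - (L w - F k w)) ((F k v - F k w - derive1 (F k) w * (v - w))
   - (l w - derive1 (F k) w) * (v - w)).
have := cnormD N (F k v - F k w - derive1 (F k) w * (v - w)) (- ((l w - derive1 (F k) w) * (v - w))).
rewrite cnormN.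
have : 12 * B / 2 ^+ k * cnorm (v - w) <= e / 2 * cnorm (v - w).
  by apply: ler_wpM2r => //; exact: cnorm_ge0.
lra.
Qed.

End MeanValue.

(** * Antiderivatives *)

Section OneVariable.
Context {K : numFieldType}.
Implicit Types (f g : K -> K) (z : K).

Lemma derive1D f g z : differentiable f z -> differentiable g z ->
  derive1 (f + g) z = derive1 f z + derive1 g z.
Proof. by move=> df dg; rewrite !derive1E deriveD //; exact: diff_derivable. Qed.

Lemma derive1M f g z : differentiable f z -> differentiable g z ->
  derive1 (f * g) z = derive1 f z * g z + f z * derive1 g z.
Proof.
move=> df dg; rewrite !derive1E deriveM; try exact: diff_derivable.
by rewrite addrC [g z *: _]mulrC.
Qed.

Lemma derive1V f z : differentiable f z -> f z != 0 ->
  derive1 (fun z : K => (f z)^-1) z = - derive1 f z / f z ^+ 2.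
Proof.
move=> df f0; rewrite !derive1E deriveV //; last exact: diff_derivable.
by rewrite -[_ *: _]/(_ * _) mulrC mulNr mulrN.
Qed.

Lemma derive1_sum n (F : 'I_n -> K -> K) z : (forall i, differentiable (F i) z) ->
  derive1 (\sum_(i < n) F i) z = \sum_(i < n) derive1 (F i) z.
Proof.
move=> dF; rewrite derive1E derive_sum; last by move=> i; exact: diff_derivable.
by apply: eq_bigr => i _; rewrite derive1E.
Qed.

Lemma derive1_near_eq (U : set K) f g z : open U -> U z ->
  (forall x, U x -> f x = g x) -> derive1 f z = derive1 g z.
Proof. by move=> oU Uz fg; rewrite !derive1E; exact: (derive_near_eq _ oU Uz fg). Qed.

Lemma smooth_primitive (U : set K) (f F : K -> K) : open U -> smooth U f ->
  (forall z, U z -> differentiable F z /\ derive1 F z = f z) -> smooth U F.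
Proof.
move=> oU sf HF; apply/smoothP => -[//|k]; apply: (nsmooth_primitive oU _ HF).
by have /smoothP := sf; exact.
Qed.

Lemma differentiable_affine (c d z : K) : differentiable (fun s : K => c + s * d) z.
Proof.
by apply: (@differentiableD _ _ _ (cst c) (id * cst d : K -> K)).
Qed.

Lemma derive1_affine (c d z : K) : derive1 (fun s : K => c + s * d) z = d.
Proof.
have -> : (fun s : K => c + s * d) = cst c + (id * cst d : K -> K) by [].
have dM : differentiable (id * cst d : K -> K) z by exact: differentiableM.
rewrite derive1D // derive1M // !derive1E !derive_cst derive_id.
by rewrite mulr0 addr0 add0r mul1r.
Qed.

Lemma smooth_affine (U : set K) (c d : K) : open U -> smooth U (fun s : K => c + s * d).
Proof.
move=> oU; apply: (@smoothD _ _ _ (cst c) (id * cst d : K -> K)) => //.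
  exact: smooth_cst.
by apply: smoothM => //; [exact: smooth_id | exact: smooth_cst].
Qed.

End OneVariable.

Section Antiderivative.
Context {R : realType} {K : numFieldType} (N : real_norm R K).
Local Notation cnorm := (rnorm N).
Local Notation "x %:C" := (ofreal N x).

Section Riemann.
Variables (z0 : K) (r : R) (f : K -> K) (B : R).
Let D := disc N z0 r.
Hypotheses (r0 : 0 < r) (sf : smooth D f).
Hypothesis f1B : forall w, D w -> cnorm (derive1 f w) <= B.
Hypothesis f2B : forall w, D w -> cnorm (derive1 (derive1 f) w) <= B.

Let oD : open D. Proof. exact: open_disc. Qed.

Let df w : D w -> differentiable f w. Proof. exact: smooth_differentiable. Qed.

Let df1 w : D w -> differentiable (derive1 f) w.
Proof. by apply: smooth_differentiable; exact: smooth_derive1. Qed.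

Let Dseg z (th : R) : D z -> 0 <= th -> th <= 1 -> D (z0 + th%:C * (z - z0)).
Proof. by move=> Dz t0 t1; apply: disc_convex => //; exact: disc_center. Qed.

(** [G z] goes from 0 at s = 0 to f z at s = 1, and its derivative in s is the derivative in z of (z
    - z0) f (z0 + s (z - z0)), the integrand of the antiderivative along the segment from z0. *)
Let G (z s : K) : K := s * f (z0 + s * (z - z0)).

Let G1 z s : D (z0 + s * (z - z0)) -> differentiable (G z) s /\
  derive1 (G z) s = f (z0 + s * (z - z0)) + s * (z - z0) * derive1 f (z0 + s * (z - z0)).
Proof.
move=> Ds; pose p := fun s : K => z0 + s * (z - z0).
have dfp : differentiable (f \o p) s.
  apply: (@differentiable_comp _ _ _ _ p f); last exact: df.
  exact: differentiable_affine.
have -> : G z = id * (f \o p) by [].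
split; first exact: differentiableM.
have dp : differentiable p s by exact: differentiable_affine.
have dfs : differentiable f (p s) by exact: df.
have did : differentiable (id : K -> K) s by [].
rewrite (derive1M did dfp) (derive1_chain dp dfs) derive1_affine derive1E derive_id.
rewrite mul1r -[id s]/s /p /=.
by rewrite [derive1 f _ * _]mulrC mulrA.
Qed.

Let G2 z s : D (z0 + s * (z - z0)) -> differentiable (derive1 (G z)) s /\
  derive1 (derive1 (G z)) s =
    2 * (z - z0) * derive1 f (z0 + s * (z - z0)) +
    s * (z - z0) ^+ 2 * derive1 (derive1 f) (z0 + s * (z - z0)).
Proof.
move=> Ds; pose p := fun s : K => z0 + s * (z - z0).
have oE : open (p @^-1` D).
  apply: open_comp => // x _; apply: differentiable_continuous.
  exact: differentiable_affine.
pose g : K -> K := (f \o p) + ((id * cst (z - z0)) * (derive1 f \o p) : K -> K).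
have dp t : differentiable p t by exact: differentiable_affine.
have dfp : differentiable (f \o p) s.
  by apply: (@differentiable_comp _ _ _ _ p f) => //; exact: df.
have dfp1 : differentiable (derive1 f \o p) s.
  by apply: (@differentiable_comp _ _ _ _ p (derive1 f)) => //; exact: df1.
have dM : differentiable (id * cst (z - z0) : K -> K) s by exact: differentiableM.
have dg : differentiable g s.
  by apply: differentiableD => //; exact: differentiableM.
have Gg t : (p @^-1` D) t -> g t = derive1 (G z) t by move=> /G1[_ ->].
split; first exact: (differentiable_near_eq oE Ds Gg).
have e1 : derive1 (f \o p) s = derive1 f (p s) * (z - z0).
  by rewrite derive1_chain ?derive1_affine //; exact: df.
have e2 : derive1 (derive1 f \o p) s = derive1 (derive1 f) (p s) * (z - z0).
  by rewrite derive1_chain ?derive1_affine //; exact: df1.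
have e3 : derive1 (id * cst (z - z0) : K -> K) s = z - z0.
  by rewrite derive1M // !derive1E derive_id derive_cst mulr0 addr0 mul1r.
rewrite -(derive1_near_eq oE Ds Gg) (derive1D dfp); last exact: differentiableM.
rewrite (derive1M dM dfp1) e1 e2 e3.
rewrite -[(id * cst (z - z0)) s]/(s * (z - z0)) -[(_ \o p) s]/(derive1 f (p s)) /p.
ring.
Qed.

(** Left Riemann sums with 2^k nodes, which makes their errors geometric. The affine maps have the
    shape c + z * d of [differentiable_affine]. *)
Let rs (k : nat) : K -> K :=
  \sum_(j < 2 ^ k) (cst ((2 ^+ k)^-1)%:C *
    ((fun z : K => - z0 + z * 1) * (f \o (fun z : K => (1 - (j%:R / 2 ^+ k)%:C) * z0 + z * (j%:R / 2 ^+ k)%:C)))).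

Let theta k (j : nat) : R := j%:R / 2 ^+ k.

Let p2 k : 0 < (2 ^+ k : R). Proof. exact: exprn_gt0. Qed.

Let theta01 k j : (j <= 2 ^ k)%N -> 0 <= theta k j /\ theta k j <= 1.
Proof.
move=> jk; split; first by rewrite divr_ge0 // ltW.
by rewrite ler_pdivrMr // mul1r -natrX ler_nat.
Qed.

Let argE (th : R) z : (1 - th%:C) * z0 + z * th%:C = z0 + th%:C * (z - z0).
Proof. ring. Qed.

Let term (c th : K) : K -> K :=
  cst c * ((fun z : K => - z0 + z * 1) * (f \o (fun z : K => (1 - th) * z0 + z * th))).

Let smooth_term c (th : R) : 0 <= th -> th <= 1 -> smooth D (term c th%:C).
Proof.
move=> t0 t1; apply: smoothM => //; first exact: smooth_cst.
apply: smoothM => //; first exact: smooth_affine.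
apply: (@smooth_comp _ _ _ D) => //; first exact: smooth_affine.
by move=> z Dz; rewrite argE; exact: Dseg.
Qed.

Let derive_term c (th : R) z : 0 <= th -> th <= 1 -> D z ->
  derive1 (term c th%:C) z = c * derive1 (G z) th%:C.
Proof.
move=> t0 t1 Dz.
have Dt := Dseg Dz t0 t1.
have [_ ->] := G1 Dt.
have dcomp : differentiable (f \o (fun z : K => (1 - th%:C) * z0 + z * th%:C)) z.
  apply: (@differentiable_comp _ _ _ _ (fun z : K => (1 - th%:C) * z0 + z * th%:C) f).
    exact: differentiable_affine.
  by apply: df; rewrite argE.
have da := @differentiable_affine K (- z0) 1 z.
have dcst : differentiable (cst c : K -> K) z by [].
rewrite (derive1M dcst (differentiableM da dcomp)) (derive1M da dcomp) derive1_chain; last 2 first.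
- exact: differentiable_affine.
- by apply: df; rewrite argE.
rewrite !derive1_affine derive1E derive_cst /= argE /cst; ring.
Qed.

Let rsE k : rs k = \sum_(j < 2 ^ k) term ((2 ^+ k)^-1)%:C (theta k j)%:C.
Proof. by []. Qed.

Let smooth_rs k : smooth D (rs k).
Proof.
apply: smooth_sum => // j _.
by have [t0 t1] := theta01 (ltnW (ltn_ord j)); exact: smooth_term.
Qed.

Let derive_rs k z : D z ->
  derive1 (rs k) z = \sum_(j < 2 ^ k) ((2 ^+ k)^-1)%:C * derive1 (G z) (theta k j)%:C.
Proof.
move=> Dz; rewrite rsE derive1_sum => [|j].
  apply: eq_bigr => j _.
  by have [t0 t1] := theta01 (ltnW (ltn_ord j)); exact: derive_term.
have [t0 t1] := theta01 (ltnW (ltn_ord j)).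
exact: smooth_differentiable (smooth_term _ t0 t1) Dz.
Qed.

(** The bound that the formula in [G2] gives for the second derivative of [G z] on [0, 1]. *)
Let B' := 2 * r * B + r ^+ 2 * B.

Let G2B z (th : R) : D z -> 0 <= th -> th <= 1 ->
  cnorm (derive1 (derive1 (G z)) th%:C) <= B'.
Proof.
move=> Dz t0 t1; have Dt := Dseg Dz t0 t1.
have [_ ->] := G2 Dt.
have zr : cnorm (z - z0) <= r by exact: ltW.
have c0 := cnorm_ge0 N (z - z0).
apply: le_trans (cnormD _ _ _) _.
rewrite !cnormM cnorm_real ger0_norm //.
have -> : cnorm 2 = 2.
  by rewrite -[2]/(2%:R) -(rmorph_nat (ofreal N)) cnorm_real ger0_norm.
have h1 := f1B Dt; have h2 := f2B Dt.
have B0 : 0 <= B by apply: le_trans h1; exact: cnorm_ge0.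
rewrite /B' [r ^+ 2]expr2; apply: lerD.
  by apply: ler_pM => //; [rewrite mulr_ge0 | exact: cnorm_ge0 | rewrite ler_pM2l].
apply: ler_pM => //.
- by rewrite !mulr_ge0.
- exact: cnorm_ge0.
- rewrite -[leRHS]mul1r; apply: ler_pM => //; first by rewrite mulr_ge0.
  exact: ler_pM.
Qed.

(* The Riemann sums of f along the segments from z0 have derivatives that are
   Riemann sums of the derivative of s |-> s f(z0 + s (z - z0)). *)
Let rs_error k z : D z -> cnorm (derive1 (rs k) z - f z) <= B' / 2 ^+ k.
Proof.
move=> Dz; rewrite derive_rs //.
have -> : f z = \sum_(j < 2 ^ k) (G z (theta k j.+1)%:C - G z (theta k j)%:C).
  rewrite -(big_mkord xpredT (fun j => G z (theta k j.+1)%:C - G z (theta k j)%:C)).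
  rewrite (telescope_sumr (fun j => G z (theta k j)%:C)) //.
  rewrite /theta mul0r rmorph0 natrX divff ?gt_eqF // rmorph1 /G !mul1r mul0r subr0.
  by rewrite addrC subrK.
rewrite -sumrB; apply: le_trans (cnorm_sum _ _ _ _) _.
(* Each of the 2^k cells contributes a second-order Taylor error of at most B' times the square of
   its length. *)
have -> : B' / 2 ^+ k = \sum_(j < 2 ^ k) (B' * (2 ^+ k)^-1 ^+ 2).
  rewrite sumr_const card_ord -[_ *+ (2 ^ k)%N]mulr_natr natrX.
  by have := p2 k; move=> /lt0r_neq0 p0; field.
apply: ler_sum => j _.
have step : (theta k j.+1)%:C - (theta k j)%:C = ((2 ^+ k)^-1)%:C.
  rewrite -rmorphB /theta -mulrBl -natrB // subSnn mul1r //.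
have [t0 t1] := theta01 (ltnW (ltn_ord j)).
have [s0 s1] := theta01 (ltn_ord j).
have := @taylor2_ineq _ _ N (G z) (theta k j)%:C (theta k j.+1)%:C B'.
rewrite step cnorm_real ger0_norm ?invr_ge0 ?(ltW (p2 k)) //.
move=> H.
rewrite cnormB [_%:C * _]mulrC; apply: H => th th0 th1 /=.
have -> : (theta k j)%:C + th%:C * ((2 ^+ k)^-1)%:C =
          ((1 - th) * theta k j + th * theta k j.+1)%:C.
  by rewrite -step; rewrite !(rmorphD, rmorphM, rmorphB, rmorph1); ring.
set u := (X in X%:C).
have u0 : 0 <= u by rewrite addr_ge0 // mulr_ge0 //; lra.
have u1 : u <= 1.
  rewrite /u; have : 0 <= (1 - th) * (1 - theta k j) by apply: mulr_ge0; lra.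
  have : 0 <= th * (1 - theta k j.+1) by apply: mulr_ge0; lra.
  lra.
have Du := Dseg Dz u0 u1.
by split; [have [] := G1 Du | have [] := G2 Du | exact: G2B].
Qed.

Lemma antiderivative_bounded :
  exists F : K -> K, F z0 = 0 /\
    forall w, D w -> differentiable F w /\ derive1 F w = f w.
Proof.
have rs0 k : rs k z0 = 0.
  rewrite rsE fct_sumE big1 // => j _.
  by rewrite -[LHS]/(_ * ((- z0 + z0 * 1) * _)) mulr1 addNr mul0r mulr0.
(* Twice B', as the derivatives of two consecutive sums are each within B' / 2^k of f. *)
have [||L [L0 LP]] := @uniform_limit _ _ N rs z0 r (2 * B') smooth_rs _ r0.
- by move=> k; rewrite !rs0.
- move=> k w Dw.
  have := cnormD N (derive1 (rs k.+1) w - f w) (f w - derive1 (rs k) w).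
  rewrite addrA subrK (cnormB N (f w)).
  have := rs_error k Dw; have := rs_error k.+1 Dw.
  have : B' / 2 ^+ k.+1 <= B' / 2 ^+ k.
    have B'0 : 0 <= B'.
      have := rs_error 0 Dw; rewrite expr0 divr1; apply: le_trans; exact: cnorm_ge0.
    apply: ler_wpM2l => //; rewrite lef_pV2 ?posrE ?p2 // ler_eXn2l //; exact: ltr1n.
  lra.
exists L; rewrite L0 rs0; split=> // w Dw.
have [dL _ LP2] := LP w Dw; split=> //.
apply/eqP; rewrite -subr_eq0; apply/eqP; apply: (@cnorm_eq0 _ _ N).
apply/eqP; rewrite eq_le cnorm_ge0 andbT.
(* 9 = 4 * 2 + 1: the distance to the derivative of [rs k] given by [uniform_limit], plus
   [rs_error]. *)
apply: (@le_of_pow2 _ _ _ (9 * B')) => k.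
have := cnormD N (derive1 L w - derive1 (rs k) w) (derive1 (rs k) w - f w).
rewrite addrA subrK; have := LP2 k; have := rs_error k Dw; lra.
Qed.

End Riemann.
End Antiderivative.

(** * Linear differential systems *)

(* lra compares atoms up to conversion, which is slow on values of derivatives:
   the norms are generalized first. *)
Ltac norm_lra :=
  repeat match goal with H : context [@rnorm] |- _ => clear H end;
  first
    [ repeat match goal with |- context [@rnorm ?R ?K ?N ?z] =>
        generalize (@rnorm R K N z); intro end; lra
    | lra ].

Section LinearSystems.
Context {R : realType} {K : numFieldType} (N : real_norm R K).
Local Notation cnorm := (rnorm N).

Lemma cnorm_le_eq0 (z : K) (c : R) : (forall k, cnorm z <= c / 2 ^+ k) -> z = 0.
Proof.
move=> H; apply: (@cnorm_eq0 _ _ N); apply/eqP; rewrite eq_le cnorm_ge0 andbT.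
by apply: (@le_of_pow2 _ _ _ c) => k; rewrite add0r.
Qed.

(** What [antiderivative_bounded] asks of an integrand, strengthened by a bound on the function
    itself so that it passes to sums, products and antiderivatives, hence to all Picard iterates. *)
Definition bounded2 (D : set K) (f : K -> K) := exists B : R, forall w, D w ->
  [/\ cnorm (f w) <= B, cnorm (derive1 f w) <= B
    & cnorm (derive1 (derive1 f) w) <= B].

Lemma bounded2_cst (D : set K) (c : K) : bounded2 D (cst c).
Proof.
exists (cnorm c) => w _.
have -> : derive1 (cst c : K -> K) = cst 0.
  by apply/funext => x; rewrite derive1E derive_cst.
by rewrite derive1E derive_cst cnorm0 cnorm_ge0; split.
Qed.

Lemma bounded2D (D : set K) (f g : K -> K) : open D -> smooth D f -> smooth D g ->
  bounded2 D f -> bounded2 D g -> bounded2 D (f + g).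
Proof.
move=> oD sf sg [Bf Hf] [Bg Hg]; exists (Bf + Bg) => w Dw.
have df x : D x -> differentiable f x by exact: smooth_differentiable.
have dg x : D x -> differentiable g x by exact: smooth_differentiable.
have df1 x : D x -> differentiable (derive1 f) x.
  by apply: smooth_differentiable; exact: smooth_derive1.
have dg1 x : D x -> differentiable (derive1 g) x.
  by apply: smooth_differentiable; exact: smooth_derive1.
have [f0 f1 f2] := Hf w Dw; have [g0 g1 g2] := Hg w Dw.
have E1 x : D x -> derive1 (f + g) x = (derive1 f + derive1 g) x.
  by move=> Dx; rewrite derive1D //; [exact: df | exact: dg].
rewrite (derive1_near_eq oD Dw E1) E1 // derive1D; [|exact: df1|exact: dg1].
by split; apply: le_trans (cnormD _ _ _) _; exact: lerD.
Qed.

Lemma bounded2M (D : set K) (f g : K -> K) : open D -> smooth D f -> smooth D g ->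
  bounded2 D f -> bounded2 D g -> bounded2 D (f * g).
Proof.
(* The second derivative of a product has four terms, counting f' g' twice. *)
move=> oD sf sg [Bf Hf] [Bg Hg]; exists (4 * (Bf * Bg)) => w Dw.
have df x : D x -> differentiable f x by exact: smooth_differentiable.
have dg x : D x -> differentiable g x by exact: smooth_differentiable.
have df1 x : D x -> differentiable (derive1 f) x.
  by apply: smooth_differentiable; exact: smooth_derive1.
have dg1 x : D x -> differentiable (derive1 g) x.
  by apply: smooth_differentiable; exact: smooth_derive1.
have [f0 f1 f2] := Hf w Dw; have [g0 g1 g2] := Hg w Dw.
have E1 x : D x -> derive1 (f * g) x = (derive1 f * g + f * derive1 g) x.
  by move=> Dx; rewrite derive1M //; [exact: df | exact: dg].
have E2 : derive1 (derive1 (f * g)) w =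
    (derive1 (derive1 f) w * g w + derive1 f w * derive1 g w) +
    (derive1 f w * derive1 g w + f w * derive1 (derive1 g) w).
  have h1 := df w Dw; have h2 := dg w Dw; have h3 := df1 w Dw; have h4 := dg1 w Dw.
  rewrite (derive1_near_eq oD Dw E1).
  rewrite derive1D; [|exact: differentiableM|exact: differentiableM].
  by rewrite !derive1M.
have P (a b : K) : cnorm a <= Bf -> cnorm b <= Bg -> cnorm (a * b) <= Bf * Bg.
  by move=> ha hb; rewrite cnormM; apply: ler_pM => //; exact: cnorm_ge0.
have P0 : 0 <= Bf * Bg by apply: le_trans (P _ _ f0 g0); exact: cnorm_ge0.
move: (Bf * Bg) P P0 => M P P0.
rewrite E2 E1 //; split.
- by apply: le_trans (P _ _ f0 g0) _; clear -P0; lra.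
- apply: le_trans (cnormD _ _ _) _; apply: (@le_trans _ _ (M + M)); last by clear -P0; lra.
  by apply: lerD; exact: P.
- apply: le_trans (cnormD _ _ _) _.
  apply: (@le_trans _ _ ((M + M) + (M + M))); last by clear -P0; lra.
  by apply: lerD; apply: le_trans (cnormD _ _ _) _; apply: lerD; exact: P.
Qed.

Lemma bounded2_primitive (z0 : K) (r : R) (f F : K -> K) : 0 < r -> smooth (disc N z0 r) f ->
  bounded2 (disc N z0 r) f ->
  (forall w, disc N z0 r w -> differentiable F w /\ derive1 F w = f w) ->
  bounded2 (disc N z0 r) F.
Proof.
move=> r0 sf [B fB] HF; set D := disc N z0 r.
have oD : open D by exact: open_disc.
have Dz0 : D z0 by exact: disc_center.
have B0 : 0 <= B by have [h _ _] := fB z0 Dz0; apply: le_trans h; exact: cnorm_ge0.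
exists (cnorm (F z0) + B * r + B) => w Dw; have [_ E] := HF w Dw.
have E2 : derive1 (derive1 F) w = derive1 f w.
  by apply: (derive1_near_eq oD Dw) => x /HF[].
rewrite E E2.
have [f0 f1 _] := fB w Dw.
have n0 := cnorm_ge0 N (F z0); have Br : 0 <= B * r by rewrite mulr_ge0 // ltW.
split; last first.
- by move: f1 n0 Br B0; norm_lra.
- by move: f0 n0 Br B0; norm_lra.
have H x : D x -> differentiable F x /\ cnorm (derive1 F x) <= B.
  by move=> Dx; have [? ->] := HF x Dx; have [] := fB x Dx.
have := disc_mean_value H Dz0 Dw.
have : B * cnorm (w - z0) <= B * r by apply: ler_wpM2l => //; exact: ltW.
have := cnormD N (F w - F z0) (F z0); rewrite subrK; move: B0; norm_lra.
Qed.

Lemma continuous_bounded (f : K -> K) (z : K) : differentiable f z ->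
  exists2 r, 0 < r & forall w, disc N z r w -> cnorm (f w) <= cnorm (f z) + 1.
Proof.
move=> df; have [d d0 dA] := linear_approx N df ltr01.
have n1 := cnorm_ge0 N (derive1 f z).
have s0 : 0 < 1 + cnorm (derive1 f z) by move: n1; norm_lra.
exists (Num.min d (1 / (1 + cnorm (derive1 f z)))).
  by rewrite lt_min d0 divr_gt0.
move=> w; rewrite {1}/disc /= lt_min ltr_pdivlMr // => /andP[wd w1].
have := dA w wd.
have := cnormD N (f w - f z - derive1 f z * (w - z)) (derive1 f z * (w - z)).
have := cnormD N (f w - f z) (f z).
rewrite !subrK cnormM; move: w1; norm_lra.
Qed.

Lemma smooth_bounded2 (U : set K) (f : K -> K) (z : K) : open U -> U z -> smooth U f ->
  exists2 r, 0 < r & disc N z r `<=` U /\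
    exists B : R, forall w, disc N z r w -> [/\ cnorm (f w) <= B, cnorm (derive1 f w) <= B
    & cnorm (derive1 (derive1 f) w) <= B].
Proof.
move=> oU Uz sf; have [r0 r00 rU] := open_ex_disc N oU Uz.
have sf1 := smooth_derive1 sf; have sf2 := smooth_derive1 sf1.
have [r1 r10 H1] := continuous_bounded (smooth_differentiable sf Uz).
have [r2 r20 H2] := continuous_bounded (smooth_differentiable sf1 Uz).
have [r3 r30 H3] := continuous_bounded (smooth_differentiable sf2 Uz).
exists (Num.min r0 (Num.min r1 (Num.min r2 r3))).
  by rewrite !lt_min r00 r10 r20.
split.
  by move=> w; rewrite /disc /= lt_min => /andP[h _]; exact: rU.
exists ((cnorm (f z) + 1) + (cnorm (derive1 f z) + 1) + (cnorm (derive1 (derive1 f) z) + 1)).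
move=> w; rewrite /disc /= !lt_min => /and4P[_ h1 h2 h3].
move: (H1 w h1) (H2 w h2) (H3 w h3) (cnorm_ge0 N (f z)) (cnorm_ge0 N (derive1 f z))
  (cnorm_ge0 N (derive1 (derive1 f) z)) => b1 b2 b3 c1 c2 c3.
by split; move: b1 b2 b3 c1 c2 c3; norm_lra.
Qed.

Section Picard.
Variables (z0 : K) (r A : R) (p q s t : K -> K) (a b : K).
Let D := disc N z0 r.
Hypotheses (r0 : 0 < r) (Ar : 4 * A * r <= 1).
Hypotheses (sp : smooth D p) (sq : smooth D q) (ss : smooth D s) (st : smooth D t).
Hypotheses (bp : bounded2 D p) (bq : bounded2 D q) (bs : bounded2 D s) (bt : bounded2 D t).
Hypothesis A0 : 0 <= A.
Hypothesis HA : forall w, D w ->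
  [/\ cnorm (p w) <= A, cnorm (q w) <= A, cnorm (s w) <= A & cnorm (t w) <= A].

Let oD : open D. Proof. exact: open_disc. Qed.
Let Dz0 : D z0. Proof. exact: disc_center. Qed.

Definition is_primitive (f F : K -> K) :=
  F z0 = 0 /\ forall w, D w -> differentiable F w /\ derive1 F w = f w.

(** An antiderivative is selected by choice, so that the iterates can be defined before their
    integrands are known to be smooth and bounded; the default value is 0. *)
Let prim (f : K -> K) : K -> K := xget (cst 0) (is_primitive f).

Let primP f : smooth D f -> bounded2 D f -> is_primitive f (prim f).
Proof.
move=> sf [B HB]; have [||F HF] := @antiderivative_bounded _ _ N z0 r f B r0 sf.
- by move=> w Dw; have [] := HB w Dw.
- by move=> w Dw; have [] := HB w Dw.
by rewrite /prim; case: xgetP => [y -> //|/(_ F)].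
Qed.

Let iterates : nat -> (K -> K) * (K -> K) := fix it k :=
  if k is k'.+1 then
    (cst a + prim (p * (it k').1 + q * (it k').2),
     cst b + prim (s * (it k').1 + t * (it k').2))
  else (cst a, cst b).

Let good (f : K -> K) := smooth D f /\ bounded2 D f.

Let good_comb f g h k : good f -> good g -> good h -> good k ->
  good (f * h + g * k).
Proof.
move=> [s1 b1] [s2 b2] [s3 b3] [s4 b4].
split; first by apply: smoothD => //; exact: smoothM.
by apply: bounded2D; try exact: smoothM; try exact: bounded2M.
Qed.

Let good_prim c f : good f -> [/\ good (cst c + prim f), (cst c + prim f) z0 = c &
  forall w, D w -> derive1 (cst c + prim f) w = f w].
Proof.
move=> [sf bf]; have [P0 PP] := primP sf bf.
have HF w : D w -> differentiable (cst c + prim f) w /\ derive1 (cst c + prim f) w = f w.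
  move=> Dw; have [dP EP] := PP w Dw; split; first exact: differentiableD.
  by rewrite derive1D // EP derive1E derive_cst add0r.
split; [split|by rewrite -[LHS]/(c + prim f z0) P0 addr0|by move=> w /HF[]].
  exact: (smooth_primitive oD sf HF).
exact: (bounded2_primitive r0 sf bf HF).
Qed.

Let good_it k : good (iterates k).1 /\ good (iterates k).2.
Proof.
elim: k => [|k [g1 g2]].
  by split; split; try exact: smooth_cst; exact: bounded2_cst.
by split; [have [] := good_prim a (good_comb (conj sp bp) (conj sq bq) g1 g2)
          |have [] := good_prim b (good_comb (conj ss bs) (conj st bt) g1 g2)].
Qed.

Let it_init k : (iterates k).1 z0 = a /\ (iterates k).2 z0 = b.
Proof.
case: k => [//|k]; have [g1 g2] := good_it k.
by split; [have [] := good_prim a (good_comb (conj sp bp) (conj sq bq) g1 g2)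
          |have [] := good_prim b (good_comb (conj ss bs) (conj st bt) g1 g2)].
Qed.

Let it_derive k w : D w ->
  derive1 (iterates k.+1).1 w = p w * (iterates k).1 w + q w * (iterates k).2 w /\
  derive1 (iterates k.+1).2 w = s w * (iterates k).1 w + t w * (iterates k).2 w.
Proof.
move=> Dw; have [g1 g2] := good_it k.
split; [have [_ _ H] := good_prim a (good_comb (conj sp bp) (conj sq bq) g1 g2)
          |have [_ _ H] := good_prim b (good_comb (conj ss bs) (conj st bt) g1 g2)];
  exact: H.
Qed.

Let comb_le (x y u v : K) (c : R) : cnorm x <= A -> cnorm y <= A ->
  cnorm u <= c -> cnorm v <= c -> cnorm (x * u + y * v) <= 2 * A * c.
Proof.
move=> hx hy hu hv; apply: le_trans (cnormD _ _ _) _; rewrite !cnormM.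
have H1 : cnorm x * cnorm u <= A * c by apply: ler_pM => //; exact: cnorm_ge0.
have H2 : cnorm y * cnorm v <= A * c by apply: ler_pM => //; exact: cnorm_ge0.
move: H1 H2; norm_lra.
Qed.

Let diff_le f g (c : R) : smooth D f -> smooth D g -> f z0 = g z0 -> 0 <= c ->
  (forall w, D w -> cnorm (derive1 f w - derive1 g w) <= c) ->
  forall w, D w -> cnorm (f w - g w) <= c * r.
Proof.
move=> sf sg fg c0 H w Dw.
have H' x : D x -> differentiable (f - g) x /\ cnorm (derive1 (f - g) x) <= c.
  move=> Dx; have d1 := smooth_differentiable sf Dx; have d2 := smooth_differentiable sg Dx.
  split; first exact: differentiableB.
  rewrite derive1E deriveB; try exact: diff_derivable.
  by rewrite -!derive1E; exact: H.
have := disc_mean_value H' Dz0 Dw.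
rewrite -[(f - g) w]/(f w - g w) -[(f - g) z0]/(f z0 - g z0) fg subrr subr0.
by move=> /le_trans; apply; apply: ler_wpM2l => //; exact: ltW.
Qed.

(** One step multiplies the distance of two iterates by at most 2 A r, which [Ar] makes at most 1/2.
    The limit satisfies the equation because both the iterates and their derivatives converge. *)
Lemma picard_solution : exists F G : K -> K,
  [/\ smooth D F, smooth D G, F z0 = a, G z0 = b &
   forall w, D w -> derive1 F w = p w * F w + q w * G w /\
                    derive1 G w = s w * F w + t w * G w].
Proof.
pose f k := (iterates k).1; pose g k := (iterates k).2.
have sf k : smooth D (f k) by have [[]] := good_it k.
have sg k : smooth D (g k) by have [_ []] := good_it k.
have fi k : f k z0 = a by have [] := it_init k.
have gi k : g k z0 = b by have [] := it_init k.
have [M HM] : exists M : R, forall w, D w ->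
    cnorm (f 1%N w - f 0%N w) <= M /\ cnorm (g 1%N w - g 0%N w) <= M.
  have [[_ [B1 H1]] [_ [B2 H2]]] := good_it 1%N.
  exists (B1 + B2 + cnorm a + cnorm b) => w Dw.
  have h1 : cnorm (f 1%N w) <= B1 by have [] := H1 w Dw.
  have h2 : cnorm (g 1%N w) <= B2 by have [] := H2 w Dw.
  move: (cnormD N (f 1%N w) (- f 0%N w)) (cnormD N (g 1%N w) (- g 0%N w)).
  rewrite !cnormN -[f 0%N w]/a -[g 0%N w]/b -/(f 1%N) -/(g 1%N) => e1 e2.
  move: (cnorm_ge0 N a) (cnorm_ge0 N b) (cnorm_ge0 N (f 1%N w)) (cnorm_ge0 N (g 1%N w)).
  move=> c1 c2 c3 c4.
  by split; move: h1 h2 e1 e2 c1 c2 c3 c4; norm_lra.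
have M0 : 0 <= M by have [h _] := HM z0 Dz0; apply: le_trans h; exact: cnorm_ge0.
have p2 k : 0 < (2 ^+ k : R)^-1 by rewrite invr_gt0 exprn_gt0.
have der k c : (forall w, D w -> cnorm (f k.+1 w - f k w) <= c /\ cnorm (g k.+1 w - g k w) <= c) ->
   forall w, D w -> cnorm (derive1 (f k.+2) w - derive1 (f k.+1) w) <= 2 * A * c /\
     cnorm (derive1 (g k.+2) w - derive1 (g k.+1) w) <= 2 * A * c.
  move=> H w Dw; have [h1 h2] := H w Dw; have [a1 a2 a3 a4] := HA Dw.
  rewrite /f /g; have [-> ->] := it_derive k.+1 Dw; have [-> ->] := it_derive k Dw.
  rewrite -/(f k.+1) -/(g k.+1) -/(f k) -/(g k).
  have E (x y u v u' v' : K) : x * u + y * v - (x * u' + y * v') = x * (u - u') + y * (v - v') by ring.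
  by rewrite !E; split; exact: comb_le.
have geo k w : D w -> cnorm (f k.+1 w - f k w) <= M / 2 ^+ k /\
    cnorm (g k.+1 w - g k w) <= M / 2 ^+ k.
  elim: k w => [|k IHk] w Dw; first by rewrite expr0 divr1; exact: HM.
  have c0 : 0 <= 2 * A * (M / 2 ^+ k).
    by rewrite !mulr_ge0 // ltW.
  have le2 : 2 * A * (M / 2 ^+ k) * r <= M / 2 ^+ k.+1.
    rewrite exprS invfM.
    have : (4 * A * r) * (M / 2 ^+ k) <= 1 * (M / 2 ^+ k).
      by apply: ler_wpM2r => //; rewrite mulr_ge0 // ltW.
    lra.
  split; apply: le_trans le2; apply: diff_le => //; rewrite ?fi ?gi // => x Dx;
    by have [] := der k _ IHk x Dx.
(* The sequence is shifted by one, as the derivatives of the iterates k + 2 and k + 1 differ by at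
   most 2 A times the distance of the iterates k + 1 and k. *)
have [|||L1 [L10 HL1]] := @uniform_limit _ _ N (fun k => f k.+1) z0 r (2 * A * M) _ _ r0.
- by move=> k; exact: sf.
- by move=> k; rewrite !fi.
- by move=> k w Dw; have [+ _] := der k _ (geo k) w Dw; rewrite mulrA.
have [|||L2 [L20 HL2]] := @uniform_limit _ _ N (fun k => g k.+1) z0 r (2 * A * M) _ _ r0.
- by move=> k; exact: sg.
- by move=> k; rewrite !gi.
- by move=> k w Dw; have [_ +] := der k _ (geo k) w Dw; rewrite mulrA.
have ode w : D w -> derive1 L1 w = p w * L1 w + q w * L2 w /\
                    derive1 L2 w = s w * L1 w + t w * L2 w.
  move=> Dw; have [_ l1 l1'] := HL1 w Dw; have [_ l2 l2'] := HL2 w Dw.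
  have [a1 a2 a3 a4] := HA Dw.
  set c := 4 * (2 * A * M); have c0 : 0 <= c by rewrite /c !mulr_ge0.
  have mono k : c / 2 ^+ k.+1 <= c / 2 ^+ k.
    apply: ler_wpM2l => //; rewrite lef_pV2 ?posrE ?exprn_gt0 // ler_eXn2l //; exact: ltr1n.
  split; apply/eqP; rewrite -subr_eq0; apply/eqP;
      apply: (@cnorm_le_eq0 _ (c + 2 * A * (c * r))) => k.
    have -> : derive1 L1 w - (p w * L1 w + q w * L2 w) =
      (derive1 L1 w - derive1 (f k.+2) w) - (p w * (L1 w - f k.+1 w) + q w * (L2 w - g k.+1 w)).
      by have [+ _] := it_derive k.+1 Dw; rewrite -/(f k.+2) => ->; rewrite /f /g; ring.
    apply: le_trans (cnormD _ _ _) _; rewrite cnormN.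
    have := l1' k.+1; rewrite -/c => h1.
    have := comb_le a1 a2 (l1 k) (l2 k).
    have := mono k; rewrite -[4 * (_ * _ * M * r)]/(4 * (2 * A * M * r)).
    have -> : 4 * (2 * A * M * r) = c * r by rewrite /c mulrA.
    move: h1; norm_lra.
  have -> : derive1 L2 w - (s w * L1 w + t w * L2 w) =
      (derive1 L2 w - derive1 (g k.+2) w) - (s w * (L1 w - f k.+1 w) + t w * (L2 w - g k.+1 w)).
    by have [_ +] := it_derive k.+1 Dw; rewrite -/(g k.+2) => ->; rewrite /f /g; ring.
  apply: le_trans (cnormD _ _ _) _; rewrite cnormN.
  have := l2' k.+1; rewrite -/c => h1.
  have := comb_le a3 a4 (l1 k) (l2 k).
  have := mono k; rewrite -[4 * (_ * _ * M * r)]/(4 * (2 * A * M * r)).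
  have -> : 4 * (2 * A * M * r) = c * r by rewrite /c mulrA.
  move: h1; norm_lra.
(* The right-hand sides have the order of the solution itself, and integrating them raises it by
   one. *)
have sm k : nsmooth k D L1 /\ nsmooth k D L2.
  elim: k => [//|k [s1 s2]].
  have ns h : smooth D h -> nsmooth k D h by move=> /smoothP.
  split.
    apply: (@nsmooth_primitive _ D (p * L1 + q * L2)) => //.
      by apply: nsmoothD => //; apply: nsmoothM => //; exact: ns.
    by move=> w Dw; have [d _ _] := HL1 w Dw; have [-> _] := ode w Dw.
  apply: (@nsmooth_primitive _ D (s * L1 + t * L2)) => //.
    by apply: nsmoothD => //; apply: nsmoothM => //; exact: ns.
  by move=> w Dw; have [d _ _] := HL2 w Dw; have [_ ->] := ode w Dw.
exists L1, L2; split=> //.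
- by apply/smoothP => k; have [] := sm k.
- by apply/smoothP => k; have [] := sm k.
- by rewrite L10 fi.
- by rewrite L20 gi.
Qed.

End Picard.

(** Two unknowns cover all the equations solved below: w'' = q w as a first-order system, a
    first-order homogeneous equation, and an antiderivative of eta as h' = eta k with k constantly
    1. *)
Lemma linear_system_solution (U : set K) (p q s t : K -> K) (z0 a b : K) :
  open U -> U z0 -> smooth U p -> smooth U q -> smooth U s -> smooth U t ->
  exists2 r, 0 < r & disc N z0 r `<=` U /\ exists F G : K -> K,
  [/\ smooth (disc N z0 r) F, smooth (disc N z0 r) G, F z0 = a, G z0 = b &
   forall w, disc N z0 r w -> derive1 F w = p w * F w + q w * G w /\
                              derive1 G w = s w * F w + t w * G w].
Proof.
move=> oU Uz sp sq ss st.
have [r1 r10 [U1 [B1 H1]]] := smooth_bounded2 oU Uz sp.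
have [r2 r20 [U2 [B2 H2]]] := smooth_bounded2 oU Uz sq.
have [r3 r30 [U3 [B3 H3]]] := smooth_bounded2 oU Uz ss.
have [r4 r40 [U4 [B4 H4]]] := smooth_bounded2 oU Uz st.
have B10 : 0 <= B1.
  by have [h _ _] := H1 z0 (disc_center N _ r10); apply: le_trans h; exact: cnorm_ge0.
have B20 : 0 <= B2.
  by have [h _ _] := H2 z0 (disc_center N _ r20); apply: le_trans h; exact: cnorm_ge0.
have B30 : 0 <= B3.
  by have [h _ _] := H3 z0 (disc_center N _ r30); apply: le_trans h; exact: cnorm_ge0.
have B40 : 0 <= B4.
  by have [h _ _] := H4 z0 (disc_center N _ r40); apply: le_trans h; exact: cnorm_ge0.
pose A := B1 + B2 + B3 + B4.
have A0 : 0 <= A by rewrite /A; lra.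
(* This ensures 4 A r <= 1 for r <= e, and the added 1 allows A = 0. *)
pose e := 1 / (4 * A + 1).
have e0 : 0 < e by rewrite divr_gt0 //; lra.
pose r := Num.min r1 (Num.min r2 (Num.min r3 (Num.min r4 e))).
have rr : 0 < r by rewrite /r !lt_min r10 r20 r30 r40.
have sub i : r <= i -> disc N z0 r `<=` disc N z0 i.
  by move=> ri w; rewrite /disc /= => /lt_le_trans; apply.
have le1 : r <= r1 by rewrite /r ge_min lexx.
have le2 : r <= r2 by rewrite /r !ge_min lexx /= orbT.
have le3 : r <= r3 by rewrite /r !ge_min lexx /= !orbT.
have le4 : r <= r4 by rewrite /r !ge_min lexx /= !orbT.
have lee : r <= e by rewrite /r !ge_min lexx /= !orbT.
have Ar : 4 * A * r <= 1.
  have : r * (4 * A + 1) <= 1 by rewrite -ler_pdivlMr //; lra.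
  lra.
have DU : disc N z0 r `<=` U by move=> w /(sub _ le1) /U1.
exists r => //; split=> //.
apply: (@picard_solution z0 r A) => //; try exact: smooth_subset DU _.
- by exists B1 => w /(sub _ le1) /H1.
- by exists B2 => w /(sub _ le2) /H2.
- by exists B3 => w /(sub _ le3) /H3.
- by exists B4 => w /(sub _ le4) /H4.
move=> w Dw; have [h1 _ _] := H1 w (sub _ le1 _ Dw); have [h2 _ _] := H2 w (sub _ le2 _ Dw).
have [h3 _ _] := H3 w (sub _ le3 _ Dw); have [h4 _ _] := H4 w (sub _ le4 _ Dw).
by rewrite /A; split; lra.
Qed.

End LinearSystems.

(** * The implicit function theorem *)

Section ImplicitFunction.
Context {R : realType} {K : numFieldType} (N : real_norm R K).
Local Notation cnorm := (rnorm N).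

Lemma continuous_plane (f : K * K -> K) (z : K * K) : differentiable f z ->
  forall e : R, 0 < e -> exists2 d : R, 0 < d &
    forall w, disc N z.1 d w.1 -> disc N z.2 d w.2 -> cnorm (f w - f z) <= e.
Proof.
move=> df e e0; have [d d0 dA] := linear_approx2 N df ltr01.
(* The increment of f is at most (1 + |f_x|) |dx| + (1 + |f_y|) |dy|, and c is the sum of the two
   factors. *)
pose c := 2 + cnorm (pdx f z) + cnorm (pdy f z).
have nx := cnorm_ge0 N (pdx f z); have ny := cnorm_ge0 N (pdy f z).
have c0 : 0 < c by rewrite /c; move: nx ny; norm_lra.
exists (Num.min d (e / c)); first by rewrite lt_min d0 divr_gt0.
have qc : e / c * c = e by rewrite divfK // gt_eqF.
move: (e / c) qc => q qc.
move=> w; rewrite {1 2}/disc /= !lt_min => /andP[w1 /ltW e1] /andP[w2 /ltW e2].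
have px : 0 <= (q - cnorm (w.1 - z.1)) * (1 + cnorm (pdx f z)).
  by apply: mulr_ge0; [rewrite subr_ge0 | exact: addr_ge0 ler01 nx].
have py : 0 <= (q - cnorm (w.2 - z.2)) * (1 + cnorm (pdy f z)).
  by apply: mulr_ge0; [rewrite subr_ge0 | exact: addr_ge0 ler01 ny].
have := dA w w1 w2; set T := (X in f w - f z - X).
have : cnorm T <= cnorm (pdx f z) * cnorm (w.1 - z.1) + cnorm (pdy f z) * cnorm (w.2 - z.2).
  by apply: le_trans (cnormD N _ _) _; rewrite 2!cnormM.
have := cnormD N (f w - f z - T) T; rewrite subrK.
move: px py qc; rewrite /c; norm_lra.
Qed.

Section Contraction.
Variables (U : set (K * K)) (psi : K * K -> K) (z0 : K * K) (r : R).
Hypotheses (spsi : smooth U psi) (r0 : 0 < r).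
Let c := pdx psi z0.
Hypothesis c0 : c != 0.
Hypothesis rU : forall w, disc N z0.1 r w.1 -> disc N z0.2 r w.2 ->
  U w /\ cnorm (pdx psi w - c) <= cnorm c / 2.

Let n0 : 0 < cnorm c. Proof. exact: cnorm_gt0. Qed.

(** Subtracting c x leaves a function of x whose derivative has modulus at most |c| / 2, so each
    slice of psi is close to multiplication by c. *)
Lemma slice_approx (x x' y : K) : disc N z0.1 r x -> disc N z0.1 r x' ->
  disc N z0.2 r y ->
  cnorm (psi (x, y) - psi (x', y) - c * (x - x')) <= cnorm c / 2 * cnorm (x - x').
Proof.
move=> xr xr' yr.
pose h : K -> K := (fun s => psi (s, y)) - cst c * id.
have -> : psi (x, y) - psi (x', y) - c * (x - x') = h x - h x'.
  rewrite -[h x]/(psi (x, y) - c * x) -[h x']/(psi (x', y) - c * x'); ring.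
apply: (disc_mean_value (z := z0.1) (r := r)) => // s sr.
have [Us Bs] := @rU (s, y) sr yr.
have dpsi := smooth_differentiable spsi Us.
have ds : differentiable (fun s => psi (s, y)) s.
  by apply: (@differentiable_comp _ _ _ _ (fun s : K => (s, y)) psi).
have dl : differentiable (cst c * id : K -> K) s by exact: differentiableM.
split; first exact: (differentiableB ds dl).
suff -> : derive1 h s = pdx psi (s, y) - c by [].
rewrite derive1E deriveB; try exact: diff_derivable.
rewrite (@derive_comp2 _ _ psi id (cst y)) // -!derive1E derive1M //.
rewrite !derive1E derive_id !derive_cst mulr0 addr0 mulr1 mul0r add0r.
by rewrite -[cst c s]/c mulr1.
Qed.

Lemma slice_lower_bound (x x' y : K) : disc N z0.1 r x -> disc N z0.1 r x' ->
  disc N z0.2 r y ->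
  cnorm c / 2 * cnorm (x - x') <= cnorm (psi (x, y) - psi (x', y)).
Proof.
move=> xr xr' yr; have := slice_approx xr xr' yr.
have := cnormD N (psi (x, y) - psi (x', y)) (- (psi (x, y) - psi (x', y) - c * (x - x'))).
rewrite cnormN opprB addrC subrK cnormM; norm_lra.
Qed.

(** Newton's iteration with the derivative frozen at c. It halves distances, and the bound |c| r /
    16 makes the first step at most r / 16; the iterates then stay within r / 8 of z0.1 and the
    limit within r / 4. *)
Lemma slice_solution (t y : K) : disc N z0.2 r y ->
  cnorm (psi (z0.1, y) - t) <= cnorm c * r / 16 ->
  exists2 x, disc N z0.1 r x & psi (x, y) = t.
Proof.
move=> yr yt.
pose g x := x - (psi (x, y) - t) / c.
pose u k := iter k g z0.1.
have gg x x' : disc N z0.1 r x -> disc N z0.1 r x' ->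
    cnorm (g x - g x') <= cnorm (x - x') / 2.
  move=> xr xr'.
  have -> : g x - g x' = - (psi (x, y) - psi (x', y) - c * (x - x')) / c.
    by rewrite /g; field.
  rewrite cnormM cnormN cnormV ler_pdivrMr //.
  by have := slice_approx xr xr' yr; norm_lra.
have p2 k : 0 < (2 ^+ k : R)^-1 by rewrite invr_gt0 exprn_gt0.
have eighth_lt k : r / 8 * (1 - (2 ^+ k)^-1) < r.
  by have := mulr_gt0 r0 (p2 k); move: r0; norm_lra.
have uP k : cnorm (u k - z0.1) <= r / 8 * (1 - (2 ^+ k)^-1) /\
            cnorm (u k.+1 - u k) <= r / 16 / 2 ^+ k.
  elim: k => [|k [IH1 IH2]].
    rewrite expr0 invr1 /u /= !subrr mulr0 cnorm0 lexx; split=> //.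
    rewrite /g addrC addKr cnormN cnormM cnormV mulr1 ler_pdivrMr //.
    by apply: le_trans yt _; rewrite mulrC mulrA; lra.
  have q0 := p2 k; have H1 : cnorm (u k.+1 - z0.1) <= r / 8 * (1 - (2 ^+ k.+1)^-1).
    have := cnormD N (u k.+1 - u k) (u k - z0.1); rewrite addrA subrK.
    rewrite exprS invfM; move: IH1 IH2; norm_lra.
  have D j : cnorm (u j - z0.1) <= r / 8 * (1 - (2 ^+ j)^-1) -> disc N z0.1 r (u j).
    rewrite /disc /= => /le_lt_trans; apply.
    exact: eighth_lt.
  split=> //.
  have := gg _ _ (D _ H1) (D _ IH1); rewrite -/(u k.+2) -/(u k.+1).
  rewrite exprS invfM; move: IH2; norm_lra.
have [l lP] := rnorm_complete (fun k => (uP k).2).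
have lr : disc N z0.1 r l.
  rewrite /disc /=; apply: le_lt_trans (lP 0%N) _; rewrite expr0 divr1.
  by move: r0; norm_lra.
have ur k : disc N z0.1 r (u k).
  have [H _] := uP k; apply: le_lt_trans H _.
  exact: eighth_lt.
exists l => //.
have gl : g l - l = 0.
  apply: (@cnorm_le_eq0 _ _ N _ r) => k.
  have := gg _ _ lr (ur k).
  have := lP k; have := lP k.+1.
  have := cnormD N (g l - g (u k)) (g (u k) - l); rewrite addrA subrK.
  rewrite -[g (u k)]/(u k.+1) (cnormB N (u k.+1)) exprS invfM.
  have : 0 < r * (2 ^+ k)^-1 by exact: mulr_gt0.
  norm_lra.
move: gl; rewrite /g addrC addrA addNr add0r => /eqP.
by rewrite oppr_eq0 mulf_eq0 invr_eq0 (negbTE c0) orbF subr_eq0 => /eqP.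
Qed.

(** The lower bound on slices first makes X Lipschitz. The linear approximation of psi at (X q, q.2)
    can then be solved for the increment of X, with an error that is small relative to that of q. *)
Lemma solution_differentiable (W : set (K * K)) (X : K * K -> K) : open W ->
  (forall q, W q -> disc N z0.2 r q.2) ->
  (forall q, W q -> disc N z0.1 r (X q) /\ psi (X q, q.2) = q.1) ->
  forall q, W q -> [/\ differentiable X q, pdx X q = (pdx psi (X q, q.2))^-1 &
     pdy X q = - pdy psi (X q, q.2) / pdx psi (X q, q.2)].
Proof.
move=> oW W2 HX q Wq; have [Xr Xq] := HX q Wq.
set P := (X q, q.2).
have [UP BP] := rU (w := P) Xr (W2 q Wq).
have dP := smooth_differentiable spsi UP.
set A := pdx psi P; set B := pdy psi P.
have A0 : 0 < cnorm A.
  have := cnormD N (- (A - c)) A; rewrite opprB subrK (cnormB N c).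
  by move: BP n0; rewrite -/A; norm_lra.
have Anz : A != 0 by apply/eqP => E; move: A0; rewrite E cnorm0 ltxx.
have [d0 d00 dW] := open_ex_bidisc N oW Wq.
have [d1 d10 H1] := linear_approx2 N dP ltr01.
(* Slices expand by at least |c| / 2, while changing q moves the right-hand side by at most |dt| +
   (1 + |B|) |dy|. *)
pose L := 2 * (2 + cnorm B) / cnorm c.
have B0 := cnorm_ge0 N B.
have L0 : 0 < L by rewrite /L !mulr_gt0 ?invr_gt0 //; move: B0; norm_lra.
pose d2 := Num.min d0 d1.
have d20 : 0 < d2 by rewrite lt_min d00.
have lip q' : disc N q.1 d2 q'.1 -> disc N q.2 d2 q'.2 ->
    cnorm (X q' - X q) <= L * (cnorm (q'.1 - q.1) + cnorm (q'.2 - q.2)).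
  rewrite {1 2}/disc /= !lt_min => /andP[h10 h11] /andP[h20 h21].
  have Wq' : W q' by apply: dW; split.
  have [Xr' Xq'] := HX q' Wq'.
  have := slice_lower_bound Xr' Xr (W2 q' Wq'); rewrite Xq'.
  have := H1 (X q, q'.2) (disc_center N _ d10) h21.
  rewrite /= subrr mulr0 add0r cnorm0 add0r mul1r /P Xq -/P -/B.
  have := cnormD N (psi (X q, q'.2) - q.1 - B * (q'.2 - q.2)) (B * (q'.2 - q.2)).
  have := cnormD N (q'.1 - q.1) (- (psi (X q, q'.2) - q.1)).
  have -> : q'.1 - q.1 - (psi (X q, q'.2) - q.1) = q'.1 - psi (X q, q'.2) by ring.
  rewrite subrK cnormN cnormM /L.
  have := cnorm_ge0 N (q'.1 - q.1); have := cnorm_ge0 N (q'.2 - q.2).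
  move=> e2 e1 i1 i2 i3 i4.
  rewrite mulrAC ler_pdivlMr //.
  have : 0 <= cnorm B * cnorm (q'.1 - q.1) by rewrite mulr_ge0.
  by move: e1 e2 i1 i2 i3 i4; norm_lra.
apply: (@approx_differentiable2 _ _ N) => e e0.
(* The increments of X and y together are at most L + 1 times that of q, and the error is finally
   divided by A. *)
pose e' := e * cnorm A / (L + 1).
have L10 : 0 < L + 1 := ltr_wpDr ler01 L0.
have e'0 : 0 < e' := divr_gt0 (mulr_gt0 e0 A0) L10.
have [d3 d30 H3] := linear_approx2 N dP e'0.
have L20 : 0 < 2 * L by rewrite mulr_gt0.
(* The last radius keeps X q' within d3 of X q, by the Lipschitz bound. *)
exists (Num.min (Num.min d2 d3) (d3 / (2 * L))).
  by rewrite lt_min (divr_gt0 d30 L20) andbT lt_min d20.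
move=> q'; rewrite {1 2}/disc /= !lt_min !ltr_pdivlMr //.
move=> /andP[/andP[/andP[h1 h2] h3] h4] /andP[/andP[/andP[k1 k2] k3] k4].
have lipq : cnorm (X q' - X q) <= L * (cnorm (q'.1 - q.1) + cnorm (q'.2 - q.2)).
  by apply: lip; rewrite /disc /= lt_min ?h1 ?h2 ?k1 ?k2.
have Wq' : W q' by apply: dW; split.
have [Xr' Xq'] := HX q' Wq'.
have Xd3 : disc N P.1 d3 (X q').
  rewrite /disc /=; apply: le_lt_trans lipq _.
  by move: h4 k4; norm_lra.
have := H3 (X q', q'.2) Xd3 k3; rewrite /= Xq' /P Xq -/P -/A -/B => H.
have -> : X q' - X q - (A^-1 * (q'.1 - q.1) + - B / A * (q'.2 - q.2)) =
   - (q'.1 - q.1 - (A * (X q' - X q) + B * (q'.2 - q.2))) / A.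
  by field.
rewrite cnormM cnormN cnormV (ler_pdivrMr _ _ A0).
have LL : 0 < L + 1 by move: L0; norm_lra.
set T := cnorm (q'.1 - q.1) + cnorm (q'.2 - q.2) in lipq *.
apply: le_trans H _.
have -> : e * T * cnorm A = e' * ((L + 1) * T).
  by rewrite /e'; field; rewrite gt_eqF.
rewrite ler_pM2l // mulrDl mul1r; apply: lerD => //.
by rewrite /T lerDr cnorm_ge0.
Qed.

End Contraction.

(** X (t, y) is the solution x of psi (x, y) = t. Keeping t as a variable makes (psi, y) a local
    coordinate system, in which the level curves of psi are straight lines. *)
Lemma implicit_function (U : set (K * K)) (psi : K * K -> K) (z0 : K * K) :
  open U -> U z0 -> smooth U psi -> pdx psi z0 != 0 ->
  exists r rho : R, [/\ 0 < r, 0 < rho,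
    disc N z0.1 r `*` disc N z0.2 rho `<=` U & exists X : K * K -> K,
    let W := disc N (psi z0) rho `*` disc N z0.2 rho in
    [/\ forall q, W q -> disc N z0.1 r (X q) /\ psi (X q, q.2) = q.1,
        forall x y, disc N z0.1 r x -> disc N z0.2 rho y ->
          disc N (psi z0) rho (psi (x, y)) -> X (psi (x, y), y) = x,
        smooth W X
      & forall q, W q -> pdx psi (X q, q.2) != 0 /\
          pdy X q = - pdy psi (X q, q.2) / pdx psi (X q, q.2)]].
Proof.
move=> oU Uz spsi c0; set c := pdx psi z0 in c0 *.
have n0 : 0 < cnorm c by exact: cnorm_gt0.
have [r1 r10 r1U] := open_ex_bidisc N oU Uz.
have n2 : 0 < cnorm c / 2 by rewrite divr_gt0.
have [r2 r20 Hr2] := continuous_plane (smooth_differentiable (smooth_pdx spsi) Uz) n2.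
pose r := Num.min r1 r2.
have r0 : 0 < r by rewrite lt_min r10.
have sub1 z w i : disc N z r w -> r <= i -> disc N z i w.
  by rewrite /disc /= => /lt_le_trans; apply.
have rr1 : r <= r1 by rewrite ge_min lexx.
have rr2 : r <= r2 by rewrite ge_min lexx orbT.
have rU w : disc N z0.1 r w.1 -> disc N z0.2 r w.2 ->
    U w /\ cnorm (pdx psi w - c) <= cnorm c / 2.
  move=> w1 w2; split; first by apply: r1U; split; exact: sub1 rr1.
  by apply: Hr2; exact: sub1 rr2.
have e0 : 0 < cnorm c * r / 32 by rewrite !mulr_gt0.
have [d d0 Hd] := continuous_plane (smooth_differentiable spsi Uz) e0.
(* Both psi (z0.1, y) and t are then within |c| r / 32 of psi z0, hence within |c| r / 16 of each
   other, as [slice_solution] requires. *)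
pose rho := Num.min (Num.min r d) (cnorm c * r / 32).
have rho0 : 0 < rho by rewrite lt_min e0 andbT lt_min r0.
have rho_lt w z : disc N z rho w -> [/\ disc N z r w, disc N z d w &
    cnorm (w - z) < cnorm c * r / 32].
  by rewrite /disc /rho lt_min => /andP[+ ->]; rewrite lt_min => /andP[].
have rho_r y : disc N z0.2 rho y -> disc N z0.2 r y by case/rho_lt.
pose W := disc N (psi z0) rho `*` disc N z0.2 rho.
have oW : open W by exact: (@open_bidisc _ _ N (psi z0, z0.2)).
have ex q : exists x, W q -> disc N z0.1 r x /\ psi (x, q.2) = q.1.
  have [Wq|nW] := pselect (W q); last by exists 0.
  have [t1 y1] := Wq.
  have [x xr xE] : exists2 x, disc N z0.1 r x & psi (x, q.2) = q.1.
    apply: (slice_solution spsi r0 c0 rU); first exact: rho_r.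
    have [_ yd _] := rho_lt _ _ y1.
    have := Hd (z0.1, q.2) (disc_center N _ d0) yd.
    have [_ _ te] := rho_lt _ _ t1.
    have := cnormD N (psi (z0.1, q.2) - psi z0) (psi z0 - q.1).
    rewrite addrA subrK (cnormB N (psi z0) q.1).
    by move: te; norm_lra.
  by exists x.
have [X HX] := choice ex.
have W2 q : W q -> disc N z0.2 r q.2 by move=> [_ /rho_r].
have XP := solution_differentiable spsi c0 rU oW W2 HX.
pose D := disc N z0.1 r `*` disc N z0.2 r.
have oD : open D by exact: open_bidisc.
have DU : D `<=` U by move=> w [w1 w2]; have [] := rU w w1 w2.
have px0 w : D w -> pdx psi w != 0.
  move=> [w1 w2]; have [_] := rU w w1 w2; apply: contra_leN => /eqP ->.
  by rewrite sub0r cnormN gtr_pMr // invf_lt1 // ltr1n.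
have s1 : smooth D (fun w => (pdx psi w)^-1).
  by apply: smoothV => //; apply: smooth_pdx; exact: smooth_subset DU spsi.
have s3 : smooth D (pdy psi) by apply: smooth_pdy; exact: smooth_subset DU spsi.
have s2 := smoothM oD (smoothN oD s3) s1.
have WD q : W q -> D (X q, q.2).
  by move=> Wq; have [Xr _] := HX q Wq; split; [exact: Xr | exact: W2 Wq].
exists r, rho; split=> //.
  by move=> w [w1 w2]; apply: DU; split; [exact: w1 | exact: rho_r w2].
exists X; split=> //.
- move=> x y xr yr tr.
  have [Xr XE] := HX (psi (x, y), y) (conj tr yr).
  have := slice_lower_bound spsi rU Xr xr (rho_r _ yr).
  rewrite XE /= subrr cnorm0 pmulr_rle0 // => H.
  apply/eqP; rewrite -subr_eq0; apply/eqP; apply: (@cnorm_eq0 _ _ N).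
  by apply/eqP; rewrite eq_le H cnorm_ge0.
(* The partial derivatives of X are smooth functions of (X, y), so each order known for X yields the
   next. *)
- apply/smoothP => k; elim: k => [//|k IHk]; split=> [q Wq|v].
    by have [] := XP q Wq.
  apply: (@nsmooth_eq _ _ _ _ (cst v.1 * (fun q => (fun w => (pdx psi w)^-1) (X q, q.2))
     + cst v.2 * (fun q => (- pdy psi * (fun w => (pdx psi w)^-1)) (X q, q.2)))) => //.
    move=> q Wq; have [dX pX pY] := XP q Wq.
    rewrite -[LHS]/(v.1 * (pdx psi (X q, q.2))^-1 +
      v.2 * (- pdy psi (X q, q.2) / pdx psi (X q, q.2))) -pY -pX /pdx /pdy !deriveE //.
    have -> : 'd X q v = 'd X q (v.1 *: ((1, 0) : K * K) + v.2 *: ((0, 1) : K * K)).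
      congr ('d X q _); rewrite -[RHS]/(_ * _ + _ * _, _ * _ + _ * _) /=.
      by case: v => v1 v2; congr pair; rewrite /= ?mulr1 ?mulr0 ?addr0 ?add0r.
    by rewrite linearD !linearZ.
  have nc a : nsmooth k W (cst a : K * K -> K) by have /smoothP := @smooth_cst _ _ W a.
  have ns : nsmooth k W (snd : K * K -> K) by have /smoothP := @smooth_snd K W; exact.
  apply: nsmoothD => //; apply: nsmoothM => //.
    exact: (nsmooth_comp2 oW s1 IHk ns WD).
  exact: (nsmooth_comp2 oW s2 IHk ns WD).
- by move=> q Wq; have [_ _ pY] := XP q Wq; split=> //; apply: px0; exact: WD.
Qed.

End ImplicitFunction.

(** * Jet polynomials *)

Section MapMpoly.
Context {n : nat} {A B : comNzRingType}.
Variable f : A -> B.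
Hypothesis f0 : f 0 = 0.

(** Needed for [pdx] and [pdy], which are not additive on arbitrary functions; the value at 0 alone
    makes the action coefficientwise. *)
Lemma mcoeff_map_mpoly0 (p : mpoly n A) m : mcoeff m (map_mpoly f p) = f (mcoeff m p).
Proof.
rewrite /map_mpoly /mmap raddf_sum /=.
under eq_bigr do rewrite mmap1_id mcoeffCM mcoeffX.
have [mp|mp] := boolP (m \in msupp p).
  rewrite (bigD1_seq m) //= ?msupp_uniq // eqxx mulr1 big1 ?addr0 //.
  by move=> i /negbTE ->; rewrite mulr0.
rewrite (memN_msupp_eq0 mp) f0 big1_seq // => i /andP[_ ip].
have [im|] := eqVneq i m; first by rewrite im (negbTE mp) in ip.
by rewrite mulr0.
Qed.

End MapMpoly.

Section JetAlgebra.
Context {K : numFieldType} {n : nat}.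
Notation jetP := (jet_poly (K := K) n).
Implicit Types (P Q : jetP) (z : K * K) (v : 'I_n -> K).

Definition value_at z : (K * K -> K) -> K := fun g => g z.

HB.instance Definition _ z := GRing.isAdditive.Build (K * K -> K) K (value_at z)
  (fun f g => erefl).
HB.instance Definition _ z := GRing.isMultiplicative.Build (K * K -> K) K (value_at z)
  (conj (fun f g => erefl) erefl).

Definition jet_at z P : mpoly n K := map_mpoly (value_at z) P.

Definition jet_eval z v P : K := meval v (jet_at z P).

Lemma mcoeff_jet_at z P m : mcoeff m (jet_at z P) = (mcoeff m P) z.
Proof. by rewrite mcoeff_map_mpoly. Qed.

Lemma jet_evalD z v P Q : jet_eval z v (P + Q) = jet_eval z v P + jet_eval z v Q.
Proof. by rewrite /jet_eval /jet_at rmorphD /= mevalD. Qed.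

Lemma jet_evalN z v P : jet_eval z v (- P) = - jet_eval z v P.
Proof. by rewrite /jet_eval /jet_at rmorphN /= mevalN. Qed.

Lemma jet_evalB z v P Q : jet_eval z v (P - Q) = jet_eval z v P - jet_eval z v Q.
Proof. by rewrite jet_evalD jet_evalN. Qed.

Lemma jet_evalM z v P Q : jet_eval z v (P * Q) = jet_eval z v P * jet_eval z v Q.
Proof. by rewrite /jet_eval /jet_at rmorphM /= mevalM. Qed.

Lemma jet_evalX z v P k : jet_eval z v (P ^+ k) = jet_eval z v P ^+ k.
Proof. by rewrite /jet_eval /jet_at !rmorphXn. Qed.

Lemma jet_evalMn z v P k : jet_eval z v (P *+ k) = jet_eval z v P *+ k.
Proof. by rewrite /jet_eval /jet_at !raddfMn. Qed.

Lemma jet_eval_sum z v I (r : seq I) (p : pred I) (F : I -> jetP) :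
  jet_eval z v (\sum_(i <- r | p i) F i) = \sum_(i <- r | p i) jet_eval z v (F i).
Proof.
apply: (big_morph (jet_eval z v) (jet_evalD z v)).
by rewrite /jet_eval /jet_at !rmorph0.
Qed.

Lemma jet_eval_cst z v g : jet_eval z v (cstJ n g) = g z.
Proof. by rewrite /jet_eval /jet_at map_mpolyC mevalC. Qed.

Lemma jet_eval_var z v i : jet_eval z v (varJ i) = v i.
Proof. by rewrite /jet_eval /jet_at map_mpolyX mevalXU. Qed.

Lemma jet_eval_Dtot z v P : jet_eval z v (Dtot P) =
  jet_eval z v (map_mpoly pdx P) + jet_eval z v (jet n 1) * jet_eval z v (map_mpoly pdy P)
  + \sum_(i < n) jet_eval z v (jet n i.+2) * jet_eval z v (mderiv i P).
Proof.
rewrite [LHS]jet_evalD; congr (_ + _).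
  by rewrite [LHS]jet_evalD; congr (_ + _); exact: jet_evalM.
rewrite [LHS]jet_eval_sum; apply: eq_bigr => i _; exact: jet_evalM.
Qed.

Lemma jet_ord (i : 'I_n) : jet n i.+1 = varJ i :> jetP.
Proof.
rewrite /jet (bigD1 i) //= big1 ?addr0 // => j /andP[/eqP[ij]].
by rewrite (ord_inj ij) eqxx.
Qed.

Lemma jet_big k : (n < k)%N -> jet n k = 0 :> jetP.
Proof.
by move=> nk; rewrite /jet big1 // => i /eqP ik; move: nk; rewrite -ik ltnNge (ltn_ord i).
Qed.

Lemma jet_eval_map z v (h : (K * K -> K) -> K * K -> K) P : h 0 = 0 ->
  jet_eval z v (map_mpoly h P) =
  \sum_(m <- msupp P) h (mcoeff m P) z * meval v (mpolyX _ m).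
Proof.
move=> h0; rewrite /jet_eval.
have -> : jet_at z (map_mpoly h P) = map_mpoly (fun g => h g z) P.
  by apply/mpolyP => m; rewrite mcoeff_jet_at !mcoeff_map_mpoly0 // h0.
rewrite /map_mpoly /mmap raddf_sum /=; apply: eq_bigr => m _.
by rewrite mmap1_id rmorphM /= mevalC.
Qed.

Lemma jet_evalE z v P :
  jet_eval z v P = \sum_(m <- msupp P) mcoeff m P z * meval v (mpolyX _ m).
Proof.
rewrite -(@jet_eval_map z v idfun _ (erefl 0)); congr jet_eval.
by apply/mpolyP => m; rewrite mcoeff_map_mpoly0.
Qed.

Lemma jet_at_deriv z i P : jet_at z (mderiv i P) = mderiv i (jet_at z P).
Proof.
apply/mpolyP => m; rewrite mcoeff_jet_at !mcoeff_mderiv mcoeff_jet_at.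
elim: (m i).+1 => [//|k IHk]; by rewrite !mulrS -IHk.
Qed.

Lemma jet_eval_deriv z v i P : jet_eval z v (mderiv i P) =
  \sum_(m <- msupp P) mcoeff m P z * meval v (mderiv i (mpolyX _ m)).
Proof.
rewrite /jet_eval jet_at_deriv.
have -> : jet_at z P = \sum_(m <- msupp P)
    mpolyC n (mcoeff m P z) * mmap1 (fun i => mpolyX _ (mnm1 i)) m by [].
rewrite (raddf_sum (mderiv i)) raddf_sum /=; apply: eq_bigr => m _.
by rewrite mmap1_id mderiv_mulC mevalM mevalC.
Qed.

Lemma pdx0 : pdx (0 : K * K -> K) = 0.
Proof. by apply/funext => z; rewrite /pdx -[0 in LHS]/(cst 0) derive_cst. Qed.

Lemma pdy0 : pdy (0 : K * K -> K) = 0.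
Proof. by apply/funext => z; rewrite /pdy -[0 in LHS]/(cst 0) derive_cst. Qed.

Definition coef_smooth (U : set (K * K)) P := forall m, smooth U (mcoeff m P).

Section CoefSmooth.
Variable U : set (K * K).
Hypothesis oU : open U.

Lemma coef_smooth0 : coef_smooth U 0.
Proof. by move=> m; rewrite mcoeff0; exact: smooth_cst. Qed.

Lemma coef_smoothD P Q : coef_smooth U P -> coef_smooth U Q -> coef_smooth U (P + Q).
Proof. by move=> sP sQ m; rewrite mcoeffD; exact: smoothD. Qed.

Lemma coef_smoothN P : coef_smooth U P -> coef_smooth U (- P).
Proof. by move=> sP m; rewrite mcoeffN; exact: smoothN. Qed.

Lemma coef_smoothM P Q : coef_smooth U P -> coef_smooth U Q -> coef_smooth U (P * Q).
Proof.
by move=> sP sQ m; rewrite mcoeffM; apply: smooth_sum => // i _; exact: smoothM.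
Qed.

Lemma coef_smoothMn P k : coef_smooth U P -> coef_smooth U (P *+ k).
Proof. by move=> sP m; rewrite mcoeffMn; exact: smoothMn. Qed.

Lemma coef_smooth_sum I (r : seq I) (p : pred I) (F : I -> jetP) :
  (forall i, p i -> coef_smooth U (F i)) -> coef_smooth U (\sum_(i <- r | p i) F i).
Proof.
move=> sF; elim/big_ind: _ => //; first exact: coef_smooth0.
by move=> P Q; exact: coef_smoothD.
Qed.

Lemma coef_smooth_cst g : smooth U g -> coef_smooth U (cstJ n g).
Proof.
move=> sg m; rewrite mcoeffC; case: eqP => _; first by rewrite mulr1.
by rewrite mulr0; exact: smooth_cst.
Qed.

Lemma coef_smooth_var i : coef_smooth U (varJ i).
Proof.
move=> m; rewrite mcoeffX; case: eqP => _; exact: smooth_cst.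
Qed.

Lemma coef_smooth_jet k : coef_smooth U (jet n k).
Proof. by apply: coef_smooth_sum => i _; exact: coef_smooth_var. Qed.

Lemma coef_smooth_Dtot P : coef_smooth U P -> coef_smooth U (Dtot P).
Proof.
move=> sP; apply: coef_smoothD; first apply: coef_smoothD.
- by move=> m; rewrite mcoeff_map_mpoly0 ?pdx0 //; exact: smooth_pdx.
- apply: coef_smoothM; first exact: coef_smooth_jet.
  by move=> m; rewrite mcoeff_map_mpoly0 ?pdy0 //; exact: smooth_pdy.
- apply: coef_smooth_sum => i _; apply: coef_smoothM; first exact: coef_smooth_jet.
  by move=> m; rewrite mcoeff_mderiv; exact: smoothMn.
Qed.

End CoefSmooth.

(* P is a polynomial in y', ..., y^(k). *)
Definition order_le (k : nat) P :=
  forall (m : multinom n) (i : 'I_n), (k <= i)%N -> m i != 0%N -> mcoeff m P = 0.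

Lemma order_leW k j P : (k <= j)%N -> order_le k P -> order_le j P.
Proof. by move=> kj oP m i ji; apply: oP; exact: leq_trans ji. Qed.

Lemma order_leD k P Q : order_le k P -> order_le k Q -> order_le k (P + Q).
Proof. by move=> oP oQ m i ki mi; rewrite mcoeffD (oP m i) // (oQ m i) // addr0. Qed.

Lemma order_leN k P : order_le k P -> order_le k (- P).
Proof. by move=> oP m i ki mi; rewrite mcoeffN (oP m i) // oppr0. Qed.

Lemma order_leM k P Q : order_le k P -> order_le k Q -> order_le k (P * Q).
Proof.
move=> oP oQ m i ki mi; rewrite mcoeffM big1 // => -[m1 m2] /= /eqP mE.
have [m1i|m1i] := eqVneq (bmnm m1 i) 0%N; last by rewrite (oP _ i) // mul0r.
rewrite (oQ (bmnm m2) i) ?mulr0 //; apply: contra mi => /eqP m2i.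
by rewrite mE mnmDE m1i m2i.
Qed.

Lemma order_leMn k P j : order_le k P -> order_le k (P *+ j).
Proof. by move=> oP m i ki mi; rewrite mcoeffMn (oP m i) // mul0rn. Qed.

Lemma order_le_sum k I (r : seq I) (p : pred I) (F : I -> jetP) :
  (forall i, p i -> order_le k (F i)) -> order_le k (\sum_(i <- r | p i) F i).
Proof.
move=> oF; elim/big_ind: _ => //; last by move=> P Q; exact: order_leD.
by move=> m i _ _; rewrite mcoeff0.
Qed.

Lemma order_le_cst k g : order_le k (cstJ n g).
Proof.
move=> m i _ mi; rewrite mcoeffC; case: eqP => [m0|_]; last by rewrite mulr0.
by rewrite m0 mnm0E in mi.
Qed.

Lemma order_le_var k (i : 'I_n) : (i < k)%N -> order_le k (varJ i).
Proof.
move=> ik m j kj mj; rewrite mcoeffX; have [E|//] := eqVneq (mnm1 i) m.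
have [ij|ij] := eqVneq i j; first by move: kj; rewrite -ij leqNgt ik.
by move: mj; rewrite -E mnm1E (negbTE ij).
Qed.

Lemma order_le_jet k j : (j <= k)%N -> order_le k (jet n j).
Proof. by move=> jk; apply: order_le_sum => i /eqP ij; apply: order_le_var; rewrite ij. Qed.

Lemma order_le_map k (h : (K * K -> K) -> K * K -> K) P : h 0 = 0 ->
  order_le k P -> order_le k (map_mpoly h P).
Proof. by move=> h0 oP m i ki mi; rewrite mcoeff_map_mpoly0 // (oP m i) // h0. Qed.

Lemma order_le_deriv k i P : order_le k P -> order_le k (mderiv i P).
Proof.
move=> oP m j kj mj; rewrite mcoeff_mderiv (oP _ j) ?mul0rn // mnmDE.
by rewrite addn_eq0 negb_and mj.
Qed.

Lemma deriv_order_le k (i : 'I_n) P : order_le k P -> (k <= i)%N -> mderiv i P = 0.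
Proof.
move=> oP ki; apply/mpolyP => m; rewrite mcoeff_mderiv mcoeff0 (oP _ i) ?mul0rn //.
by rewrite mnmDE mnm1E eqxx addn1.
Qed.

(** Differentiation multiplies a coefficient by a positive integer, and the characteristic is 0. The
    argument is pointwise because the ring of coefficient functions has torsion to be excluded
    through its values in K. *)
Lemma order_le_of_deriv k P : (forall i : 'I_n, (k <= i)%N -> mderiv i P = 0) ->
  order_le k P.
Proof.
move=> dP m i ki mi; have := congr1 (mcoeff (mnm_sub m (mnm1 i))) (dP i ki).
rewrite mcoeff_mderiv mcoeff0 submK; last by rewrite lep1mP.
move: (_ i).+1 (ltn0Sn ((mnm_sub m (mnm1 i)) i)) => j j0 E.
apply/funext => z; have := congr1 (value_at z) E.
rewrite raddfMn raddf0 => /eqP; rewrite mulrn_eq0 => /orP[/eqP j0'|/eqP //].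
by rewrite j0' in j0.
Qed.

Lemma order_le_Dtot k P : order_le k P -> order_le k.+1 (Dtot P).
Proof.
move=> oP; apply: order_leD; first apply: order_leD.
- by apply: order_le_map; [exact: pdx0 | exact: order_leW oP].
- apply: order_leM; first exact: order_le_jet.
  by apply: order_le_map; [exact: pdy0 | exact: order_leW oP].
- apply: order_le_sum => i _; have [ki|ik] := leqP k i.
    by rewrite (deriv_order_le oP ki) mulr0 => m j _ _; rewrite mcoeff0.
  apply: order_leM; first exact: order_le_jet.
  by apply: order_le_deriv; exact: order_leW oP.
Qed.

Lemma jet_eval_order k P z v w : order_le k P ->
  (forall i : 'I_n, (i < k)%N -> v i = w i) -> jet_eval z v P = jet_eval z w P.
Proof.
move=> oP vw; rewrite !jet_evalE; apply: eq_bigr => m _.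
have [[i ki mi]|no] := pselect (exists2 i : 'I_n, (k <= i)%N & m i != 0%N).
  by rewrite (oP m i) // !mul0r.
rewrite !mevalX; congr (_ * _); apply: eq_bigr => i _.
have [ki|/vw -> //] := leqP k i.
have -> : m i = 0%N by apply/eqP/negP => /negP mi; apply: no; exists i.
by rewrite !expr0.
Qed.

End JetAlgebra.

(** * Derivatives of polynomial expressions, and polynomials that vanish everywhere *)

Section DerivativeRules.
Context {K : numFieldType}.
Implicit Types (f g : K -> K) (x : K).

(** The value of [derive1] is meaningful only together with differentiability; the rules below carry
    both at once. *)
Definition has_derive f x l := differentiable f x /\ derive1 f x = l.

Lemma has_derive_cst (c x : K) : has_derive (cst c) x 0.
Proof. by split=> //; rewrite derive1E derive_cst. Qed.

Lemma has_deriveD f g x a b : has_derive f x a -> has_derive g x b ->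
  has_derive (fun s => f s + g s) x (a + b).
Proof.
move=> [df <-] [dg <-]; split; first exact: (differentiableD df dg).
exact: (derive1D df dg).
Qed.

Lemma has_deriveM f g x a b : has_derive f x a -> has_derive g x b ->
  has_derive (fun s => f s * g s) x (a * g x + f x * b).
Proof.
move=> [df <-] [dg <-]; split; first exact: (differentiableM df dg).
exact: (derive1M df dg).
Qed.

Lemma has_derive_sum I (r : seq I) (F : I -> K -> K) (L : I -> K) x :
  (forall i, has_derive (F i) x (L i)) ->
  has_derive (fun s => \sum_(i <- r) F i s) x (\sum_(i <- r) L i).
Proof.
move=> H; elim: r => [|i r IHr].
  rewrite big_nil; have -> : (fun s => \sum_(i <- [::]) F i s) = cst 0.
    by apply/funext => s; rewrite big_nil.
  exact: has_derive_cst.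
rewrite big_cons; have -> : (fun s => \sum_(j <- i :: r) F j s) =
    (fun s => F i s + \sum_(j <- r) F j s).
  by apply/funext => s; rewrite big_cons.
exact: has_deriveD.
Qed.

Lemma has_derive_comp f g x a b : has_derive g x a -> has_derive f (g x) b ->
  has_derive (fun s => f (g s)) x (b * a).
Proof.
move=> [dg <-] [df <-]; split; first exact: (differentiable_comp dg df).
exact: (derive1_chain dg df).
Qed.

Lemma has_derive_eq (U : set K) f g x a : open U -> U x ->
  (forall s, U s -> f s = g s) -> has_derive f x a -> has_derive g x a.
Proof.
move=> oU Ux fg [df <-]; split; first exact: (differentiable_near_eq oU Ux fg).
by rewrite (derive1_near_eq oU Ux fg).
Qed.

Lemma smooth_has_derive (U : set K) f x : smooth U f -> U x ->
  has_derive f x (derive1 f x).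
Proof. by move=> sf Ux; split=> //; exact: smooth_differentiable Ux. Qed.

Lemma has_derive_meval n (v : K -> 'I_n -> K) (v' : 'I_n -> K) x (p : mpoly n K) :
  (forall i, has_derive (v ^~ i) x (v' i)) ->
  has_derive (fun s => meval (v s) p) x (\sum_(i < n) v' i * meval (v x) (mderiv i p)).
Proof.
move=> Hv.
pose PD p := has_derive (fun s => meval (v s) p) x
  (\sum_(i < n) v' i * meval (v x) (mderiv i p)).
have PDM p1 p2 : PD p1 -> PD p2 -> PD (p1 * p2).
  move=> h1 h2; rewrite /PD.
  have -> : (fun s => meval (v s) (p1 * p2)) = (fun s => meval (v s) p1 * meval (v s) p2).
    by apply/funext => s; rewrite mevalM.
  suff -> : \sum_(i < n) v' i * meval (v x) (mderiv i (p1 * p2)) =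
     (\sum_(i < n) v' i * meval (v x) (mderiv i p1)) * meval (v x) p2 +
     meval (v x) p1 * (\sum_(i < n) v' i * meval (v x) (mderiv i p2)).
    exact: has_deriveM.
  rewrite mulr_suml mulr_sumr -big_split /=; apply: eq_bigr => i _.
  by rewrite mderivM mevalD !mevalM; ring.
have PDC c : PD (mpolyC n c).
  rewrite /PD big1 => [|i _]; last by rewrite mderivC meval0 mulr0.
  have -> : (fun s => meval (v s) (mpolyC n c)) = cst c.
    by apply/funext => s; rewrite mevalC.
  exact: has_derive_cst.
have PDX i : PD (mpolyX _ (mnm1 i)).
  rewrite /PD.
  have -> : (fun s => meval (v s) (mpolyX _ (mnm1 i))) = v ^~ i.
    by apply/funext => s; rewrite mevalXU.
  rewrite (bigD1 i) //= big1 => [|j ji].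
    rewrite mderivX mnm1E eqxx scale1r mevalX big1 ?mulr1 ?addr0 // => j _.
    by rewrite mnmBE subnn expr0.
  by rewrite mderivX mnm1E eq_sym (negbTE ji) scale0r meval0 mulr0.
have PDm m : PD (mpolyX _ m).
  rewrite mpolyXE_id; elim/big_ind: _ => //; first exact: (PDC 1).
  move=> i _; elim: (m i) => [|k IHk]; first exact: (PDC 1).
  by rewrite exprS; exact: PDM.
rewrite -/(PD p); elim/mpolyind: p => [|c m p _ _ IHp]; first by rewrite -mpolyC0; exact: PDC.
have PDcm : PD (c *: mpolyX _ m) by rewrite -mul_mpolyC; exact: PDM.
rewrite /PD; have -> : (fun s => meval (v s) (c *: mpolyX _ m + p)) =
    (fun s => meval (v s) (c *: mpolyX _ m) + meval (v s) p).
  by apply/funext => s; rewrite mevalD.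
suff -> : \sum_(i < n) v' i * meval (v x) (mderiv i (c *: mpolyX _ m + p)) =
     \sum_(i < n) v' i * meval (v x) (mderiv i (c *: mpolyX _ m)) +
     \sum_(i < n) v' i * meval (v x) (mderiv i p).
  exact: has_deriveD.
by rewrite -big_split /=; apply: eq_bigr => i _; rewrite mderivD mevalD mulrDr.
Qed.

Lemma meval_zero n (q : mpoly n K) : meval (fun=> 0) q = mcoeff mnm0 q.
Proof.
elim/mpolyind: q => [|c m q _ _ IHq]; first by rewrite meval0 mcoeff0.
rewrite mevalD mcoeffD IHq mevalZ mcoeffZ mcoeffX mevalX; congr (c * _ + _).
have [->|m0] := eqVneq m mnm0.
  by rewrite big1 // => i _; rewrite mnm0E expr0.
have [i mi] : exists i, m i != 0%N.
  apply/not_existsP => H; move/eqP: m0; apply; apply/mnmP => i; rewrite mnm0E.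
  by apply/eqP; rewrite -[_ == _]negbK; apply/negP; exact: H.
by rewrite (bigD1 i) //= expr0n (negbTE mi) mul0r.
Qed.

(** Differentiating along coordinate lines shows that all partial derivatives vanish everywhere; at
    the origin they are the coefficients up to factorials, which are nonzero in characteristic 0. *)
Lemma meval_eq0 n (p : mpoly n K) : (forall v, meval v p = 0) -> p = 0.
Proof.
have step (i : 'I_n) (q : mpoly n K) : (forall v, meval v q = 0) ->
    forall v, meval v (mderiv i q) = 0.
  move=> H v.
  pose w (s : K) (j : 'I_n) : K := v j + s * (i == j)%:R.
  have Hw j : has_derive (w ^~ j) 0 (i == j)%:R.
    by split; [exact: differentiable_affine | exact: derive1_affine].
  have [_] := has_derive_meval q Hw.
  have -> : (fun s => meval (w s) q) = cst 0 by apply/funext => s; rewrite H.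
  rewrite derive1E derive_cst (bigD1 i) //= eqxx mul1r big1 => [|j ji].
    rewrite addr0 => E; rewrite [RHS]E; apply: meval_eq => j.
    by rewrite /w mul0r addr0.
  by rewrite eq_sym (negbTE ji) mul0r.
move=> H; apply/mpolyP => m; rewrite mcoeff0.
have Hm : forall v, meval v (mderivm m p) = 0.
  rewrite mderivm_foldr; elim: (flatten _) => [//|i s IHs] /=.
  exact: step.
have /eqP := Hm (fun=> 0); rewrite meval_zero mcoeff_mderivm mulrn_eq0 addm0.
case/orP => [|/eqP //]; rewrite -leqn0 leqNgt prodn_gt0 // => i.
by rewrite ffactnn fact_gt0.
Qed.

End DerivativeRules.

(** * Curves with a prescribed jet *)

Section TaylorCurve.
Context {K : numFieldType}.

Definition taylor_curve (n : nat) (x0 : K) (v : nat -> K) : K -> K :=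
  fun s => \sum_(k < n) v k * ((s - x0) ^+ k / (k`!)%:R).

Lemma derive1_taylor n x0 v x :
  has_derive (taylor_curve n.+1 x0 v) x (taylor_curve n x0 (fun k => v k.+1) x).
Proof.
have Hx : has_derive (fun s => s - x0) x 1.
  have := @has_deriveD _ id (cst (- x0)) x 1 0.
  rewrite addr0; apply; last exact: has_derive_cst.
  by split=> //; rewrite derive1E derive_id.
have Hk k : has_derive (fun s => (s - x0) ^+ k) x (k%:R * (x - x0) ^+ k.-1).
  elim: k => [|k IHk]; first by rewrite mul0r; exact: (has_derive_cst 1).
  have -> : (fun s => (s - x0) ^+ k.+1) = (fun s => (s - x0) * (s - x0) ^+ k).
    by apply/funext => s; rewrite exprS.
  have -> : k.+1%:R * (x - x0) ^+ k.+1.-1 =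
      1 * (x - x0) ^+ k + (x - x0) * (k%:R * (x - x0) ^+ k.-1).
    case: k {IHk} => [|k] /=; first by rewrite !expr0; ring.
    by rewrite -[k.+2%:R]natr1 exprS; ring.
  exact: has_deriveM.
rewrite /taylor_curve; pose L k := v k * ((k%:R * (x - x0) ^+ k.-1) / (k`!)%:R).
have -> : \sum_(k < n) v k.+1 * ((x - x0) ^+ k / (k`!)%:R) = \sum_(k < n.+1) L k.
  rewrite big_ord_recl /L !mul0r mulr0 add0r; apply: eq_bigr => k _.
  rewrite lift0 /= factS natrM; field.
  by rewrite pnatr_eq0 -lt0n fact_gt0 /= addrC natr1 pnatr_eq0.
apply: (@has_derive_sum _ _ _ (fun (k : 'I_n.+1) s => v k * ((s - x0) ^+ k / (k`!)%:R))
  (fun k : 'I_n.+1 => L k)) => k.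
have -> : L k = 0 * ((x - x0) ^+ k / (k`!)%:R) +
     v k * ((k%:R * (x - x0) ^+ k.-1) * (k`!)%:R^-1 + (x - x0) ^+ k * 0).
  by rewrite /L; ring.
apply: (@has_deriveM _ (cst (v k))); first exact: has_derive_cst.
apply: (@has_deriveM _ _ (cst ((k`!)%:R^-1))); [exact: Hk | exact: has_derive_cst].
Qed.

Lemma derive1n_taylor n k x0 v : (k <= n)%N ->
  derive1n k (taylor_curve n x0 v) = taylor_curve (n - k) x0 (fun j => v (j + k)%N).
Proof.
elim: k => [|k IHk] kn.
  by rewrite subn0; congr taylor_curve; apply/funext => j; rewrite addn0.
rewrite derive1nS IHk ?(ltnW kn) // subnS.
have nk : (0 < n - k)%N by rewrite subn_gt0.
rewrite -{1}(prednK nk); apply/funext => x.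
have [_ ->] := derive1_taylor (n - k).-1 x0 (fun j => v (j + k)%N) x.
by congr (taylor_curve _ _ _ x); apply/funext => j; rewrite addnS addSn.
Qed.

Lemma taylor_center n x0 v : taylor_curve n.+1 x0 v x0 = v 0%N.
Proof.
rewrite /taylor_curve big_ord_recl big1 => [|i _]; last first.
  by rewrite lift0 subrr expr0n /= mul0r mulr0.
by rewrite expr0 fact0 divr1 mulr1 addr0.
Qed.

Lemma smooth_taylor n x0 v U : open U -> smooth U (taylor_curve n x0 v).
Proof.
move=> oU; elim: n v => [|n IHn] v.
  have -> : taylor_curve 0 x0 v = cst 0 by apply/funext => s; rewrite /taylor_curve big_ord0.
  exact: smooth_cst.
apply: (smooth_primitive oU (IHn (fun k => v k.+1))) => z _; exact: derive1_taylor.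
Qed.

Lemma exists_jet (n : nat) (x0 : K) (v : nat -> K) : exists y : K -> K,
  (forall U : set K, open U -> smooth U y) /\ forall k, (k < n)%N -> derive1n k y x0 = v k.
Proof.
exists (taylor_curve n x0 v); split=> [U oU|k kn]; first exact: smooth_taylor.
rewrite derive1n_taylor 1?ltnW //; have nk : (0 < n - k)%N by rewrite subn_gt0.
by rewrite -(prednK nk) taylor_center.
Qed.

End TaylorCurve.

(** * Evaluation along curves *)

Section CurveEvaluation.
Context {K : numFieldType} {n : nat}.
Notation jetP := (jet_poly (K := K) n).
Implicit Types (P Q : jetP).

Definition curve_jet (y : K -> K) (x : K) (i : 'I_n) : K := derive1n i.+1 y x.

Definition curve_eval (y : K -> K) (P : jetP) (x : K) : K :=
  jet_eval (x, y x) (curve_jet y x) P.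

(** The chain rule. The bound on the order excludes y^(n) from P, the variable whose total
    derivative [Dtot] replaces by 0. *)
Lemma curve_eval_derive (U : set (K * K)) (I : set K) (y : K -> K) P x :
  (0 < n)%N -> smooth I y -> I x -> U (x, y x) -> coef_smooth U P ->
  order_le n.-1 P ->
  has_derive (curve_eval y P) x (curve_eval y (Dtot P) x).
Proof.
move=> n0 sy Ix Uxy sP oP.
have dy : has_derive y x (derive1 y x) by exact: smooth_has_derive Ix.
pose v' (i : 'I_n) := derive1n i.+2 y x.
have Hv i : has_derive ((curve_jet y) ^~ i) x (v' i).
  exact: (smooth_has_derive (smooth_derive1n i.+1 sy) Ix).
have Hg m : has_derive (fun s => mcoeff m P (s, y s)) x
    (pdx (mcoeff m P) (x, y x) + pdy (mcoeff m P) (x, y x) * derive1 y x).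
  have dm := smooth_differentiable (sP m) Uxy.
  have [dyx _] := dy.
  split; last exact: derive1_plane_curve.
  apply: (@differentiable_comp _ _ _ _ (fun s : K => (s, y s)) (mcoeff m P)) => //.
  have di : differentiable (id : K -> K) x by [].
  exact: (differentiable_pair di dyx).
have E : curve_eval y P = fun s => \sum_(m <- msupp P)
    mcoeff m P (s, y s) * meval (curve_jet y s) (mpolyX _ m).
  by apply/funext => s; rewrite /curve_eval jet_evalE.
rewrite E.
pose L m := (pdx (mcoeff m P) (x, y x) + pdy (mcoeff m P) (x, y x) * derive1 y x) *
  meval (curve_jet y x) (mpolyX _ m) + mcoeff m P (x, y x) *
  (\sum_(i < n) v' i * meval (curve_jet y x) (mderiv i (mpolyX _ m))).
suff -> : curve_eval y (Dtot P) x = \sum_(m <- msupp P) L m.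
  apply: has_derive_sum => m; apply: has_deriveM => //.
  exact: has_derive_meval.
have -> : curve_eval y (Dtot P) x =
   \sum_(m <- msupp P) pdx (mcoeff m P) (x, y x) * meval (curve_jet y x) (mpolyX _ m)
   + derive1 y x *
     (\sum_(m <- msupp P) pdy (mcoeff m P) (x, y x) * meval (curve_jet y x) (mpolyX _ m))
   + \sum_(i < n) v' i *
     (\sum_(m <- msupp P) mcoeff m P (x, y x) * meval (curve_jet y x) (mderiv i (mpolyX _ m))).
  rewrite [LHS]jet_eval_Dtot; congr (_ + _ * _ + _).
  - by apply: jet_eval_map; exact: pdx0.
  - by rewrite (jet_ord (Ordinal n0)); exact: jet_eval_var.
  - by apply: jet_eval_map; exact: pdy0.
  - apply: eq_bigr => i _; rewrite -jet_eval_deriv.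
    (* The last index stands for y^(n): there [jet n n.+1] is 0, but so is the derivative of P in
       y^(n). *)
    have [ni|ni] := ltnP i.+1 n.
      by rewrite (jet_ord (Ordinal ni)); congr (_ * _); exact: jet_eval_var.
    rewrite (deriv_order_le oP); last by rewrite -ltnS (prednK n0).
    have -> : jet_eval (x, y x) (curve_jet y x) 0 = 0 by rewrite /jet_eval /jet_at rmorph0 meval0.
    by rewrite !mulr0.
under [X in _ + X = _]eq_bigr => i _ do rewrite mulr_sumr.
rewrite exchange_big mulr_sumr -!big_split /=; apply: eq_bigr => m _.
rewrite /L; congr (_ + _); first by rewrite mulrDl; congr (_ + _); rewrite mulrA [_ * pdy _ _]mulrC.
by rewrite [RHS]mulr_sumr; apply: eq_bigr => i _; rewrite mulrCA.
Qed.

Variables (phi psi : K * K -> K).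

Lemma order_le_Delta : order_le 1 (Delta n psi).
Proof. by apply: order_le_Dtot; exact: order_le_cst. Qed.

Lemma coef_smooth_Delta U : open U -> smooth U psi -> coef_smooth U (Delta n psi).
Proof.
by move=> oU s; apply: coef_smooth_Dtot => //; exact: coef_smooth_cst.
Qed.

Lemma Ufrac_succ k : Ufrac n phi psi k.+1 = divDelta (DtotF psi (Ufrac n phi psi k)).
Proof. by []. Qed.

Lemma order_le_Ufrac k : order_le k (Ufrac n phi psi k).1.
Proof.
elim: k => [|k IHk]; first exact: order_le_cst.
rewrite Ufrac_succ /DtotF; have E := Ufrac_exponent n phi psi k.
case: (Ufrac n phi psi k) IHk E => Q e /= oQ eE; case: eqP => e0 /=.
  exact: order_le_Dtot.
have k0 : (0 < k)%N by case: (k) eE => // eE; case: e0; rewrite eE.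
have oD := order_le_Delta.
apply: order_leD.
  by apply: order_leM; [exact: order_leW oD | exact: order_le_Dtot].
apply: order_leN; apply: order_leMn; apply: order_leM; first exact: order_leW oQ.
by apply: (@order_leW _ _ 2); [rewrite ltnS | exact: order_le_Dtot].
Qed.

Lemma coef_smooth_Ufrac U k : open U -> smooth U phi -> smooth U psi ->
  coef_smooth U (Ufrac n phi psi k).1.
Proof.
move=> oU s1 s2; elim: k => [|k IHk]; first exact: coef_smooth_cst.
rewrite Ufrac_succ /DtotF; case: (Ufrac n phi psi k) IHk => Q e /= sQ.
have sD := coef_smooth_Delta oU s2.
case: eqP => _ /=; first exact: coef_smooth_Dtot.
apply: (coef_smoothD oU); first by apply: (coef_smoothM oU sD); exact: coef_smooth_Dtot.
apply: (coef_smoothN oU); apply: (coef_smoothMn oU); apply: (coef_smoothM oU sQ).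
exact: coef_smooth_Dtot.
Qed.

(** Stated for arbitrary values, so that its use leaves the large numerators closed. *)
Lemma curve_eval_step y x (P Q P' Q' : jetP) (e : nat) a b c d :
  curve_eval y P x = a -> curve_eval y Q x = b -> curve_eval y P' x = c ->
  curve_eval y Q' x = d ->
  curve_eval y (P * Q - P' * Q' *+ e) x = a * b - (c * d) *+ e.
Proof.
move=> <- <- <- <-; rewrite [LHS]jet_evalB; congr (_ - _); first exact: jet_evalM.
by rewrite [LHS]jet_evalMn; congr (_ *+ e); exact: jet_evalM.
Qed.

(* The functions W_k are the successive derivatives of u along the curve. *)
Lemma Ufrac_curve (U : set (K * K)) (I : set K) (y : K -> K) (W : nat -> K -> K) :
  open U -> open I -> smooth U phi -> smooth U psi -> smooth I y ->
  (forall x, I x -> U (x, y x) /\ derive1 (fun s => psi (s, y s)) x != 0) ->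
  (forall x, I x -> W 0%N x = phi (x, y x)) ->
  (forall k x, (k < n)%N -> I x ->
     has_derive (W k) x (W k.+1 x * derive1 (fun s => psi (s, y s)) x)) ->
  forall k x, (k <= n)%N -> I x -> curve_eval y (Ufrac n phi psi k).1 x =
    W k x * derive1 (fun s => psi (s, y s)) x ^+ (Ufrac n phi psi k).2.
Proof.
move=> oU oI s1 s2 sy IU W0 WS; set tau' := derive1 (fun s => psi (s, y s)).
have [n0|n0] := posnP n.
  move=> k x kn Ix; have -> : k = 0%N by apply/eqP; rewrite -leqn0 -n0.
  by rewrite /curve_eval jet_eval_cst W0 // mulr1.
have eD x : I x -> curve_eval y (Delta n psi) x = tau' x.
  move=> Ix; have [Uxy _] := IU x Ix.
  have oc : order_le n.-1 (cstJ n psi) by exact: order_le_cst.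
  have [_ <-] := curve_eval_derive n0 sy Ix Uxy (coef_smooth_cst s2) oc.
  rewrite /tau'; congr (derive1 _ x); apply/funext => s.
  by rewrite /curve_eval jet_eval_cst.
elim=> [|k IHk] x kn Ix.
  by rewrite /curve_eval jet_eval_cst mulr1 W0.
have Hk z : I z -> curve_eval y (Ufrac n phi psi k).1 z =
    W k z * tau' z ^+ (Ufrac n phi psi k).2 by move=> Iz; apply: IHk => //; exact: ltnW.
have [Uxy t0] := IU x Ix.
have sU := coef_smooth_Ufrac k oU s1 s2.
have oUk : order_le n.-1 (Ufrac n phi psi k).1.
  have kn1 : (k <= n.-1)%N by rewrite -ltnS (prednK n0).
  exact: (order_leW kn1 (@order_le_Ufrac k)).
have HQ := curve_eval_derive n0 sy Ix Uxy sU oUk.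
rewrite Ufrac_succ /DtotF; have E := Ufrac_exponent n phi psi k.
case: (Ufrac n phi psi k) E Hk HQ {sU oUk} => Q e /= eE Hk [_ HQ].
(* As e is the truncated difference 2 k - 1, it vanishes only for k = 0, where U_0 = phi has no
   denominator. *)
have [e0|e0] := eqVneq e 0%N => /=.
  have [_ HW] := WS k x kn Ix.
  rewrite expr1 -HW -HQ; apply: (derive1_near_eq oI Ix) => z Iz.
  by rewrite Hk // e0 mulr1.
have n1 : (1 <= n.-1)%N.
  have : (0 < k)%N by case: (k) eE => // eE; rewrite eE in e0.
  by move=> k0; rewrite -ltnS (prednK n0); exact: leq_ltn_trans k0 kn.
have oD : order_le n.-1 (Delta n psi) by exact: (order_leW n1 order_le_Delta).
have HD := curve_eval_derive n0 sy Ix Uxy (coef_smooth_Delta oU s2) oD.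
have HT : has_derive tau' x (curve_eval y (Dtot (Delta n psi)) x).
  by apply: (has_derive_eq oI Ix _ HD) => z Iz; exact: eD.
have HTe j : has_derive (fun s => tau' s ^+ j) x
    (j%:R * curve_eval y (Dtot (Delta n psi)) x * tau' x ^+ j.-1).
  elim: j => [|j IHj]; first by rewrite !mul0r; exact: (has_derive_cst 1).
  have -> : (fun s => tau' s ^+ j.+1) = (fun s => tau' s * tau' s ^+ j).
    by apply/funext => s; rewrite exprS.
  set d := curve_eval _ _ _ in HT IHj *.
  have -> : j.+1%:R * d * tau' x ^+ j.+1.-1 =
      d * tau' x ^+ j + tau' x * (j%:R * d * tau' x ^+ j.-1).
    case: j {IHj} => [|j] /=; first by rewrite !expr0; ring.
    by rewrite -[j.+2%:R]natr1 exprS; ring.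
  exact: has_deriveM.
(* Differentiating Q = W_k Delta^e along the curve gives D Q = W_(k+1) Delta^(e+1) + e W_k
   Delta^(e-1) D Delta; so Delta D Q - e Q D Delta = W_(k+1) Delta^(e+2). *)
have HWT := has_deriveM (WS k x kn Ix) (HTe e).
have [_ EQ] := has_derive_eq oI Ix (fun z Iz => esym (Hk z Iz)) HWT.
have EB := etrans (esym HQ) EQ.
apply: etrans (curve_eval_step e (eD x Ix) EB (Hk x Ix) erefl) _.
move: (curve_eval y (Dtot (Delta n psi)) x) => d; rewrite -/(tau' x).
case: e e0 {eE Hk HQ HTe HWT EQ EB} => [//|e] _ /=.
by rewrite -[X in _ - X]mulr_natl !exprS; ring.
Qed.

End CurveEvaluation.

(** * The leading term of the numerator of U_n *)

Section TopOrder.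
Context {K : numFieldType} {n : nat}.
Notation jetP := (jet_poly (K := K) n).
Implicit Types (P Q : jetP).

Lemma deriv_var (i j : 'I_n) : mderiv i (varJ j) = (i == j)%:R :> jetP.
Proof.
rewrite /varJ mderivX mnm1E [j == i]eq_sym; case: eqP => [->|_]; last by rewrite scale0r.
have -> : mnm_sub (mnm1 j) (mnm1 j) = mnm0 by apply/mnmP => k; rewrite mnmBE mnm0E subnn.
by rewrite scale1r mpolyX0.
Qed.

Lemma deriv_jet (i : 'I_n) k : mderiv i (jet n k) = (k == i.+1)%:R :> jetP.
Proof.
case: k => [|k].
  by rewrite /jet big_pred0 ?mderiv0 // => j; rewrite eqn0Ngt ltn0Sn.
have [kn|kn] := ltnP k n.
  by rewrite (jet_ord (Ordinal kn)) deriv_var eqSS eq_sym.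
rewrite jet_big // mderiv0 eqSS; case: eqP => // ki.
by move: kn; rewrite ki leqNgt ltn_ord.
Qed.

(* The derivatives of jet polynomials below are computed by instantiating
   identities in variables, since rewriting in the large terms is slow. *)
Lemma deriv_addM (i : 'I_n) (A B C : jetP) a b c :
  mderiv i A = a -> mderiv i B = b -> mderiv i C = c ->
  mderiv i (A + B * C) = a + (b * C + B * c).
Proof. by move=> <- <- <-; rewrite mderivD mderivM. Qed.

Lemma deriv_step (i : 'I_n) (A B C D : jetP) (e : nat) a b c d :
  mderiv i A = a -> mderiv i B = b -> mderiv i C = c -> mderiv i D = d ->
  mderiv i (A * B - C * D *+ e) = (a * B + A * b) - (c * D + C * d) *+ e.
Proof. by move=> <- <- <- <-; rewrite mderivB mderivMn !mderivM. Qed.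

Lemma deriv_sumM (i : 'I_n) (A B : 'I_n -> jetP) :
  mderiv i (\sum_j A j * B j) = \sum_j (mderiv i (A j) * B j + A j * mderiv i (B j)).
Proof. by rewrite raddf_sum; apply: eq_bigr => j _; exact: mderivM. Qed.

(** Only the summand y^(k+1) dP/dy^(k) of the total derivative contains y^(k+1). By the shift of
    indices, i stands for y^(k) and j for y^(k+1). *)
Lemma deriv_Dtot_top k P (i j : 'I_n) : i.+1 = j :> nat -> j = k :> nat ->
  order_le k P -> mderiv j (Dtot P) = mderiv i P.
Proof.
move=> ij jk oP.
have kj : (k <= j)%N by rewrite jk.
have oM (h : (K * K -> K) -> K * K -> K) : h 0 = 0 -> mderiv j (map_mpoly h P) = 0.
  by move=> h0; apply: (@deriv_order_le _ _ k) => //; exact: order_le_map.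
have j1 : mderiv j (jet n 1) = 0 :> jetP by rewrite deriv_jet eqSS -ij.
apply: etrans (mderivD _ _ _) _.
apply: etrans (congr2 +%R (deriv_addM (oM _ pdx0) j1 (oM _ pdy0)) (deriv_sumM _ _ _)) _.
rewrite mul0r mulr0 !add0r (bigD1 i) //= big1 => [|i' i'i].
  have -> : mderiv j (mderiv i P) = 0.
    by apply: etrans (mderiv_comm _ _ _) _; rewrite (deriv_order_le oP kj) mderiv0.
  by rewrite mulr0 !addr0 deriv_jet ij eqxx mul1r.
have -> : mderiv j (mderiv i' P) = 0.
  by apply: etrans (mderiv_comm _ _ _) _; rewrite (deriv_order_le oP kj) mderiv0.
rewrite mulr0 addr0 deriv_jet eqSS -ij eqSS; case: eqP => [E|_]; last by rewrite mul0r.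
by case/eqP: i'i; exact: ord_inj.
Qed.

Lemma map_cst h (g : K * K -> K) : h 0 = 0 ->
  map_mpoly h (cstJ n g) = cstJ n (h g) :> jetP.
Proof.
move=> h0; apply/mpolyP => m; rewrite mcoeff_map_mpoly0 // !mcoeffC.
by case: eqP => _; rewrite ?mulr1 ?mulr0.
Qed.

Lemma Dtot_cst (g : K * K -> K) :
  Dtot (cstJ n g) = cstJ n (pdx g) + jet n 1 * cstJ n (pdy g).
Proof.
have S0 : \sum_(i < n) jet n i.+2 * mderiv i (cstJ n g) = 0 :> jetP.
  by apply: big1 => j _; rewrite [X in _ * X]mderivC mulr0.
apply: etrans (congr2 +%R (congr2 +%R (map_cst _ pdx0) (congr2 *%R erefl (map_cst _ pdy0))) S0) _.
exact: addr0.
Qed.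

Lemma deriv_Dtot_cst (g : K * K -> K) (i : 'I_n) : i = 0%N :> nat ->
  mderiv i (Dtot (cstJ n g)) = cstJ n (pdy g).
Proof.
move=> i0; rewrite Dtot_cst.
have j1 : mderiv i (jet n 1) = 1 :> jetP by rewrite deriv_jet i0 eqxx.
apply: etrans (deriv_addM (mderivC _ _) j1 (mderivC _ _)) _.
by rewrite mul1r mulr0 addr0 add0r.
Qed.

(** The coefficient of y'' in D psi D^2 phi - D phi D^2 psi, where A = D psi, B = D phi and p = y':
    the terms in y' cancel and J remains. *)
Lemma wronskian_identity (A B X Y p a b c d : jetP) : A = c + p * d -> B = a + p * b ->
  (0 * X + A * b) - (0 * Y + B * d) *+ 1 = b * c - a * d.
Proof. by move=> -> ->; ring. Qed.

Lemma leading_identity (A B C D E : jetP) e :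
  (0 * A + B * C) - (0 * D + E * 0) *+ e = B * C.
Proof. by rewrite !mul0r mulr0 addr0 mul0rn subr0 add0r. Qed.

Variables (phi psi : K * K -> K).

Lemma deriv_Ufrac2 (i : 'I_n) : i = 1%N :> nat ->
  mderiv i (Ufrac n phi psi 2).1 = Jac n phi psi.
Proof.
move=> i1; have n0 : (0 < n)%N by apply: leq_ltn_trans (ltn_ord i).
pose i0 := Ordinal n0.
have o1 (g : K * K -> K) : order_le 1 (Dtot (cstJ n g)).
  by apply: order_le_Dtot; exact: order_le_cst.
have k1 : (1 <= i)%N by rewrite i1.
have d1 (g : K * K -> K) : mderiv i (Dtot (cstJ n g)) = 0 by exact: (deriv_order_le (o1 g) k1).
have d2 (g : K * K -> K) : mderiv i (Dtot (Dtot (cstJ n g))) = cstJ n (pdy g).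
  apply: etrans (@deriv_Dtot_top 1 _ i0 i _ _ (o1 g)) _ => //.
  exact: deriv_Dtot_cst.
apply: etrans (@deriv_step i _ _ _ _ 1 _ _ _ _ (d1 psi) (d2 phi) (d1 phi) (d2 psi)) _.
apply: etrans (wronskian_identity _ _ (Dtot_cst psi) (Dtot_cst phi)) _.
by rewrite /Jac /jacobian_det /cstJ mpolyCB !mpolyCM.
Qed.

(** From U_3 on, only the summand Delta D Q of the numerator contains the highest derivative, so
    each step multiplies its coefficient by Delta. *)
Lemma deriv_Ufrac_top k (i : 'I_n) : i.+1 = k.+2 -> mderiv i (Ufrac n phi psi k.+2).1 =
  Jac n phi psi * Delta n psi ^+ k.
Proof.
elim: k i => [|k IHk] i ik.
  by rewrite expr0 mulr1; apply: deriv_Ufrac2; case: ik.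
have kn : (k.+1 < n)%N by move: (ltn_ord i); case: ik => ->; exact: ltnW.
pose j := Ordinal kn.
have IH := IHk j erefl.
rewrite Ufrac_succ /DtotF; have E := Ufrac_exponent n phi psi k.+2.
have oQ := @order_le_Ufrac _ n phi psi k.+2.
case: (Ufrac n phi psi k.+2) IH oQ E => Q e /= IH oQ eE.
have e0 : e != 0%N by rewrite eE.
rewrite (negbTE e0) /=.
have ik2 : i = k.+2 :> nat by case: ik.
have oD : order_le k.+2 (Delta n psi) by apply: (@order_leW _ _ 1) => //; exact: order_le_Delta.
have oDD : order_le k.+2 (Dtot (Delta n psi)).
  apply: (@order_leW _ _ 2); first by [].
  by apply: order_le_Dtot; exact: order_le_Delta.
have ki : (k.+2 <= i)%N by rewrite ik2.
have dQ : mderiv i (Dtot Q) = Jac n phi psi * Delta n psi ^+ k.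
  by apply: etrans IH; apply: (@deriv_Dtot_top k.+2 _ j i) => //; rewrite ik2.
apply: etrans (@deriv_step i _ _ _ _ e _ _ _ _ (deriv_order_le oD ki) dQ
  (deriv_order_le oQ ki) (deriv_order_le oDD ki)) _.
apply: etrans (leading_identity _ _ _ _ _ _) _.
by rewrite exprS mulrCA.
Qed.

Lemma order_le_Jac k : order_le k (Jac n phi psi).
Proof. exact: order_le_cst. Qed.

Lemma order_leX k P e : order_le k P -> order_le k (P ^+ e).
Proof.
move=> oP; elim: e => [|e IHe]; last by rewrite exprS; exact: order_leM.
by rewrite expr0 -[1]/(cstJ n 1); exact: order_le_cst.
Qed.

Lemma order_le_Pn : (2 <= n)%N -> order_le n.-1 (Pn n phi psi).
Proof.
move=> n2; apply: order_le_of_deriv => i ni.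
have n1 : (n.-1 < n)%N by rewrite prednK // ltnW.
have iE : i = n.-1 :> nat.
  by apply/eqP; rewrite eqn_leq ni andbT -ltnS prednK ?ltn_ord // ltnW.
have nE : n = (n - 2).+2 by rewrite -addn2 subnK.
have iE2 : i.+1 = (n - 2).+2 by rewrite iE prednK // ltnW.
have oJD : order_le 1 (Jac n phi psi * Delta n psi ^+ (n - 2)).
  by apply: order_leM; [exact: order_le_Jac | apply: order_leX; exact: order_le_Delta].
have i1 : (1 <= i)%N by rewrite iE -ltnS prednK // ltnW.
have dU : mderiv i (Ufrac n phi psi n).1 = Jac n phi psi * Delta n psi ^+ (n - 2).
  by rewrite -(deriv_Ufrac_top iE2) -nE.
have dj : mderiv i (jet n n) = 1 :> jetP by rewrite deriv_jet iE prednK ?eqxx // ltnW.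
apply: etrans (mderivB _ _ _) _.
apply: etrans (congr2 (fun A B => A - B) dU (mderivM _ _ _)) _.
by rewrite (deriv_order_le oJD i1) dj mul0r add0r mulr1 subrr.
Qed.

End TopOrder.

(** * The linearizing system along a curve *)

Section LiftedEquation.
Context {K : numFieldType} {n m l : nat}.
Variables (p : 'I_m -> K * K -> K) (q : 'I_l -> K * K -> K).
Implicit Types (P M N : ode_poly K n m l).
Notation widen := (widen_ord (leq_pred n)).

Lemma lift_sum P : lift_ode_poly p q P =
  \sum_(mon <- msupp P) cstJ n (fun z => meval (base_point p q z) (mcoeff mon P)) *
    \prod_(i < n.-1) varJ (widen i) ^+ mon i.
Proof. by []. Qed.

Lemma jet_eval_lift z (v : 'I_n -> K) P :
  jet_eval z v (lift_ode_poly p q P) =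
  meval (fun i : 'I_n.-1 => v (widen i)) (specialize p q P z).
Proof.
rewrite lift_sum; apply: etrans (jet_eval_sum _ _ _ _ _) _.
rewrite /specialize /map_mpoly /mmap raddf_sum /=; apply: eq_bigr => mon _.
apply: etrans (jet_evalM _ _ _ _) _.
rewrite mmap1_id mevalM mevalC mevalX; congr (_ * _); first exact: jet_eval_cst.
rewrite (big_morph (jet_eval z v) (jet_evalM z v) (id1 := 1)); last exact: jet_eval_cst.
apply: eq_bigr => i _; apply: etrans (jet_evalX _ _ _ _) _; congr (_ ^+ _).
exact: jet_eval_var.
Qed.

Lemma eval_along_lift P y x :
  eval_along p q P y x = curve_eval y (lift_ode_poly p q P) x.
Proof. by rewrite [RHS]jet_eval_lift. Qed.

Lemma smooth_base_point U i : (forall j, smooth U (p j)) -> (forall j, smooth U (q j)) ->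
  smooth U (fun z => base_point p q z i).
Proof.
move=> sp sq; rewrite /base_point; case: (fintype.split i) => j.
  by case: (nat_of_ord j == 0%N); [exact: smooth_fst | exact: smooth_snd].
by case: (fintype.split j) => k.
Qed.

Lemma smooth_base_eval U (b : mpoly (2 + (m + l)) K) : open U ->
  (forall j, smooth U (p j)) -> (forall j, smooth U (q j)) ->
  smooth U (fun z => meval (base_point p q z) b).
Proof.
move=> oU sp sq.
have -> : (fun z => meval (base_point p q z) b) = \sum_(mon <- msupp b)
    (cst (mcoeff mon b) * \prod_i ((fun z => base_point p q z i) ^+ mon i)).
  apply/funext => z; rewrite mevalE fct_sumE; apply: eq_bigr => mon _.
  rewrite -[RHS]/(mcoeff mon b * (\prod_i ((fun z => base_point p q z i) ^+ mon i)) z).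
  congr (_ * _); rewrite fct_prodE; apply: eq_bigr => i _.
  by elim: (mon i) => [|k IHk]; rewrite ?expr0 // !exprS IHk.
apply: smooth_sum => // mon _; apply: smoothM => //; first exact: smooth_cst.
elim/big_ind: _ => //; first exact: smooth_cst.
  by move=> f g; exact: smoothM.
by move=> i _; apply: smoothX => //; exact: smooth_base_point.
Qed.

Lemma coef_smooth_lift U P : open U ->
  (forall j, smooth U (p j)) -> (forall j, smooth U (q j)) ->
  coef_smooth U (lift_ode_poly p q P).
Proof.
move=> oU sp sq; rewrite lift_sum; apply: coef_smooth_sum => // mon _.
apply: (coef_smoothM oU); first by apply: coef_smooth_cst; exact: smooth_base_eval.
elim/big_ind: _; first exact: (coef_smooth_cst (smooth_cst (1 : K))).
  by move=> A B; exact: coef_smoothM.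
move=> i _; elim: (mon i) => [|k IHk]; first exact: (coef_smooth_cst (smooth_cst (1 : K))).
by rewrite exprS; apply: (coef_smoothM oU) => //; exact: coef_smooth_var.
Qed.

Lemma order_le_lift P : order_le n.-1 (lift_ode_poly p q P).
Proof.
rewrite lift_sum; apply: order_le_sum => mon _; apply: order_leM; first exact: order_le_cst.
elim/big_ind: _; first exact: (order_le_cst (1 : K * K -> K)).
  by move=> A B; exact: order_leM.
move=> i _; apply: order_leX; apply: order_le_var; exact: (ltn_ord i).
Qed.

Variables (phi psi : K * K -> K) (a : 'I_(n - 2) -> K * K -> K).

Lemma order_le_Rpoly : (2 <= n)%N -> order_le n.-1 (Rpoly phi psi a).
Proof.
move=> n2; apply: order_leD; first exact: order_le_Pn.
apply: order_le_sum => k _.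
have kn : (k <= n.-1)%N.
  apply: leq_trans (ltnW (ltn_ord k)) _; rewrite -subn1; exact: leq_sub2l.
have n1 : (1 <= n.-1)%N by rewrite -ltnS prednK // ltnW.
apply: order_leM; last by apply: order_leX; apply: (order_leW n1); exact: order_le_Delta.
apply: order_leM; first exact: order_le_cst.
exact: (order_leW kn (@order_le_Ufrac _ _ _ _ k)).
Qed.

Lemma order_le_system M N : (2 <= n)%N ->
  order_le n.-1 (system_expression M N phi psi a p q).
Proof.
move=> n2; apply: order_leD.
  by apply: order_leM; [exact: order_le_Rpoly | exact: order_le_lift].
have n1 : (1 <= n.-1)%N by rewrite -ltnS prednK // ltnW.
apply: order_leN; apply: order_leM; last first.
  by apply: order_leX; apply: (order_leW n1); exact: order_le_Delta.
by apply: order_leM; [exact: order_le_Jac | exact: order_le_lift].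
Qed.

(* W k stands for the k-th derivative of u, and d for Delta. *)
Lemma system_value M N y x (W : nat -> K) (d : K) : (2 <= n)%N ->
  (forall k, (k <= n)%N -> curve_eval y (Ufrac n phi psi k).1 x =
     W k * d ^+ (Ufrac n phi psi k).2) ->
  curve_eval y (Delta n psi) x = d ->
  d ^+ (2 * n - 1) * (W n + \sum_(k < n - 2) a k (x, y x) * W k) * eval_along p q N y x =
  curve_eval y (system_expression M N phi psi a p q) x +
  jacobian_det phi psi (x, y x) * d ^+ (n - 2) *
    (derive1n n y x * eval_along p q N y x + eval_along p q M y x).
Proof.
move=> n2 HU Hd.
have n0 : (0 < n)%N by exact: ltnW.
have HJ : curve_eval y (Jac n phi psi) x = jacobian_det phi psi (x, y x).
  exact: jet_eval_cst.
have HX e : curve_eval y (Delta n psi ^+ e) x = d ^+ e.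
  by apply: etrans (jet_evalX _ _ _ _) _; congr (_ ^+ e); exact: Hd.
have Hj : curve_eval y (jet n n) x = derive1n n y x.
  have n1 : (n.-1 < n)%N by rewrite prednK.
  have E := @jet_ord K n (Ordinal n1).
  rewrite -[X in jet n X.+1]/(n.-1) (prednK n0) in E; rewrite E.
  by apply: etrans (jet_eval_var _ _ _) _; rewrite /curve_jet -[nat_of_ord _]/(n.-1) (prednK n0).
have HPn : curve_eval y (Pn n phi psi) x = W n * d ^+ (2 * n - 1) -
    jacobian_det phi psi (x, y x) * d ^+ (n - 2) * derive1n n y x.
  apply: etrans (jet_evalB _ _ _ _) _; congr (_ - _).
    by rewrite -(Ufrac_exponent n phi psi n); exact: HU.
  apply: etrans (jet_evalM _ _ _ _) _; congr (_ * _); last exact: Hj.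
  by apply: etrans (jet_evalM _ _ _ _) _; congr (_ * _); [exact: HJ | exact: HX].
have HR : curve_eval y (Rpoly phi psi a) x = W n * d ^+ (2 * n - 1) -
    jacobian_det phi psi (x, y x) * d ^+ (n - 2) * derive1n n y x +
    d ^+ (2 * n - 1) * \sum_(k < n - 2) a k (x, y x) * W k.
  apply: etrans (jet_evalD _ _ _ _) _; congr (_ + _); first exact: HPn.
  rewrite mulr_sumr; apply: etrans (jet_eval_sum _ _ _ _ _) _; apply: eq_bigr => k _.
  have kn : (k <= n)%N by apply: leq_trans (ltnW (ltn_ord k)) _; exact: leq_subr.
  apply: (@etrans _ _ ((a k (x, y x) * (W k * d ^+ (Ufrac n phi psi k).2)) *
      d ^+ (2 * n - 1 - (Ufrac n phi psi k).2))).
    apply: etrans (jet_evalM _ _ _ _) _; congr (_ * _); last exact: HX.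
    apply: etrans (jet_evalM _ _ _ _) _; congr (_ * _); first exact: jet_eval_cst.
    exact: HU.
  rewrite -!mulrA -exprD subnKC; first by rewrite [RHS]mulrC -mulrA.
  by rewrite Ufrac_exponent leq_sub2r // leq_mul2l.
have HS : curve_eval y (system_expression M N phi psi a p q) x =
    curve_eval y (Rpoly phi psi a) x * eval_along p q N y x -
    jacobian_det phi psi (x, y x) * eval_along p q M y x * d ^+ (n - 2).
  apply: etrans (jet_evalB _ _ _ _) _; congr (_ - _).
    by apply: etrans (jet_evalM _ _ _ _) _; congr (_ * _); rewrite eval_along_lift.
  apply: etrans (jet_evalM _ _ _ _) _; congr (_ * _); last exact: HX.
  apply: etrans (jet_evalM _ _ _ _) _; congr (_ * _); first exact: HJ.
  by rewrite eval_along_lift.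
rewrite HS HR; move: (\sum_(k < _) _) (jacobian_det _ _ _) (eval_along _ _ _ _ _)
  (eval_along _ _ _ _ _) (derive1n n y x) (d ^+ (n - 2)) (d ^+ (2 * n - 1)) (W n).
by move=> S J e1 e2 yn d1 d2 w; ring.
Qed.

End LiftedEquation.

(** * Functions of psi *)

Section OpenPreimage.
Context {K : numFieldType} {V : normedModType K}.

Lemma open_preimage (U : set V) (f : V -> K) (W : set K) : open U ->
  (forall z, U z -> differentiable f z) -> open W -> open (U `&` f @^-1` W).
Proof.
move=> oU df oW; rewrite openE => z [Uz Wz]; apply: filterI.
  exact: (open_nbhs_nbhs (conj oU Uz)).
by apply: (differentiable_continuous (df z Uz)); exact: (open_nbhs_nbhs (conj oW Wz)).
Qed.

End OpenPreimage.

Section Swap.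
Context {K : numFieldType}.
Implicit Types (f : K * K -> K) (U : set (K * K)).

(** Exchanging the coordinates reduces the case psi_y != 0 to psi_x != 0; the equations (ii) merely
    change sign. *)
Definition swap_fun f : K * K -> K := fun z => f (z.2, z.1).
Definition swap_set U : set (K * K) := fun z => U (z.2, z.1).

Lemma pdx_swap f z : differentiable f (z.2, z.1) ->
  pdx (swap_fun f) z = pdy f (z.2, z.1).
Proof.
move=> df; have [d1 _] := is_diff_fst z; have [d2 _] := is_diff_snd z.
rewrite /pdx (derive_comp2 _ d2 d1 df) derive_fst derive_snd /=.
by rewrite mulr0 mulr1 add0r.
Qed.

Lemma pdy_swap f z : differentiable f (z.2, z.1) ->
  pdy (swap_fun f) z = pdx f (z.2, z.1).
Proof.
move=> df; have [d1 _] := is_diff_fst z; have [d2 _] := is_diff_snd z.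
rewrite /pdy (derive_comp2 _ d2 d1 df) derive_fst derive_snd /=.
by rewrite mulr0 mulr1 addr0.
Qed.

Lemma open_swap U : open U -> open (swap_set U).
Proof.
move=> oU; rewrite openE => -[x y] Uyx.
have [[P Q] [/= nP nQ] PQ] : nbhs (y, x) U by exact: (open_nbhs_nbhs (conj oU Uyx)).
by exists (Q, P) => // -[a b] [/= Qa Pb]; apply: PQ; split.
Qed.

Lemma smooth_swap U f : open U -> smooth U f -> smooth (swap_set U) (swap_fun f).
Proof.
move=> oU sf; apply: (smooth_comp2 (open_swap oU) sf).
- exact: smooth_snd.
- exact: smooth_fst.
- by [].
Qed.

End Swap.

Section Factorization.
Context {R : realType} {K : numFieldType} (Nm : real_norm R K).
Local Notation cnorm := (rnorm Nm).

(** A single neighbourhood serves the whole family a, as it is determined by psi. *)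
Definition locally_function_of (U : set (K * K)) (psi : K * K -> K) (z0 : K * K)
    (I : Type) (a : I -> K * K -> K) :=
  exists (U' : set (K * K)) (V : set K) (al : I -> K -> K),
  [/\ open U' /\ U' z0, U' `<=` U, open V /\ psi @` U' `<=` V,
      forall i, smooth V (al i) & forall i z, U' z -> a i z = al i (psi z)].

(** By (ii), a is constant along the level curves s |-> (X (t, s), s) of psi, so it equals its value
    where the level curve meets the line y = z0.2. *)
Lemma factor_through_x (U : set (K * K)) (psi : K * K -> K) (z0 : K * K) I
    (a : I -> K * K -> K) :
  open U -> U z0 -> smooth U psi -> (forall i, smooth U (a i)) ->
  pdx psi z0 != 0 ->
  (forall i z, U z -> pdy psi z * pdx (a i) z - pdx psi z * pdy (a i) z = 0) ->
  locally_function_of U psi z0 a.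
Proof.
move=> oU Uz spsi sa px0 Ha.
have [r [rho [r0 rho0 BU [X /= [X1 X2 sX X3]]]]] := implicit_function Nm oU Uz spsi px0.
pose V := disc Nm (psi z0) rho.
pose Y := disc Nm z0.2 rho.
pose U' := (disc Nm z0.1 r `*` Y) `&` psi @^-1` V.
have oV : open V by exact: open_disc.
have oY : open Y by exact: open_disc.
have U'U : U' `<=` U by move=> z [Bz _]; exact: BU.
have Yz : Y z0.2 by exact: disc_center.
pose al i t := a i (X (t, z0.2), z0.2).
have BX t s : V t -> Y s -> U (X (t, s), s).
  by move=> Vt Ys; apply: BU; split => //=; have [] := X1 (t, s) (conj Vt Ys).
exists U', V, al; split=> //.
- split; last first.
    split; last exact: disc_center.
    by split; exact: disc_center.
  apply: open_preimage => //; first exact: (@open_bidisc _ _ Nm (z0.1, z0.2)).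
  by move=> z Bz; apply: (smooth_differentiable spsi); exact: BU.
- by split=> // _ [z [_ Vz] <-].
- move=> i; apply: (@smooth_comp2 _ _ _ U (a i) (fun t : K => X (t, z0.2)) (cst z0.2)) => //.
  + apply: (@smooth_comp2 _ _ _ (V `*` Y) X id (cst z0.2)) => //.
    * exact: smooth_id.
    * exact: smooth_cst.
  + exact: smooth_cst.
  + by move=> t Vt; exact: BX.
- move=> i -[x y] [[/= xr Yy] Vt]; rewrite /al.
  set t := psi (x, y) in Vt *.
  have Ex : X (t, y) = x by exact: X2.
  rewrite -{1}Ex.
  (* Its derivative is a_x X_s + a_y with X_s = - psi_y / psi_x, that is, minus the left side of
     (ii) divided by psi_x. *)
  pose G := fun s : K => a i (X (t, s), s).
  have HG s : Y s -> differentiable G s /\ derive1 G s = 0.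
    move=> Ys.
    have Ws : (V `*` Y) (t, s) by [].
    have Us : U (X (t, s), s) by exact: BX.
    have dX := smooth_differentiable sX Ws.
    have di : differentiable (id : K -> K) s by [].
    have dc : differentiable (cst t : K -> K) s by [].
    have dg : differentiable (fun s : K => X (t, s)) s.
      apply: (@differentiable_comp _ _ _ _ (fun s : K => (t, s)) X) => //.
    have da := smooth_differentiable (sa i) Us.
    split.
      apply: (@differentiable_comp _ _ _ _ (fun s : K => (X (t, s), s)) (a i)) => //.
      exact: (differentiable_pair dg di).
    rewrite derive1E (derive_comp2 _ dg di da).
    rewrite (derive_comp2 _ dc di dX) derive_id derive_cst mulr0 add0r !mulr1.
    have [p0 /= ->] := X3 (t, s) Ws; rewrite /= in p0.
    have := Ha i _ Us; move: p0.
    move: (pdx psi _) (pdy psi _) (pdx (a i) _) (pdy (a i) _) => A B c d A0 E.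
    have -> : c * (- B / A) + d = - (B * c - A * d) / A by field.
    by rewrite E oppr0 mul0r.
  exact: (disc_constant HG Yy Yz).
Qed.

Lemma factor_through (U : set (K * K)) (psi : K * K -> K) (z0 : K * K) I
    (a : I -> K * K -> K) :
  open U -> U z0 -> smooth U psi -> (forall i, smooth U (a i)) ->
  pdx psi z0 != 0 \/ pdy psi z0 != 0 ->
  (forall i z, U z -> pdy psi z * pdx (a i) z - pdx psi z * pdy (a i) z = 0) ->
  locally_function_of U psi z0 a.
Proof.
move=> oU Uz spsi sa [|p0 Ha]; first exact: factor_through_x.
have dpsi z : U z -> differentiable psi z by exact: smooth_differentiable.
have da i z : U z -> differentiable (a i) z by exact: smooth_differentiable.
have [||||||U' [V [al [[oU' U'z] U'U [oV psiV] sal aE]]]] :=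
    @factor_through_x (swap_set U) (swap_fun psi) (z0.2, z0.1) I (fun i => swap_fun (a i)).
- exact: open_swap.
- by rewrite /swap_set /= -surjective_pairing.
- exact: smooth_swap.
- by move=> i; exact: smooth_swap.
- by rewrite pdx_swap /= -surjective_pairing //; exact: dpsi.
- move=> i [x y] Uyx; have := Ha i (y, x) Uyx.
  rewrite pdx_swap ?pdy_swap ?pdx_swap ?pdy_swap /=; try exact: dpsi; try exact: da.
  by move=> E; rewrite -[RHS]oppr0 -E opprB.
exists (swap_set U'), V, al; split=> //.
- by split; [exact: open_swap | rewrite /swap_set].
- by move=> [x y] /U'U.
- split=> // _ [[x y] U'yx <-]; apply: psiV; exists (y, x) => //.
- by move=> i [x y] U'yx; rewrite -[RHS](aE i (y, x) U'yx).
Qed.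

Lemma locally_constant (U : set (K * K)) (f : K * K -> K) (z0 : K * K) (r : R) :
  (disc Nm z0.1 r `*` disc Nm z0.2 r) `<=` U -> 0 < r ->
  smooth U f -> (forall z, U z -> pdx f z = 0 /\ pdy f z = 0) ->
  forall z, (disc Nm z0.1 r `*` disc Nm z0.2 r) z -> f z = f z0.
Proof.
move=> BU r0 sf Hf [x y] [/= xr yr].
have df z : U z -> differentiable f z by exact: smooth_differentiable.
have z1 : disc Nm z0.1 r z0.1 by exact: disc_center.
have z2 : disc Nm z0.2 r z0.2 by exact: disc_center.
have H1 s : disc Nm z0.2 r s -> differentiable (fun s : K => f (x, s)) s /\
    derive1 (fun s : K => f (x, s)) s = 0.
  move=> sr; have Us : U (x, s) by exact: BU.
  have dfs := df _ Us.
  have di : differentiable (id : K -> K) s by [].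
  have dc : differentiable (cst x : K -> K) s by [].
  split; first by apply: (@differentiable_comp _ _ _ _ (fun s : K => (x, s)) f).
  rewrite derive1E (derive_comp2 _ dc di dfs) derive_id derive_cst.
  by have [-> ->] := Hf _ Us; rewrite !mul0r addr0.
have H2 s : disc Nm z0.1 r s -> differentiable (fun s : K => f (s, z0.2)) s /\
    derive1 (fun s : K => f (s, z0.2)) s = 0.
  move=> sr; have Us : U (s, z0.2) by exact: BU.
  have dfs := df _ Us.
  have di : differentiable (id : K -> K) s by [].
  have dc : differentiable (cst z0.2 : K -> K) s by [].
  split; first by apply: (@differentiable_comp _ _ _ _ (fun s : K => (s, z0.2)) f).
  rewrite derive1E (derive_comp2 _ di dc dfs) derive_id derive_cst.
  by have [-> ->] := Hf _ Us; rewrite !mul0r addr0.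
rewrite [RHS](_ : _ = f (z0.1, z0.2)); last by rewrite -surjective_pairing.
by rewrite (disc_constant H1 yr z2) (disc_constant H2 xr z1).
Qed.

End Factorization.

(** * From the system to a linearization *)

Section CurveTransformation.
Context {K : numFieldType} {n : nat}.

Lemma has_derive_along (U : set (K * K)) (I : set K) (psi : K * K -> K) (y : K -> K) x :
  smooth U psi -> smooth I y -> I x -> U (x, y x) ->
  has_derive (fun s => psi (s, y s)) x (derive1 (fun s => psi (s, y s)) x).
Proof.
move=> spsi sy Ix Ux; split=> //.
have dy : differentiable y x := smooth_differentiable sy Ix.
have di : differentiable (id : K -> K) x by [].
apply: (@differentiable_comp _ _ _ _ (fun s : K => (s, y s)) psi).
  exact: (differentiable_pair di dy).
exact: smooth_differentiable spsi Ux.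
Qed.

Lemma curve_eval_Delta (U : set (K * K)) (I : set K) (psi : K * K -> K) (y : K -> K) x :
  (0 < n)%N -> smooth U psi -> smooth I y -> I x -> U (x, y x) ->
  curve_eval y (Delta n psi) x = derive1 (fun s => psi (s, y s)) x.
Proof.
move=> n0 spsi sy Ix Ux.
have oc : order_le n.-1 (cstJ n psi) by exact: order_le_cst.
have [_ <-] := curve_eval_derive n0 sy Ix Ux (coef_smooth_cst spsi) oc.
by congr (derive1 _ x); apply/funext => s; rewrite /curve_eval jet_eval_cst.
Qed.

Lemma eval_along_eq m l (P : ode_poly K n m l) p p' q y x :
  (forall i, p i (x, y x) = p' i (x, y x)) ->
  eval_along p q P y x = eval_along p' q P y x.
Proof.
move=> pp; rewrite /eval_along /specialize.
suff -> : base_point p q (x, y x) = base_point p' q (x, y x) by [].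
apply/funext => i; rewrite /base_point; case: (fintype.split i) => // j.
by case: (fintype.split j).
Qed.

Lemma specialize_eq m l (P : ode_poly K n m l) (p p' : 'I_m -> K * K -> K) q z :
  (forall i, p i z = p' i z) -> specialize p q P z = specialize p' q P z.
Proof.
move=> pp; rewrite /specialize.
suff -> : base_point p q z = base_point p' q z by [].
apply/funext => i; rewrite /base_point; case: (fintype.split i) => // j.
by case: (fintype.split j).
Qed.

Lemma jet_eval_eq0 (P : jet_poly (K := K) n) z v : (forall m, mcoeff m P z = 0) ->
  jet_eval z v P = 0.
Proof. by move=> P0; rewrite jet_evalE big1 // => m _; rewrite P0 mul0r. Qed.

(** [linear_equation] has n coefficients and the system n - 2; [insub] pads the two highest with
    0. *)
Lemma sum_extend (a : 'I_(n - 2) -> K) (F : nat -> K) : (2 <= n)%N ->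
  \sum_(k < n) (if insub (k : nat) is Some i then a i else 0) * F k =
  \sum_(k < n - 2) a k * F k.
Proof.
move=> n2.
pose G (k : nat) := (if insub k is Some i then a i else 0) * F k.
rewrite -(big_mkord xpredT G) (@big_cat_nat _ _ _ (n - 2)) //=; last exact: leq_subr.
rewrite [X in _ + X]big1_seq ?addr0 => [|k].
  rewrite big_mkord; apply: eq_bigr => k _.
  by rewrite /G valK.
rewrite mem_index_iota /= => /andP[nk _]; rewrite /G insubF ?mul0r //.
by apply/negbTE; rewrite -leqNgt.
Qed.

End CurveTransformation.

Lemma jacobian_gradient {K : numFieldType} (phi psi : K * K -> K) z :
  jacobian_det phi psi z != 0 -> pdx psi z != 0 \/ pdy psi z != 0.
Proof.
have H (a b c d : K) : a * c - b * d != 0 -> c != 0 \/ d != 0.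
  have [->|c0] := eqVneq c 0; last by left.
  have [->|d0] := eqVneq d 0; last by right.
  by rewrite !mulr0 subrr eqxx.
exact: H.
Qed.

Section Sufficiency.
Context {R : realType} {K : numFieldType} (Nm : real_norm R K).

Lemma system_linearizable n m l (M N : ode_poly K n m l) : (2 <= n)%N ->
  linearizing_system_consistent M N -> linearizable M N.
Proof.
move=> n2 [U [phi [psi [a [p [q [[oU [z0 Uz]] [sphi spsi sa] [sp sq dN] [S1 S2 S3] S4]]]]]]].
have n0 : (0 < n)%N by exact: ltnW.
have pxy := jacobian_gradient (S4 z0 Uz).
have [U1 [V [al [[oU1 U1z] U1U [oV psiV] sal aE]]]] :=
  factor_through Nm oU Uz spsi sa pxy S2.
(* On a bidisc, which is connected, (iii) makes the parameters equal to their values at z0; these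
   are the constants that [linearizable] asks for. *)
have [r r0 BU] := open_ex_bidisc Nm oU Uz.
pose B := disc Nm z0.1 r `*` disc Nm z0.2 r.
have oB : open B by exact: open_bidisc.
pose U' := U1 `&` B.
have U'U : U' `<=` U by move=> z [/U1U].
have pE i z : U' z -> p i z = p i z0.
  by move=> [_ Bz]; apply: (locally_constant BU r0 (sp i) (S3 i)).
pose c i := p i z0.
pose b (k : 'I_n) (t : K) : K :=
  if insub (k : nat) is Some i then al i t else 0.
exists U', V, c, q, phi, psi, b; split.
- split; first exact: openI.
  by exists z0; split=> //; split; exact: disc_center.
- split=> [j|z U'z]; first exact: smooth_subset U'U (sq j).
  rewrite (@specialize_eq _ _ _ _ _ _ p); last by move=> i; rewrite pE.
  exact: dN (U'U z U'z).
- split; [exact: smooth_subset U'U sphi|exact: smooth_subset U'U spsi|].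
  by move=> z /U'U; exact: S4.
- split=> // [|k]; first by move=> _ [z [Uz1 _] <-]; apply: psiV; exists z.
  rewrite /b; case: insubP => [i _ _|_]; first exact: sal.
  exact: (smooth_cst (0 : K)).
move=> I T y u oI sy oT su HI Htr x Ix.
have [U'x N0] := HI x Ix.
have Ux : U (x, y x) by exact: U'U.
have [U1x _] := U'x.
have Htau s : I s -> U (s, y s) /\ derive1 (fun s => psi (s, y s)) s != 0.
  move=> Is; have [/U'U Us _] := HI s Is; have [ts _ _] := Htr s Is.
  by rewrite derive1E.
pose W (k : nat) (s : K) := derive1n k u (psi (s, y s)).
have W0 s : I s -> W 0%N s = phi (s, y s) by move=> Is; have [_ _] := Htr s Is.
have WS k s : (k < n)%N -> I s ->
    has_derive (W k) s (W k.+1 s * derive1 (fun s => psi (s, y s)) s).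
  move=> _ Is; have [Us _] := Htau s Is; have [_ Ts _] := Htr s Is.
  apply: has_derive_comp; first exact: (has_derive_along spsi sy Is Us).
  exact: (smooth_has_derive (smooth_derive1n k su) Ts).
have HU k : (k <= n)%N -> curve_eval y (Ufrac n phi psi k).1 x =
    W k x * derive1 (fun s => psi (s, y s)) x ^+ (Ufrac n phi psi k).2.
  by move=> kn; apply: (Ufrac_curve oU oI sphi spsi sy Htau W0 WS).
have HD := curve_eval_Delta n0 spsi sy Ix Ux.
have := system_value p q a M N n2 HU HD.
have -> : curve_eval y (system_expression M N phi psi a p q) x = 0.
  by apply: jet_eval_eq0 => mon; exact: S1.
have [_ d0] := Htau x Ix; set d := derive1 _ x in d0 *.
have pc i : cst (c i) (x, y x) = p i (x, y x) by rewrite pE.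
rewrite /source_equation /linear_equation.
rewrite !(eval_along_eq _ _ pc); rewrite (eval_along_eq _ _ pc) in N0.
have -> : \sum_(k < n) b k (psi (x, y x)) * derive1n k u (psi (x, y x)) =
    \sum_(k < n - 2) a k (x, y x) * W k x.
  rewrite -(sum_extend (fun k => a k (x, y x)) (fun k => W k x) n2).
  apply: eq_bigr => k _; congr (_ * _); rewrite /b; case: insubP => // i _ _.
  by rewrite (aE i _ U1x).
rewrite -/(W n x) add0r; set S := W n x + _.
have J0 := S4 _ Ux.
move: N0 J0; move: (eval_along p q N y x) (eval_along p q M y x) (derive1n n y x)
  (jacobian_det _ _ _) => e1 e2 yn J e10 J0 E.
split=> H.
  have H' : yn * e1 + e2 = 0.
    have := congr1 ( *%R^~ e1) H; rewrite mul0r mulrDl divfK //.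
  move: E; rewrite H' mulr0 => /eqP; rewrite !mulf_eq0 expf_eq0 (negbTE d0) andbF.
  by rewrite (negbTE e10) orbF /= => /eqP.
move: E; rewrite H mulr0 mul0r => /esym/eqP.
rewrite !mulf_eq0 (negbTE J0) expf_eq0 (negbTE d0) andbF /= => /eqP H'.
by apply: (mulIf e10); rewrite mulrDl divfK // mul0r.
Qed.

End Sufficiency.

(** * The Laguerre-Forsyth form *)

(* If G' = g G and eta' = 2 th eta, the functions
   Y_j = G eta^j (d/dh)^j (u / G), where dh = eta dt, satisfy
   Y_j' = (g + 2 j th) Y_j + Y_(j+1).  Here gauge_seq u j is Y_j, and gauge_coef k j
   is the coefficient of Y_j in the k-th derivative of u. *)
Section Gauge.
Context {K : numFieldType}.
Variables (V : set K) (g th : K -> K).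
Hypotheses (oV : open V) (sg : smooth V g) (sth : smooth V th).

Definition gauge_weight (j : nat) : K -> K := g + (th *+ (2 * j)).

Lemma smooth_gauge_weight j : smooth V (gauge_weight j).
Proof. by apply: smoothD => //; exact: smoothMn. Qed.

Fixpoint gauge_coef (k : nat) : nat -> K -> K :=
  if k is k'.+1 then fun j =>
    derive1 (gauge_coef k' j) + gauge_weight j * gauge_coef k' j +
    (if j is j'.+1 then gauge_coef k' j' else cst 0)
  else fun j => if j is 0%N then cst 1 else cst 0.

Lemma smooth_gauge_coef k j : smooth V (gauge_coef k j).
Proof.
elim: k j => [|k IHk] j /=; first by case: j => [|j]; exact: smooth_cst.
apply: smoothD => //; last by case: j => [|j] //; exact: smooth_cst.
apply: smoothD => //; first exact: smooth_derive1.
by apply: smoothM => //; exact: smooth_gauge_weight.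
Qed.

Lemma gauge_coef_big k j : (k < j)%N -> gauge_coef k j = cst 0.
Proof.
elim: k j => [|k IHk] [|j] //= kj; rewrite !IHk // ?(leqW kj) //; last exact: ltnW.
apply/funext => t; rewrite -[LHS]/((derive1 (cst 0) t : K) + gauge_weight j.+1 t * 0 + 0).
by rewrite derive1E derive_cst mulr0 !addr0.
Qed.

Fixpoint gauge_seq (u : K -> K) (j : nat) : K -> K :=
  if j is j'.+1 then derive1 (gauge_seq u j') - gauge_weight j' * gauge_seq u j'
  else u.

Section Sequence.
Variables (T : set K) (u : K -> K).
Hypotheses (oT : open T) (su : smooth T u).
Let O := T `&` V.

Let oO : open O. Proof. exact: openI. Qed.

Lemma smooth_gauge_seq j : smooth O (gauge_seq u j).
Proof.
elim: j => [|j IHj] /=; first by apply: smooth_subset su => t [].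
apply: smoothB => //; first exact: smooth_derive1.
apply: smoothM => //; apply: smooth_subset (smooth_gauge_weight j).
by move=> t [].
Qed.

Lemma gauge_seq_derive j t : O t ->
  has_derive (gauge_seq u j) t
    (gauge_weight j t * gauge_seq u j t + gauge_seq u j.+1 t).
Proof.
move=> Ot; have [d e] := smooth_has_derive (smooth_gauge_seq j) Ot; split=> //=.
rewrite -[(_ - _) t]/((derive1 (gauge_seq u j) t : K) - gauge_weight j t * gauge_seq u j t).
by rewrite addrC subrK.
Qed.

(** The sum runs up to n for every k, with vanishing coefficients beyond k, so that the expansions
    of all derivatives can be added termwise. *)
Lemma derive_gauge_expansion n k t : (k <= n)%N -> O t ->
  derive1n k u t = \sum_(j < n.+1) gauge_coef k j t * gauge_seq u j t.
Proof.
elim: k t => [|k IHk] t kn Ot.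
  rewrite big_ord_recl /= big1 ?addr0 ?mul1r // => j _.
  by rewrite mul0r.
have H : has_derive (derive1n k u) t (\sum_(j < n.+1)
   ((derive1 (gauge_coef k j) t : K) * gauge_seq u j t +
    gauge_coef k j t * (gauge_weight j t * gauge_seq u j t + gauge_seq u j.+1 t))).
  apply: (has_derive_eq oO Ot (fun s Os => esym (IHk s (ltnW kn) Os))).
  apply: has_derive_sum => j; apply: has_deriveM; last exact: gauge_seq_derive.
  have [_ Vt] := Ot; exact: (smooth_has_derive (smooth_gauge_coef k j) Vt).
have [_ E] := H; rewrite derive1nS E.
pose prev (j : nat) : K := if j is j'.+1 then gauge_coef k j' t else 0.
have coefS j : gauge_coef k.+1 j t =
    (derive1 (gauge_coef k j) t : K) + gauge_weight j t * gauge_coef k j t + prev j.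
  by rewrite /prev; case: j.
have -> : \sum_(j < n.+1) gauge_coef k.+1 j t * gauge_seq u j t =
    \sum_(j < n.+1) ((derive1 (gauge_coef k j) t : K) * gauge_seq u j t +
      gauge_coef k j t * gauge_weight j t * gauge_seq u j t) +
    \sum_(j < n.+1) prev j * gauge_seq u j t.
  by rewrite -big_split; apply: eq_bigr => j _; rewrite coefS mulrDl mulrDl; congr (_ + _ + _); rewrite -!mulrA mulrCA.
rewrite [X in _ = _ + X]big_ord_recl mul0r add0r.
have -> : \sum_(i < n) prev (lift ord0 i) * gauge_seq u (lift ord0 i) t =
    \sum_(i < n.+1) gauge_coef k i t * gauge_seq u i.+1 t.
  rewrite [RHS]big_ord_recr /= gauge_coef_big //= /cst mul0r addr0.
  by apply: eq_bigr => i _.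
by rewrite -big_split /=; apply: eq_bigr => j _; ring.
Qed.

End Sequence.

Lemma gauge_coef_diag k t : V t -> gauge_coef k k t = 1.
Proof.
move=> Vt; elim: k => [//|k IHk] /=.
rewrite gauge_coef_big // -[LHS]/((derive1 (cst 0) t : K) + gauge_weight k.+1 t * 0 + gauge_coef k k t).
by rewrite derive1E derive_cst mulr0 !add0r.
Qed.

(** The recursion adds up the weights g + 2 j th over j <= k. *)
Lemma gauge_coef_diag1 k t : V t ->
  gauge_coef k.+1 k t = k.+1%:R * g t + (k%:R * k.+1%:R) * th t.
Proof.
move=> Vt; have dd j : (derive1 (gauge_coef j j) t : K) = 0.
  have E s : V s -> cst 1 s = gauge_coef j j s by move=> Vs; rewrite gauge_coef_diag.
  by rewrite -(derive1_near_eq oV Vt E) derive1E derive_cst.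
have weightE j : gauge_weight j t = g t + (2 * j)%:R * th t.
  by rewrite -[LHS]/(g t + (th *+ (2 * j)) t) natmulfctE mulr_natl.
elim: k => [|k IHk].
  rewrite -[LHS]/((derive1 (gauge_coef 0 0) t : K) + gauge_weight 0 t * 1 + 0).
  by rewrite dd weightE muln0; ring.
rewrite -[LHS]/((derive1 (gauge_coef k.+1 k.+1) t : K) + gauge_weight k.+1 t * gauge_coef k.+1 k.+1 t
   + gauge_coef k.+1 k t) dd IHk gauge_coef_diag // weightE natrM -!natr1; ring.
Qed.

(** The recursion sums c_j' + (g + 2 j th) c_j over j <= k, where c_j = (j + 1) g + j (j + 1) th is
    the coefficient of [gauge_coef_diag1]. *)
Lemma gauge_coef_diag2 k t : V t ->
  gauge_coef k.+2 k t = k.+1%:R * k.+2%:R / 2 * ((derive1 g t : K) + g t ^+ 2) +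
   k%:R * k.+1%:R * k.+2%:R / 3 * ((derive1 th t : K) + 3 * (g t * th t)) +
   k%:R * k.+1%:R * k.+2%:R * (3 * k%:R + 1) / 6 * th t ^+ 2.
Proof.
move=> Vt.
have dd j : (derive1 (gauge_coef j.+1 j) t : K) = j.+1%:R * (derive1 g t : K) + (j%:R * j.+1%:R) * (derive1 th t : K).
  have E s : V s -> (j.+1%:R * g s + (j%:R * j.+1%:R) * th s) = gauge_coef j.+1 j s.
    by move=> Vs; rewrite gauge_coef_diag1.
  rewrite -(derive1_near_eq oV Vt E).
  have Hg := smooth_has_derive sg Vt; have Ht := smooth_has_derive sth Vt.
  have [_ ->] := has_deriveD (has_deriveM (has_derive_cst j.+1%:R t) Hg)
    (has_deriveM (has_derive_cst (j%:R * j.+1%:R) t) Ht).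
  by rewrite !mul0r !add0r.
have weightE j : gauge_weight j t = g t + (2 * j)%:R * th t.
  by rewrite -[LHS]/(g t + (th *+ (2 * j)) t) natmulfctE mulr_natl.
elim: k => [|k IHk].
  rewrite -[LHS]/((derive1 (gauge_coef 1 0) t : K) + gauge_weight 0 t * gauge_coef 1 0 t + 0).
  rewrite dd weightE gauge_coef_diag1 // muln0; field; rewrite ?pnatr_eq0 //.
rewrite -[LHS]/((derive1 (gauge_coef k.+2 k.+1) t : K) + gauge_weight k.+1 t * gauge_coef k.+2 k.+1 t
   + gauge_coef k.+2 k t) dd IHk gauge_coef_diag1 // weightE natrM -!natr1; field; rewrite ?pnatr_eq0 //.
Qed.

End Gauge.

Section LaguerreForsyth.
Context {R : realType} {K : numFieldType} (Nm : real_norm R K).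

Lemma smooth_nonzero_near (U : set K) (f : K -> K) (z : K) : open U -> U z -> smooth U f ->
  f z != 0 -> exists2 r : R, 0 < r & disc Nm z r `<=` U /\ forall w, disc Nm z r w -> f w != 0.
Proof.
move=> oU Uz sf f0.
have cf := differentiable_continuous (smooth_differentiable sf Uz).
have nf : nbhs z [set w | f w != 0].
  have H : nbhs z (f @^-1` disc Nm (f z) (rnorm Nm (f z))).
    exact: (cf _ (@disc_nbhs _ _ Nm (f z) _ (cnorm_gt0 Nm f0))).
  apply: filterS H => w.
  by rewrite /disc /=; apply: contraTneq => ->; rewrite sub0r cnormN ltxx.
have nU : nbhs z U by exact: open_nbhs_nbhs.
have [r r0 rP] := nbhs_disc Nm (filterI nU nf).
by exists r => //; split=> w /rP[].
Qed.

(* theta = - w' / w turns the Riccati equation theta' = theta^2 - q into the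
   linear equation w'' = q w. *)
Lemma riccati_solution (U : set K) (q : K -> K) (t0 : K) : open U -> U t0 -> smooth U q ->
  exists2 r : R, 0 < r & disc Nm t0 r `<=` U /\ exists w th : K -> K,
   [/\ smooth (disc Nm t0 r) w, smooth (disc Nm t0 r) th,
       forall t, disc Nm t0 r t -> w t != 0
     & forall t, disc Nm t0 r t -> derive1 w t = - th t * w t /\
         derive1 th t = th t ^+ 2 - q t].
Proof.
move=> oU Ut sq; have sc c : smooth U (cst c : K -> K) by exact: smooth_cst.
have [r1 r10 [D1 [F [H [sF sH F0 H0 FH]]]]] :=
  linear_system_solution Nm 1 0 oU Ut (sc 0) (sc 1) sq (sc 0).
have oD1 : open (disc Nm t0 r1) by exact: open_disc.
have F0' : F t0 != 0 by rewrite F0 oner_eq0.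
have [r r0 [rD Fn0]] := smooth_nonzero_near oD1 (disc_center Nm t0 r10) sF F0'.
have oD : open (disc Nm t0 r) by exact: open_disc.
have sF' := smooth_subset rD sF; have sH' := smooth_subset rD sH.
pose th : K -> K := - H * (fun t => (F t)^-1).
have sth : smooth (disc Nm t0 r) th.
  by apply: smoothM => //; [exact: smoothN | exact: smoothV].
exists r => //; split; first by move=> t /rD /D1.
exists F, th; split=> // t Dt.
have Fn := Fn0 t Dt; have [F' H'] := FH t (rD t Dt).
have F1 : derive1 F t = H t by rewrite F' /cst mul0r mul1r add0r.
have H1 : derive1 H t = q t * F t by rewrite H' /cst mul0r addr0.
have thE : th t = - H t / F t by [].
split; first by rewrite F1 thE; field.
have dF := smooth_differentiable sF' Dt; have dH := smooth_differentiable sH' Dt.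
have hN : has_derive (fun s => - H s) t (- 1 * derive1 H t).
  have -> : (fun s => - H s) = (fun s => cst (-1) s * H s).
    by apply/funext => s; rewrite mulN1r.
  have := has_deriveM (has_derive_cst (-1) t) (smooth_has_derive sH' Dt).
  by rewrite mul0r add0r.
have hV : has_derive (fun s => (F s)^-1) t (- derive1 F t / F t ^+ 2).
  by split; [exact: differentiableV | exact: derive1V].
have [_ ->] := has_deriveM hN hV.
rewrite F1 H1 thE; move: (H t) (F t) (q t) Fn => h f k f0; field.
exact: f0.
Qed.

(** G is an exponential of an antiderivative of gam, and h' = w^-2 has logarithmic derivative 2 th
    because that of w is - th. *)
Lemma gauge_fixing (U : set K) (gam w th : K -> K) (t0 : K) (r : R) : 0 < r ->
  smooth (disc Nm t0 r) gam -> smooth (disc Nm t0 r) w -> smooth (disc Nm t0 r) th ->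
  (forall t, disc Nm t0 r t -> w t != 0) ->
  (forall t, disc Nm t0 r t -> derive1 w t = - th t * w t) ->
  exists2 r' : R, 0 < r' & disc Nm t0 r' `<=` disc Nm t0 r /\ exists G h : K -> K,
   [/\ smooth (disc Nm t0 r') G, smooth (disc Nm t0 r') h,
       forall t, disc Nm t0 r' t -> G t != 0 /\ derive1 h t != 0,
       forall t, disc Nm t0 r' t -> derive1 G t = gam t * G t
     & forall t, disc Nm t0 r' t -> derive1 (derive1 h) t = 2 * th t * derive1 h t].
Proof.
move=> r0 sgam sw sth wn0 w'.
have oD : open (disc Nm t0 r) by exact: open_disc.
have Dt0 : disc Nm t0 r t0 by exact: disc_center.
have sc c : smooth (disc Nm t0 r) (cst c : K -> K) by exact: smooth_cst.
pose wi : K -> K := fun t => (w t)^-1.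
have swi : smooth (disc Nm t0 r) wi by exact: smoothV.
pose eta : K -> K := wi * wi.
have seta : smooth (disc Nm t0 r) eta by exact: smoothM.
have [r1 r10 [D1 [G [G2 [sG sG2 G0 _ HG]]]]] :=
  linear_system_solution Nm 1 0 oD Dt0 sgam (sc 0) (sc 0) (sc 0).
(* The second unknown k is constantly 1, which makes h an antiderivative of eta. *)
have [r2 r20 [D2 [h [k [sh sk h0 k0 Hh]]]]] :=
  linear_system_solution Nm 0 1 oD Dt0 (sc 0) seta (sc 0) (sc 0).
have oD1 : open (disc Nm t0 r1) by exact: open_disc.
have G0' : G t0 != 0 by rewrite G0 oner_eq0.
have [r3 r30 [D3 Gn0]] := smooth_nonzero_near oD1 (disc_center Nm t0 r10) sG G0'.
pose r' := Num.min r2 r3.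
have r'0 : 0 < r' by rewrite lt_min r20.
have sub2 : disc Nm t0 r' `<=` disc Nm t0 r2.
  by move=> t; rewrite /disc /r' /= lt_min => /andP[].
have sub3 : disc Nm t0 r' `<=` disc Nm t0 r3.
  by move=> t; rewrite /disc /r' /= lt_min => /andP[].
have k1 t : disc Nm t0 r2 t -> k t = 1.
  move=> Dt; rewrite -k0.
  apply: (@disc_constant _ _ Nm k t0 r2 t t0 _ Dt (disc_center Nm t0 r20)) => s Ds.
  have [_ ->] := Hh s Ds; split; first exact: smooth_differentiable sk Ds.
  by rewrite /cst !mul0r addr0.
have h' t : disc Nm t0 r2 t -> derive1 h t = eta t.
  by move=> Dt; have [-> _] := Hh t Dt; rewrite k1 // /cst mul0r add0r mulr1.
exists r' => //; split; first by move=> t /sub2 /D2.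
exists G, h; split.
- by apply: smooth_subset sG => t /sub3 /D3.
- exact: smooth_subset sub2 sh.
- move=> t Dt; split; first by apply: Gn0; exact: sub3.
  rewrite h'; last exact: sub2.
  have := wn0 t (D2 _ (sub2 _ Dt)) => wt.
  by rewrite -[eta t]/((w t)^-1 * (w t)^-1) mulf_neq0 // invr_eq0.
- move=> t Dt; have [-> _] := HG t (D3 _ (sub3 _ Dt)).
  by rewrite /cst mul0r addr0.
- move=> t Dt; have Dt2 := sub2 _ Dt; have Dtr := D2 _ Dt2.
  have oD2 : open (disc Nm t0 r2) by exact: open_disc.
  rewrite (derive1_near_eq oD2 Dt2 h') h' //.
  have dw := smooth_differentiable sw Dtr.
  have hV : has_derive wi t (- derive1 w t / w t ^+ 2).
    by split; [apply: differentiableV => //; exact: wn0 | apply: derive1V => //; exact: wn0].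
  have [_ ->] := has_deriveM hV hV.
  rewrite w' // -[eta t]/((w t)^-1 * (w t)^-1) /wi.
  have := wn0 t Dtr; move: (w t) (th t) => f s f0; field.
  exact: f0.
Qed.

(** Rewritten in the gauge sequence Y_j, the operator has coefficient n g + n (n - 1) th + a_(n-1)
    at Y_(n-1), which the choice of g makes 0. The coefficient at Y_(n-2) is then a multiple of th'
    - th^2 + q, with q depending on a_(n-1) and a_(n-2) only, and the Riccati equation makes it
    0. *)
Lemma laguerre_forsyth (n : nat) (V : set K) (a : nat -> K -> K) (t0 : K) :
  (2 <= n)%N -> open V -> V t0 -> (forall k, smooth V (a k)) ->
  exists (V' : set K) (G h : K -> K) (b : nat -> K -> K),
  [/\ [/\ open V', V' t0 & V' `<=` V], smooth V' G /\ smooth V' h,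
      forall k, smooth V' (b k),
      forall t, V' t -> G t != 0 /\ derive1 h t != 0
    & forall (T : set K) (u : K -> K), open T -> smooth T u ->
      exists W : nat -> K -> K,
      [/\ forall t, (T `&` V') t -> W 0%N t = u t / G t,
          forall k t, (T `&` V') t -> has_derive (W k) t (W k.+1 t * derive1 h t)
        & forall t, (T `&` V') t ->
          derive1n n u t + \sum_(k < n) a k t * derive1n k u t =
          G t * derive1 h t ^+ n * (W n t + \sum_(k < n - 2) b k t * W k t)]].
Proof.
case: n => [//|[//|n]] _ oV Vt0 sa.
(* The order of the equation is kept as an opaque scalar c for the field computations below. *)
have [c cE] : exists c : K, n.+2%:R = c by exists n.+2%:R.
have c0 : c != 0 by rewrite -cE pnatr_eq0.
have c1 : c - 1 != 0 by rewrite -cE -natr1 addrK pnatr_eq0.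
have c2 : c + 1 != 0 by rewrite -cE natr1 pnatr_eq0.
pose al := a n.+1.
(* After substituting for g, the coefficient at Y_(n-2) contains th' with the factor - c (c - 1) (c
   + 1) / 6, and q is the part free of th divided by it. *)
pose q : K -> K := fun t => - 6 / (c * (c - 1) * (c + 1)) *
  ((c - 1) / 2 * (- derive1 al t + al t ^+ 2 / c) - al t ^+ 2 * (c - 1) / c + a n t).
have sq : smooth V q.
  have -> : q = cst (- 6 / (c * (c - 1) * (c + 1))) *
     (cst ((c - 1) / 2) * (- derive1 al + al * al * cst (c^-1)) -
      al * al * cst ((c - 1) / c) + a n).
    by apply/funext => t; rewrite /q expr2 -[al t * al t * (c - 1) / c]mulrA.
  have sal : smooth V al by exact: sa.
  have sc d : smooth V (cst d : K -> K) by exact: smooth_cst.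
  apply: (smoothM oV (sc _)); apply: (smoothD oV); last exact: sa.
  apply: (smoothB oV); last by apply: (smoothM oV) => //; exact: (smoothM oV).
  apply: (smoothM oV (sc _)); apply: (smoothD oV).
    by apply: (smoothN oV); exact: smooth_derive1.
  by apply: (smoothM oV) => //; exact: (smoothM oV).
have [r1 r10 [D1 [w [th [sw sth wn0 Hw]]]]] := riccati_solution oV Vt0 sq.
have oD1 : open (disc Nm t0 r1) by exact: open_disc.
(* The solution g of c g + c (c - 1) th + al = 0. *)
pose gam : K -> K := cst (- (c - 1)) * th + cst (- c^-1) * al.
have sc d (U : set K) : smooth U (cst d : K -> K) by exact: smooth_cst.
have sal1 : smooth (disc Nm t0 r1) al by exact: smooth_subset D1 (sa _).
have sgam : smooth (disc Nm t0 r1) gam.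
  by apply: (smoothD oD1); apply: (smoothM oD1).
have [r r0 [D2 [G [h [sG sh Gh0 G' h'']]]]] :=
  gauge_fixing V r10 sgam sw sth wn0 (fun t Dt => (Hw t Dt).1).
set V' := disc Nm t0 r.
have oV' : open V' by exact: open_disc.
have V'V : V' `<=` V by move=> t /D2 /D1.
have sgam' : smooth V' gam := smooth_subset D2 sgam.
have sth' : smooth V' th := smooth_subset D2 sth.
(* The leading coefficient 1 is included, so that the whole operator is a single sum. *)
pose A k : K -> K := if k == n.+2 then cst 1 else a k.
have sA k : smooth V' (A k).
  by rewrite /A; case: eqP => _; [exact: sc | exact: smooth_subset V'V (sa _)].
(* The coefficient of Y_j in the whole operator. *)
pose e j : K -> K := \sum_(k < n.+3) A k * gauge_coef gam th k j.
pose eta := derive1 h.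
have sse : smooth V' eta by exact: smooth_derive1.
have eta0 t : V' t -> eta t != 0 by move=> /Gh0[].
(* Y_j is G eta^j W_j, and the factor G eta^n is taken out of the equation. *)
pose b j : K -> K := e j * (fun t => (eta t)^-1) ^+ (n.+2 - j).
have se j : smooth V' (e j).
  apply: smooth_sum => // k _; apply: (smoothM oV') => //.
  exact: smooth_gauge_coef.
exists V', G, h, b; split=> //.
- by split=> //; exact: disc_center.
- move=> j; apply: (smoothM oV') => //; apply: smoothX => //; exact: smoothV.
move=> T u oT su.
pose Y := gauge_seq gam th u.
have oO : open (T `&` V') by exact: openI.
(* The k-th derivative of u / G with respect to h. *)
pose W k : K -> K := fun t => Y k t * ((G t)^-1 * (eta t)^-1 ^+ k).
exists W; split.
- by move=> t _; rewrite /W /Y /= expr0 mulr1.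
- move=> k t [Tt Vt]; rewrite /W -/(eta t).
  have HY := gauge_seq_derive oV' sgam' sth' oT su k (conj Tt Vt).
  have dG := smooth_has_derive sG Vt.
  have Gt := (Gh0 t Vt).1; have et := eta0 t Vt.
  have HG : has_derive (fun s => (G s)^-1) t (- gam t / G t).
    have [d _] := dG; split; first exact: differentiableV.
    by rewrite derive1V // G' //; field.
  have He : has_derive (fun s => (eta s)^-1) t (- (2 * th t) / eta t).
    have [d _] := smooth_has_derive sse Vt; split; first exact: differentiableV.
    by rewrite derive1V // h'' // -/eta; field.
  have Hek j : has_derive (fun s => (eta s)^-1 ^+ j) t (- (2 * j)%:R * th t * (eta t)^-1 ^+ j).
    elim: j => [|j IHj]; first by rewrite muln0 oppr0 !mul0r; exact: (has_derive_cst 1).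
    have -> : (fun s => (eta s)^-1 ^+ j.+1) = (fun s => (eta s)^-1 * (eta s)^-1 ^+ j).
      by apply/funext => s; rewrite exprS.
    have -> : - (2 * j.+1)%:R * th t * (eta t)^-1 ^+ j.+1 =
       (- (2 * th t) / eta t) * (eta t)^-1 ^+ j + (eta t)^-1 * (- (2 * j)%:R * th t * (eta t)^-1 ^+ j).
      by rewrite exprS !natrM -natr1; ring.
    exact: has_deriveM.
  have HW := has_deriveM HY (has_deriveM HG (Hek k)).
  set L := (X in has_derive _ t X) in HW.
  suff <- : L = Y k.+1 t * ((G t)^-1 * (eta t)^-1 ^+ k.+1) * eta t by [].
  have wE : gauge_weight gam th k t = gam t + (2 * k)%:R * th t.
    by rewrite -[LHS]/(gam t + (th *+ (2 * k)) t) natmulfctE mulr_natl.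
  rewrite /L wE -/(Y k.+1) -/(Y k) exprS.
  move: (Y k t) (Y k.+1 t) (gam t) (th t) (G t) (eta t) ((2 * k)%:R : K) Gt et.
  move=> y y1 g s f x m f0 x0.
  by field; rewrite ?f0 ?x0.
move=> t Ot; have [Tt Vt] := Ot.
have Gt := (Gh0 t Vt).1; have et := eta0 t Vt.
have step1 : derive1n n.+2 u t + \sum_(k < n.+2) a k t * derive1n k u t =
    \sum_(k < n.+3) A k t * derive1n k u t.
  rewrite [RHS]big_ord_recr /= /A eqxx mul1r addrC; congr (_ + _).
  by apply: eq_bigr => k _; rewrite ltn_eqF.
have step2 : \sum_(k < n.+3) A k t * derive1n k u t = \sum_(j < n.+3) e j t * Y j t.
  under eq_bigr => k _.
    rewrite (derive_gauge_expansion oV' sgam' sth' oT su (ltn_ord k : (k <= n.+2)%N) Ot).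
    rewrite mulr_sumr.
    over.
  rewrite exchange_big /=; apply: eq_bigr => j _.
  rewrite /e fct_sumE mulr_suml; apply: eq_bigr => k _.
  by rewrite -[(A k * _) t]/(A k t * gauge_coef gam th k j t) mulrA.
have e_low j : (forall k : nat, (k < j)%N -> (A k * gauge_coef gam th k j) t = 0).
  by move=> k kj; rewrite gauge_coef_big //; exact: (mulr0 (A k t)).
have eN : e n.+2 t = 1.
  rewrite /e fct_sumE big_ord_recr big1 => [|k _]; last exact: e_low (ltn_ord k).
  rewrite -[LHS]/(0 + A n.+2 t * gauge_coef gam th n.+2 n.+2 t) add0r.
  by rewrite (gauge_coef_diag _ _ _ Vt) /A eqxx mulr1.
have gamE : gam t = - (c - 1) * th t - al t / c.
  by rewrite -[LHS]/(- (c - 1) * th t + - c^-1 * al t); ring.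
have AN : A n.+2 t = 1 by rewrite /A eqxx.
have AN1 : A n.+1 t = al t by rewrite /A ltn_eqF.
have AN2 : A n t = a n t by rewrite /A ltn_eqF.
have cE1 : n.+1%:R = c - 1 :> K by rewrite -cE -[n.+2%:R]natr1 addrK.
have cE2 : n%:R = c - 2 :> K by rewrite -cE -[n.+2%:R]natr1 -[n.+1%:R]natr1; ring.
have eN1 : e n.+1 t = 0.
  rewrite /e fct_sumE 2!big_ord_recr big1 => [|k _]; last exact: e_low (ltn_ord k).
  rewrite -[LHS]/(0 + A n.+1 t * gauge_coef gam th n.+1 n.+1 t +
    A n.+2 t * gauge_coef gam th n.+2 n.+1 t) add0r.
  rewrite (gauge_coef_diag _ _ _ Vt) (gauge_coef_diag1 _ _ oV' _ Vt).
  rewrite AN AN1 gamE cE1 cE; field; exact: c0.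
have dgam : (derive1 gam t : K) = - (c - 1) * (th t ^+ 2 - q t) - (derive1 al t : K) / c.
  have Hth := smooth_has_derive sth' Vt; have Hal := smooth_has_derive (sa n.+1) (V'V t Vt).
  have [_ ->] := has_deriveD (has_deriveM (has_derive_cst (- (c - 1)) t) Hth)
    (has_deriveM (has_derive_cst (- c^-1) t) Hal).
  by rewrite (Hw t (D2 t Vt)).2 /cst; ring.
have eN2 : e n t = 0.
  rewrite /e fct_sumE 3!big_ord_recr big1 => [|k _]; last exact: e_low (ltn_ord k).
  rewrite -[LHS]/(0 + A n t * gauge_coef gam th n n t +
    A n.+1 t * gauge_coef gam th n.+1 n t + A n.+2 t * gauge_coef gam th n.+2 n t) add0r.
  rewrite (gauge_coef_diag _ _ _ Vt) (gauge_coef_diag1 _ _ oV' _ Vt).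
  rewrite (gauge_coef_diag2 oV' sgam' sth' _ Vt) AN AN1 AN2 dgam.
  rewrite (Hw t (D2 t Vt)).2 gamE cE1 cE2 cE /q.
  move: (derive1 al t : K) (al t) (th t) (a n t) => x y s z.
  by field; rewrite c0 c1 c2.
rewrite step1 step2 -/(eta t).
rewrite 3!big_ord_recr /= eN eN1 eN2 !mul0r !addr0 mul1r -/(W n.+2).
have -> : (n.+2 - 2 = n)%N by rewrite subn2.
rewrite addrC mulrDr; congr (_ + _).
  by rewrite /W; move: (G t) (eta t) (Y n.+2 t) Gt et => f x y f0 x0; rewrite exprVn; field; rewrite ?f0 ?expf_neq0.
rewrite mulr_sumr; apply: eq_bigr => k _.
have -> : b k t = e k t * (eta t)^-1 ^+ (n.+2 - k).
  by rewrite -[LHS]/(e k t * ((fun t => (eta t)^-1) ^+ (n.+2 - k)) t) exprfctE.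
rewrite /W.
have kn : (k <= n.+2)%N := leq_trans (ltnW (ltn_ord k)) (leqW (leqnSn n)).
rewrite -{1}(subnK kn) exprD.
move: (e k t) (eta t) (G t) (Y k t) Gt et => E x f y f0 x0.
rewrite !exprVn.
have [p1 p2] : x ^+ (n.+2 - k) != 0 /\ x ^+ k != 0 by split; exact: expf_neq0.
by move: (x ^+ (n.+2 - k)) (x ^+ k) p1 p2 => X1 X2 p1 p2; field; rewrite f0 p1 p2.
Qed.

End LaguerreForsyth.

(** * From a linearization to the system *)

Section LocalInverse.
Context {R : realType} {K : numFieldType} (Nm : real_norm R K).

Lemma open_nonzero : open [set y : K | y != 0].
Proof.
rewrite openE => y /= y0; apply: filterS (@disc_nbhs _ _ Nm y _ (cnorm_gt0 Nm y0)) => w.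
by rewrite /disc /=; apply: contraTneq => ->; rewrite sub0r cnormN ltxx.
Qed.

(** The implicit function theorem for psi (x, y) = tau x, restricted to y = 0. *)
Lemma local_inverse (I : set K) (tau : K -> K) (x0 : K) : open I -> I x0 ->
  smooth I tau -> derive1 tau x0 != 0 ->
  exists (I' T : set K) (g : K -> K),
  [/\ [/\ open I', I' x0 & I' `<=` I], open T, smooth T g, g @` T `<=` I
    & forall x, I' x -> T (tau x) /\ g (tau x) = x].
Proof.
move=> oI Ix st tau0.
pose U : set (K * K) := fun z => I z.1.
have oU : open U.
  by apply: (@open_comp _ _ (fst : K * K -> K) I) => // z _; exact: cvg_fst.
pose psi : K * K -> K := tau \o fst.
have spsi : smooth U psi by apply: (smooth_comp oU st) => //; exact: smooth_fst.
have Uz : U (x0, 0) by [].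
have [d1 _] := is_diff_fst ((x0, 0) : K * K).
have dtau := smooth_differentiable st Ix.
have p0 : pdx psi (x0, 0) != 0.
  by rewrite /psi pdx_comp //= /pdx derive_fst mulr1.
have [r [rho [r0 rho0 BU [X /= [X1 X2 sX _]]]]] := implicit_function Nm oU Uz spsi p0.
pose T := disc Nm (tau x0) rho.
have oT : open T by exact: open_disc.
pose D := disc Nm x0 r.
have oD : open D by exact: open_disc.
have Y0 : disc Nm 0 rho (0 : K) by exact: disc_center.
have DI : D `<=` I by move=> x Dx; exact: (BU (x, 0) (conj Dx Y0)).
exists (D `&` tau @^-1` T), T, (fun t => X (t, 0)); split=> //.
- split; last by move=> x [/DI].
    apply: open_preimage => // x /DI Ix'; exact: smooth_differentiable st Ix'.
  by split; exact: disc_center.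
- apply: (@smooth_comp2 _ _ _ (T `*` disc Nm 0 rho) X id (cst 0)) => //.
  + exact: smooth_id.
  + exact: smooth_cst.
- by move=> _ [t Tt <-]; apply: DI; have [] := X1 (t, 0) (conj Tt Y0).
- by move=> x [Dx Tx]; split=> //; exact: (X2 x 0 Dx Y0 Tx).
Qed.

End LocalInverse.

Section Necessity.
Context {R : realType} {K : numFieldType} (Nm : real_norm R K).

Lemma pdx_mul (f g : K * K -> K) z : differentiable f z -> differentiable g z ->
  pdx (f * g) z = pdx f z * g z + f z * pdx g z.
Proof.
move=> df dg; rewrite /pdx deriveM; try exact: diff_derivable.
by rewrite addrC -[g z *: _]/(g z * _) mulrC.
Qed.

Lemma pdy_mul (f g : K * K -> K) z : differentiable f z -> differentiable g z ->
  pdy (f * g) z = pdy f z * g z + f z * pdy g z.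
Proof.
move=> df dg; rewrite /pdy deriveM; try exact: diff_derivable.
by rewrite addrC -[g z *: _]/(g z * _) mulrC.
Qed.

(** The terms with the derivative of f cancel, since the gradients of f o psi and h o psi are both
    proportional to that of psi. *)
Lemma jacobian_gauge (phi psi : K * K -> K) (f h : K -> K) z :
  differentiable phi z -> differentiable psi z ->
  differentiable f (psi z) -> differentiable h (psi z) ->
  jacobian_det (phi * (f \o psi)) (h \o psi) z =
  f (psi z) * derive1 h (psi z) * jacobian_det phi psi z.
Proof.
move=> dphi dpsi df dh; have dfp : differentiable (f \o psi) z.
  exact: differentiable_comp.
rewrite /jacobian_det -[LHS]/(pdy (phi * (f \o psi)) z * pdx (h \o psi) z -
  pdx (phi * (f \o psi)) z * pdy (h \o psi) z).
rewrite pdx_mul // pdy_mul // !pdx_comp // !pdy_comp //.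
rewrite -[X in _ = _ * X]/(pdy phi z * pdx psi z - pdx phi z * pdy psi z).
rewrite -[(f \o psi) z]/(f (psi z)).
move: (pdx phi z) (pdy phi z) (pdx psi z) (pdy psi z) (f (psi z)) (phi z)
  (derive1 f (psi z) : K) (derive1 h (psi z) : K) => *; ring.
Qed.

Lemma jet_eval_DeltaE n (psi : K * K -> K) z (v : 'I_n -> K) (n0 : (0 < n)%N) :
  jet_eval z v (Delta n psi) = pdx psi z + v (Ordinal n0) * pdy psi z.
Proof.
rewrite /Delta Dtot_cst; apply: etrans (jet_evalD _ _ _ _) _; congr (_ + _).
  exact: jet_eval_cst.
apply: etrans (jet_evalM _ _ _ _) _; congr (_ * _); last exact: jet_eval_cst.
by rewrite (jet_ord (Ordinal n0)); exact: jet_eval_var.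
Qed.

Lemma jet_at_Delta_neq0 n (psi : K * K -> K) z : (0 < n)%N ->
  pdx psi z != 0 \/ pdy psi z != 0 -> jet_at z (Delta n psi) != 0.
Proof.
move=> n0 H; apply/eqP => E.
have Z (v : 'I_n -> K) : pdx psi z + v (Ordinal n0) * pdy psi z = 0.
  by rewrite -jet_eval_DeltaE /jet_eval E meval0.
have := Z (fun=> 0); rewrite mul0r addr0 => px.
have := Z (fun=> 1); rewrite mul1r px add0r => py.
by case: H => /eqP.
Qed.

Lemma jet_at_lift_neq0 n m l (N : ode_poly K n m l) p q z : (0 < n)%N ->
  specialize p q N z != 0 -> jet_at z (lift_ode_poly p q N) != 0.
Proof.
move=> n0; apply: contra_neq => E; apply: meval_eq0 => w.
pose v (i : 'I_n) : K := if insub (i : nat) is Some j then w j else 0.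
have -> : w = fun i : 'I_n.-1 => v (widen_ord (leq_pred n) i).
  by apply/funext => i; rewrite /v /= valK.
by rewrite -jet_eval_lift /jet_eval E meval0.
Qed.

Section Pointwise.
Variables (n m l : nat) (M N : ode_poly K n m l).
Variables (p : 'I_m -> K * K -> K) (q : 'I_l -> K * K -> K).
Variables (U : set (K * K)) (phi psi : K * K -> K) (a : 'I_n -> K -> K).
Hypotheses (n2 : (2 <= n)%N) (oU : open U) (sphi : smooth U phi) (spsi : smooth U psi).
Hypotheses (sp : forall i, smooth U (p i)) (sq : forall i, smooth U (q i)).
Hypothesis linear : maps_to_linear M N p q U phi psi a.

(** The function u is phi along the curve, transported by a local inverse of tau. The source
    equation holds at z.1 by the choice of y^(n), and the pointwise equivalence [linear] carries it
    to psi z. *)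
Lemma generic_solution (z : K * K) (v : 'I_n -> K) : U z ->
  jet_eval z v (lift_ode_poly p q N) != 0 -> jet_eval z v (Delta n psi) != 0 ->
  exists (I T : set K) (y u : K -> K),
  [/\ [/\ open I, I z.1, y z.1 = z.2 & smooth I y],
      [/\ open T, smooth T u, T (psi z) & linear_equation a u (psi z)],
      forall x, I x -> [/\ U (x, y x), derive1 (fun s => psi (s, y s)) x != 0,
        T (psi (x, y x)) & u (psi (x, y x)) = phi (x, y x)],
      forall P : jet_poly n, order_le n.-1 P -> jet_eval z v P = curve_eval y P z.1
    & derive1n n y z.1 * eval_along p q N y z.1 + eval_along p q M y z.1 = 0].
Proof.
move=> Uz e10 d0; have n0 : (0 < n)%N by exact: ltnW.
set e1 := jet_eval z v _ in e10; set x0 := z.1.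
pose e2 := jet_eval z v (lift_ode_poly p q M).
(* The variable of index i is y^(i+1), hence the shift; the value of y^(n) is prescribed by the
   source equation rather than by v. *)
pose w (k : nat) : K := if k == n then - e2 / e1 else if k is k'.+1 then
  (if insub k' is Some i then v i else 0) else z.2.
have [y [sy yw]] := exists_jet n.+1 x0 w.
have y0 : y x0 = z.2 by have := yw 0%N (ltn0Sn n); rewrite /w (ltn_eqF n0).
have zE : (x0, y x0) = z by rewrite y0 -surjective_pairing.
have jetE (P : jet_poly n) : order_le n.-1 P -> jet_eval z v P = curve_eval y P x0.
  move=> oP; rewrite /curve_eval zE; apply: (@jet_eval_order _ _ n.-1) oP _ => i ni.
  rewrite /curve_jet yw ?ltnS // /w.
  by rewrite (ltn_eqF (_ : i.+1 < n)%N) ?valK // -ltn_predRL.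
have syT : smooth setT y by apply: sy; exact: openT.
(* [linear] speaks of curves that stay in U, with N and tau' nonzero throughout; the three open sets
   secure these conditions in turn. *)
pose S1 : set K := fun s => U (s, y s).
have oS1 : open S1.
  apply: (@open_comp _ _ (fun s : K => (s, y s)) U) => // s _.
  apply: differentiable_continuous.
  have di : differentiable (id : K -> K) s by [].
  have dy : differentiable y s by exact: smooth_differentiable syT _.
  exact: (differentiable_pair di dy).
have S1x : S1 x0 by rewrite /S1 zE.
have sy1 : smooth S1 y by exact: sy.
pose tau s := psi (s, y s).
have stau : smooth S1 tau.
  by apply: (@smooth_comp2 _ _ _ U psi id y) => //; exact: smooth_id.
have sN := coef_smooth_lift N oU sp sq.
have oN := @order_le_lift _ _ _ _ p q N.
pose eN := curve_eval y (lift_ode_poly p q N).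
have dN s : S1 s -> differentiable eN s.
  by move=> Ss; have [] := curve_eval_derive n0 sy1 Ss Ss sN oN.
pose S2 := S1 `&` eN @^-1` [set y | y != 0].
have oS2 : open S2.
  by apply: open_preimage => //; exact: (open_nonzero Nm).
pose S3 := S2 `&` (derive1 tau) @^-1` [set y | y != 0].
have oS3 : open S3.
  apply: open_preimage => //; last exact: (open_nonzero Nm).
  by move=> s [Ss _]; exact: (smooth_differentiable (smooth_derive1 stau) Ss).
have tau0 : derive1 tau x0 != 0.
  have oD : order_le n.-1 (Delta n psi).
    by apply: (@order_leW _ _ 1); [rewrite -ltnS prednK | exact: order_le_Delta].
  by rewrite /tau -(curve_eval_Delta n0 spsi sy1 S1x S1x) -(jetE _ oD).
have S3x : S3 x0.
  by split=> //; split=> //=; rewrite /eN -jetE.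
have S31 : S3 `<=` S1 by move=> s [[]].
have [I [T [g [[oI Ix IS3] oT sg gT gK]]]] :=
  local_inverse Nm oS3 S3x (smooth_subset S31 stau) tau0.
pose u t := phi (g t, y (g t)).
have su : smooth T u.
  apply: (@smooth_comp2 _ _ _ U phi g (y \o g)) => //.
    by apply: (smooth_comp oT syT sg).
  by move=> t Tt; apply: (S31 (g t)); apply: gT; exists t.
have tauI x : I x -> [/\ U (x, y x), derive1 tau x != 0, T (tau x) & u (tau x) = phi (x, y x)].
  move=> Ixx; have [Tx gx] := gK x Ixx; have [[Ss Ns] ts] := IS3 x Ixx.
  by split=> //; rewrite /u gx.
have EN : eval_along p q N y x0 = e1 by rewrite eval_along_lift -jetE.
have EM : eval_along p q M y x0 = e2.
  by rewrite eval_along_lift; apply: esym; exact: (jetE _ (@order_le_lift _ _ _ _ p q M)).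
have ynE : derive1n n y x0 = - e2 / e1.
  by rewrite yw // /w eqxx.
have HI x : I x -> U (x, y x) /\ eval_along p q N y x != 0.
  by move=> Ixx; have [[Ss Ns] _] := IS3 x Ixx; rewrite eval_along_lift.
have Htr : transforms phi psi I T y u.
  by move=> x Ixx; have [_ t0 Tx ux] := tauI x Ixx; rewrite -derive1E; split.
have syI : smooth I y by exact: sy.
have [lin _] := linear oI syI oT su HI Htr Ix.
exists I, T, y, u; split=> //.
- split=> //; first by have [_ _ + _] := tauI x0 Ix; rewrite /tau zE.
  have := lin _; rewrite -/x0 zE; apply.
  by rewrite /source_equation EN EM ynE mulNr addNr.
- by rewrite EN EM ynE divfK // addNr.
Qed.

End Pointwise.

(** The hypotheses on G, h and b are the outcome of [laguerre_forsyth]. In the unknown u / G and the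
    variable h the derivatives of the transported function are the W_k, so the numerators for (phi /
    (G o psi), h o psi) can be evaluated along the curve. *)
Lemma gauged_system_generic n m l (M N : ode_poly K n m l) p q (U : set (K * K))
    (phi psi : K * K -> K) (a : nat -> K -> K) (V : set K) (G h : K -> K)
    (b : nat -> K -> K) (z : K * K) (v : 'I_n -> K) :
  (2 <= n)%N -> open U -> smooth U phi -> smooth U psi ->
  (forall i, smooth U (p i)) -> (forall i, smooth U (q i)) ->
  maps_to_linear M N p q U phi psi (fun k : 'I_n => a k) ->
  (forall z, U z -> V (psi z)) -> smooth V G -> smooth V h ->
  (forall t, V t -> G t != 0 /\ derive1 h t != 0) ->
  (forall (T : set K) (u : K -> K), open T -> smooth T u ->
     exists W : nat -> K -> K,
     [/\ forall t, (T `&` V) t -> W 0%N t = u t / G t,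
         forall k t, (T `&` V) t -> has_derive (W k) t (W k.+1 t * derive1 h t)
       & forall t, (T `&` V) t ->
         derive1n n u t + \sum_(k < n) a k t * derive1n k u t =
         G t * derive1 h t ^+ n * (W n t + \sum_(k < n - 2) b k t * W k t)]) ->
  smooth U (phi * ((fun t => (G t)^-1) \o psi)) -> smooth U (h \o psi) ->
  U z -> jet_eval z v (lift_ode_poly p q N) != 0 -> jet_eval z v (Delta n psi) != 0 ->
  jet_eval z v (system_expression M N (phi * ((fun t => (G t)^-1) \o psi)) (h \o psi)
    (fun k : 'I_(n - 2) => b k \o psi) p q) = 0.
Proof.
move=> n2 oU sphi spsi sp sq lin psiV sG sh Gh0 gauge sphi' spsi' Uz N0 D0.
have n0 : (0 < n)%N by exact: ltnW.
have [I [T [y [u [[oI Ix y0 sy] [oT su Tz linz] HI jetE src]]]]] :=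
  generic_solution n2 oU sphi spsi sp sq lin Uz N0 D0.
rewrite jetE; last exact: (@order_le_system _ _ _ _ p q _ _ _ M N n2).
have zE : psi (z.1, y z.1) = psi z by rewrite y0 -surjective_pairing.
have [W [W0 WS Wn]] := gauge T u oT su.
pose tau s := psi (s, y s).
have TV x : I x -> (T `&` V) (tau x).
  by move=> Ixx; have [Ux _ Tx _] := HI x Ixx; split=> //; exact: psiV.
have dtau x : I x -> has_derive tau x (derive1 tau x).
  by move=> Ixx; have [Ux _ _ _] := HI x Ixx; exact: (has_derive_along spsi sy Ixx Ux).
have tau'E x : I x ->
    derive1 (fun s => (h \o psi) (s, y s)) x = derive1 h (tau x) * derive1 tau x.
  move=> Ixx; have [_ Vx] := TV x Ixx.
  have dh : has_derive h (tau x) (derive1 h (tau x)).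
    by split=> //; exact: smooth_differentiable sh Vx.
  by have [] := has_derive_comp (dtau x Ixx) dh.
have Htau x : I x -> U (x, y x) /\ derive1 (fun s => (h \o psi) (s, y s)) x != 0.
  move=> Ixx; have [Ux t0 _ _] := HI x Ixx; split=> //.
  by rewrite tau'E // mulf_neq0 //; have [_ Vx] := TV x Ixx; have [] := Gh0 _ Vx.
have W0' x : I x -> W 0%N (tau x) = (phi * ((fun t => (G t)^-1) \o psi)) (x, y x).
  by move=> Ixx; have [_ _ _ ux] := HI x Ixx; rewrite W0 ?ux //; exact: TV.
have WS' k x : (k < n)%N -> I x -> has_derive (fun s => W k (tau s)) x
    (W k.+1 (tau x) * derive1 (fun s => (h \o psi) (s, y s)) x).
  move=> _ Ixx; rewrite tau'E // mulrA.
  by apply: has_derive_comp; [exact: dtau|apply: WS; exact: TV].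
have HU k : (k <= n)%N -> _ := fun kn =>
  Ufrac_curve oU oI sphi' spsi' sy Htau W0' WS' kn Ix.
have [Ux _] := Htau _ Ix.
have HD := curve_eval_Delta n0 spsi' sy Ix Ux.
have := system_value p q (fun k : 'I_(n - 2) => b k \o psi) M N n2 HU HD.
rewrite src mulr0 addr0 => <-.
have [GV hV] := Gh0 _ (psiV z Uz).
have Wz : W n (psi z) + \sum_(k < n - 2) b k (psi z) * W k (psi z) = 0.
  have := Wn (psi z) (conj Tz (psiV z Uz)); rewrite [LHS]linz => /esym/eqP.
  by rewrite !mulf_eq0 expf_eq0 (negbTE GV) (negbTE hV) andbF /= => /eqP.
rewrite [X in _ * X * _](_ : _ = 0) ?mulr0 ?mul0r //.
by rewrite -[RHS]Wz -zE.
Qed.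

Lemma linearizable_system n m l (M N : ode_poly K n m l) : (2 <= n)%N ->
  linearizable M N -> linearizing_system_consistent M N.
Proof.
move=> n2 [U0 [V0 [c [q [phi [psi [a0 [[oU0 [z0 Uz0]] [sq dN] [sphi spsi J0] [oV0 psiV0 sa0] lin]]]]]]]].
have n0 : (0 < n)%N by exact: ltnW.
pose a (k : nat) : K -> K := if insub k is Some i then a0 i else cst 0.
have sa k : smooth V0 (a k).
  by rewrite /a; case: insubP => [i _ _|_]; [exact: sa0|exact: smooth_cst].
have aE : (fun k : 'I_n => a k) = a0 by apply/funext => k; rewrite /a valK.
have V0z z : U0 z -> V0 (psi z) by move=> Uz; apply: psiV0; exists z.
have [V [G [h [b [[oV Vt0 VV0] [sG sh] sb Gh0 gauge]]]]] :=
  laguerre_forsyth Nm n2 oV0 (V0z z0 Uz0) sa.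
pose U := U0 `&` psi @^-1` V.
have UU0 : U `<=` U0 by move=> z [].
have oU : open U.
  by apply: open_preimage => // z Uz; exact: smooth_differentiable spsi Uz.
have psiV z : U z -> V (psi z) by case.
have {}sphi := smooth_subset UU0 sphi; have {}spsi := smooth_subset UU0 spsi.
have {}sq j := smooth_subset UU0 (sq j).
have sGV : smooth V (fun t => (G t)^-1).
  by apply: smoothV => // t /Gh0 [].
have sphi' : smooth U (phi * ((fun t => (G t)^-1) \o psi)).
  by apply: smoothM => //; exact: (smooth_comp oU sGV spsi).
have spsi' : smooth U (h \o psi) by exact: (smooth_comp oU sh spsi).
have sb' (k : 'I_(n - 2)) : smooth U (b k \o psi).
  exact: (smooth_comp oU (sb k) spsi).
pose p i : K * K -> K := cst (c i).
have sp i : smooth U (p i) by exact: smooth_cst.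
have linU : maps_to_linear M N p q U phi psi (fun k : 'I_n => a k).
  rewrite aE => I T y u oI sy oT su HI; apply: lin => // x Ix.
  by have [/UU0] := HI x Ix.
exists U, (phi * ((fun t => (G t)^-1) \o psi)), (h \o psi),
  (fun k : 'I_(n - 2) => b k \o psi), p, q; split=> //.
- by split=> //; exists z0.
- by split=> // z /UU0; exact: dN.
- split=> [mon z Uz|k z Uz|i z _].
  + rewrite -mcoeff_jet_at.
    suff -> : jet_at z (system_expression M N (phi * ((fun t => (G t)^-1) \o psi))
      (h \o psi) (fun k : 'I_(n - 2) => b k \o psi) p q) = 0 by rewrite mcoeff0.
    have pxy := jacobian_gradient (J0 z (UU0 z Uz)).
    have N0 := jet_at_lift_neq0 n0 (dN z (UU0 z Uz)).
    have D0 := jet_at_Delta_neq0 n0 pxy.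
    set S := jet_at z (system_expression _ _ _ _ _ _ _).
    suff /eqP : S * (jet_at z (lift_ode_poly p q N) * jet_at z (Delta n psi)) = 0.
      by rewrite mulf_eq0 mulf_eq0 (negbTE N0) (negbTE D0) !orbF => /eqP.
    apply: meval_eq0 => v; apply: etrans (mevalM _ _ _) _.
    apply: etrans (congr1 _ (mevalM _ _ _)) _.
    have [E|Nv] := eqVneq (jet_eval z v (lift_ode_poly p q N)) 0.
      by rewrite [X in _ * (X * _)]E mul0r mulr0.
    have [E|Dv] := eqVneq (jet_eval z v (Delta n psi)) 0.
      by rewrite [X in _ * (_ * X)]E !mulr0.
    have E := gauged_system_generic n2 oU sphi spsi sp sq linU psiV sG sh Gh0 gauge
      sphi' spsi' Uz Nv Dv.
    by rewrite [X in X * _]E mul0r.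
  (* For (ii): both functions factor through psi, so their gradients are proportional. *)
  + have dpsi := smooth_differentiable spsi Uz.
    have dh := smooth_differentiable sh (psiV z Uz).
    have db := smooth_differentiable (sb k) (psiV z Uz).
    rewrite -[LHS]/(pdy (h \o psi) z * pdx (b k \o psi) z -
      pdx (h \o psi) z * pdy (b k \o psi) z).
    rewrite !pdx_comp // !pdy_comp //.
    move: (derive1 h (psi z) : K) (derive1 (b k) (psi z) : K) (pdx psi z) (pdy psi z).
    by move=> *; ring.
  + by rewrite /pdx /pdy /p !derive_cst.
- move=> z Uz; have [Gz hz] := Gh0 _ (psiV z Uz).
  rewrite jacobian_gauge; last first.
  + exact: smooth_differentiable sh (psiV z Uz).
  + exact: smooth_differentiable sGV (psiV z Uz).
  + exact: smooth_differentiable spsi Uz.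
  + exact: smooth_differentiable sphi Uz.
  by rewrite !mulf_neq0 ?invr_eq0 //; exact: J0 (UU0 z Uz).
Qed.

End Necessity.

(** * The complex numbers *)

Section ComplexNumbers.
Context {R : realType}.
Local Notation C := (complex R).

(** The intervals of centre u k and radius 2 B / 2^k, the sum of all later steps, are nested; the
    supremum of their left ends lies in each of them. *)
Lemma geometric_limit (u : nat -> R) (B : R) :
  (forall k, `|u k.+1 - u k| <= B / 2 ^+ k) ->
  exists l, forall k, `|l - u k| <= 2 * B / 2 ^+ k.
Proof.
move=> uB; pose e k := 2 * B / 2 ^+ k.
have eS k : e k.+1 = e k - B / 2 ^+ k.
  by rewrite /e exprS invfM; field; rewrite expf_neq0 // pnatr_eq0.
have e0 k : 0 <= e k.
  have := le_trans (normr_ge0 _) (uB k); rewrite /e -mulrA.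
  by move=> H; rewrite mulr_ge0.
have lo : {homo (fun k => u k - e k) : i j / (i <= j)%N >-> i <= j}.
  apply/nondecreasing_seqP => k; have := uB k; rewrite eS ler_norml => /andP[H _].
  by move: H; lra.
have hi : {homo (fun k => u k + e k) : i j / (i <= j)%N >-> j <= i}.
  apply/nonincreasing_seqP => k; have := uB k; rewrite eS ler_norml => /andP[_ H].
  by move: H; lra.
have lohi i k : u i - e i <= u k + e k.
  apply: le_trans (lo i (maxn i k) (leq_maxl _ _)) _.
  apply: le_trans _ (hi k (maxn i k) (leq_maxr _ _)).
  by have := e0 (maxn i k); lra.
pose A := range (fun k => u k - e k).
have A0 : A !=set0 by exists (u 0%N - e 0%N), 0%N.
exists (sup A) => k; rewrite ler_norml; apply/andP; split.
  have : u k - e k <= sup A.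
    by apply: ub_le_sup; [exists (u 0%N + e 0%N) => _ [i _ <-]|exists k].
  by rewrite -/(e k); lra.
have : sup A <= u k + e k by apply: ge_sup => // _ [i _ <-].
by rewrite -/(e k); lra.
Qed.

Definition cplx_abs (z : C) : R := Num.sqrt (complex.Re z ^+ 2 + complex.Im z ^+ 2).

Lemma cplx_abs_Re (z : C) : `|complex.Re z| <= cplx_abs z.
Proof. by rewrite -sqrtr_sqr ler_wsqrtr // lerDl sqr_ge0. Qed.

Lemma cplx_abs_Im (z : C) : `|complex.Im z| <= cplx_abs z.
Proof. by rewrite -sqrtr_sqr ler_wsqrtr // lerDr sqr_ge0. Qed.

Lemma cplx_abs_le (z : C) : cplx_abs z <= `|complex.Re z| + `|complex.Im z|.
Proof.
rewrite -[leRHS]ger0_norm ?addr_ge0 // -sqrtr_sqr ler_wsqrtr //.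
by rewrite sqrrD !real_normK ?num_real // lerD2r lerDl mulrn_wge0 ?mulr_ge0.
Qed.

(** The real and imaginary parts converge separately, each with the constant 2 of [geometric_limit];
    together they give 4. *)
Lemma cplx_abs_complete (u : nat -> C) (B : R) :
  (forall k, cplx_abs (u k.+1 - u k) <= B / 2 ^+ k) ->
  exists l, forall k, cplx_abs (l - u k) <= 4 * B / 2 ^+ k.
Proof.
have ReB (z w : C) : complex.Re (z - w) = complex.Re z - complex.Re w.
  by case: z w => [a b] [c d].
have ImB (z w : C) : complex.Im (z - w) = complex.Im z - complex.Im w.
  by case: z w => [a b] [c d].
move=> uB.
have [|a aE] := @geometric_limit (fun k => complex.Re (u k)) B.
  by move=> k; rewrite -ReB; exact: le_trans (cplx_abs_Re _) (uB k).
have [|b bE] := @geometric_limit (fun k => complex.Im (u k)) B.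
  by move=> k; rewrite -ImB; exact: le_trans (cplx_abs_Im _) (uB k).
exists (complex.Complex a b) => k; apply: le_trans (cplx_abs_le _) _.
rewrite ReB ImB /=; apply: le_trans (lerD (aE k) (bE k)) _.
by rewrite -mulrDl -mulrDl -natrD.
Qed.

Definition complex_real_norm : real_norm R C :=
  @RealNorm R C (complex.real_complex R) cplx_abs (@complex.lecR R)
    (@complex.normc_def R) cplx_abs_complete.

End ComplexNumbers.

Theorem theorem3 (R : realType) (n m l : nat)
    (M N : ode_poly (complex R) n m l) (hn : (2 <= n)%N) (hN : N != 0) :
  linearizable M N <-> linearizing_system_consistent M N.
Proof.
split; first exact: (linearizable_system complex_real_norm hn).
exact: (system_linearizable complex_real_norm hn).
Qed.
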